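(* Let $S$ be a finite set of rational primes. When quadratic fields are ordered by absolute discriminant, (i) the average size of $\mathcal{O}_{K,S}^\times/(\mathcal{O}_{K,S}^\times)^3$ as $K$ ranges over real quadratic fields is equal to $$3^{|S|+1}\prod_{p\in S}\left(1+\frac{p}{p+1}\right);$$ and (ii) the average size of $\mathcal{O}_{K,S}^\times/(\mathcal{O}_{K,S}^\times)^3$ as $K$ ranges over imaginary quadratic fields is equal to $$3^{|S|}\prod_{p\in S}\left(1+\frac{p}{p+1}\right).$$
   Context: For a quadratic field $K$ (a degree $2$ extension of $\mathbb{Q}$, considered up to isomorphism) with ring of integers $\mathcal{O}_K$ and discriminant $d_K$, let $S_K$ be the set of primes of $\mathcal{O}_K$ lying above the primes in $S$, and let $\mathcal{O}_{K,S}^\times$ be the group of $S_K$-units of $K$, i.e. the $\alpha\in K^\times$ with $\mathrm{val}_{\mathfrak p}(\alpha)=0$ for all primes $\mathfrak p\notin S_K$ of $\mathcal{O}_K$. For a family $\mathcal{F}$ of quadratic fields ordered by absolute discriminant, the average of a quantity $f(K)$ over $\mathcal{F}$ is $\lim_{X\to\infty}\left(\sum_{K\in\mathcal{F},\,|d_K|<X} f(K)\right)/\left|\{K\in\mathcal{F}: |d_K|<X\}\right|$. *)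

(* Defs.v *)
From HB Require Import structures.
From mathcomp Require Import all_boot all_order all_algebra all_field.
From mathcomp Require Import finmap.
From mathcomp Require Import all_classical all_reals all_analysis.
Set Implicit Arguments.
Unset Strict Implicit.
Unset Printing Implicit Defensive.
Import Order.TTheory GRing.Theory Num.Theory.
Import numFieldNormedType.Exports.
Local Open Scope classical_set_scope.
Local Open Scope ring_scope.

Section NumberField.
Variable K : fieldExtType rat.

Definition ring_of_integers : set K :=
  [set x | integralOver (intr : int -> K) x].

Local Notation O := ring_of_integers.

Definition field_trace (x : K) : rat :=
  \sum_(i < \dim {:K}) coord (vbasis {:K}) i (x * (vbasis {:K})`_i).

Definition integral_basis (w : (\dim {:K}).-tuple K) : Prop :=
  basis_of {:K} w /\
  forall x, O x <-> exists c : 'I_(\dim {:K}) -> int,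
    x = \sum_(i < \dim {:K}) w`_i *~ c i.

Definition is_discriminant (d : int) : Prop :=
  exists2 w : (\dim {:K}).-tuple K, integral_basis w &
    d%:~R = \det (\matrix_(i < \dim {:K}, j < \dim {:K}) field_trace (w`_i * w`_j)).

(* Every number field has exactly one discriminant, so the default value 0
   is never used. *)
Definition discriminant : int := xget 0 is_discriminant.

Definition nonzero_prime_ideal (P : set K) : Prop :=
  [/\ P `<=` O,
      [/\ P 0, forall x y, P x -> P y -> P (x + y)
        & forall a x, O a -> P x -> P (a * x)],
      ~ P 1,
      forall x y, O x -> O y -> P (x * y) -> P x \/ P y
    & exists2 x, P x & x != 0].

Definition lies_above (P : set K) (p : nat) : Prop :=
  forall n : int, P n%:~R <-> (p %| n)%Z.

Definition primes_above (S : {fset nat}) (P : set K) : Prop :=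
  nonzero_prime_ideal P /\ exists2 p, p \in S & lies_above P p.

Definition ideal_mul (I J : set K) : set K :=
  [set x | exists n (a b : 'I_n -> K),
    (forall i, I (a i) /\ J (b i)) /\ x = \sum_i a i * b i].

Definition ideal_exp (I : set K) (n : nat) : set K := iter n (ideal_mul I) O.

(* The exponent of P in the factorization of the ideal (a), for 0 != a in O:
   the powers of P decrease, so it is the n with a in P^n but not in P^n.+1. *)
Definition ideal_val (P : set K) (a : K) (n : nat) : Prop :=
  ideal_exp P n a /\ ~ ideal_exp P n.+1 a.

(* The graph of val_P : K^* -> Z. *)
Definition has_val (P : set K) (x : K) (v : int) : Prop :=
  exists a b m n, [/\ O a /\ a != 0, O b /\ b != 0, x = a / b,
    ideal_val P a m /\ ideal_val P b n & v = m%:Z - n%:Z].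

Definition S_units (S : {fset nat}) : set K :=
  [set x | x != 0 /\ forall P, nonzero_prime_ideal P -> ~ primes_above S P ->
    has_val P x 0].

Definition quotient_by_cubes (U : set K) : set (set K) :=
  [set [set x * y ^+ 3 | y in U] | x in U].

(* |U / U^3|; fset_set sends an infinite set to fset0, but this quotient is
   finite for U = S_units S, by Dirichlet's S-unit theorem. *)
Definition card_quotient_by_cubes (U : set K) : nat :=
  #|` fset_set (quotient_by_cubes U)|%fset.

Definition quadratic : Prop := \dim {:K} = 2%N.

Definition real_quadratic : Prop :=
  quadratic /\ forall (s : {rmorphism K -> algC}) x, s x \is Num.real.

Definition imaginary_quadratic : Prop :=
  quadratic /\
  forall s : {rmorphism K -> algC}, exists x, s x \isn't Num.real.

End NumberField.

Definition field_isomorphic (K L : fieldExtType rat) : Prop :=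
  exists f : {rmorphism K -> L}, bijective f.

(* k lists, once per isomorphism class, the fields in F with |d_K| < X. *)
Definition enumerates_below (R : realType) (F : fieldExtType rat -> Prop)
    (X : R) (N : nat) (k : 'I_N -> fieldExtType rat) : Prop :=
  [/\ forall i, F (k i) /\ `|discriminant (k i)|%:~R < X,
      forall i j, field_isomorphic (k i) (k j) -> i = j
    & forall K, F K -> `|discriminant K|%:~R < X ->
        exists i, field_isomorphic K (k i)].

(* The average over F, up to isomorphism, of f is l. The first conjunct says
   that the sums are finite; the second does not depend on the
   representatives chosen, as it quantifies over all choices. *)
Definition average_is (R : realType) (F : fieldExtType rat -> Prop)
    (f : fieldExtType rat -> nat) (l : R) : Prop :=
  (forall X : R, exists (N : nat) (k : 'I_N -> fieldExtType rat),
     enumerates_below F X k) /\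
  forall (N : R -> nat) (k : forall X, 'I_(N X) -> fieldExtType rat),
    (forall X, enumerates_below F X (k X)) ->
    (\sum_(i < N X) (f (k X i))%:R) / (N X)%:R @[X --> +oo] --> l.

(* Main.v *)
Require Import Defs.
From HB Require Import structures.
From mathcomp Require Import all_boot all_order all_algebra all_field.
From mathcomp Require Import finmap.
From mathcomp Require Import all_classical all_reals all_analysis.
From mathcomp Require Import zify ring lra.
(* For a quadratic field K of discriminant d with O = Z[w], write U for the
   S-units and g for the number of p in S that split. The homomorphisms
   v_p o Norm (p in S) and v_P - v_P' (p = P P' split in S) from U to Z are
   nonzero on the common kernel of the preceding ones, and each of them splits
   off a factor Z, so |U / U^3| = 3 ^ (|S| + g) |O^* / (O^* )^3|; the last factor
   is 3 for d > 0 (Pell) and 1 for d < 0, except for d = -3, a single field that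
   does not affect the average. Finiteness of the class group is not needed: a
   p-unit with v_P <> v_P' comes from Thue's lemma in the powers of P and the
   pigeonhole principle, as in the usual proof of Pell's equation.
   As 3 ^ g = prod_(p in S) (1 + 2 [p splits]), it remains to average this over
   fundamental discriminants. Being fundamental and splitting at p are
   conditions modulo p^2 (modulo 16 if p = 2), so up to an error
   O(n / z) coming from divisibility by the squares of primes p >= z the two
   counting functions are sums of periodic functions, whose means are products
   of local means; the ratio of the local means at p in S is 1 + p / (p + 1). *)

Set Implicit Arguments.
Unset Strict Implicit.
Unset Printing Implicit Defensive.
Import Order.TTheory GRing.Theory Num.Theory.
Import numFieldNormedType.Exports.
Local Open Scope ring_scope.

(** * Arithmetic of quadratic orders *)

(** The obstacle on the algebraic side is that valuations are given as relations on powers of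
    ideals. [S_unitsE] eliminates them: x is an S-unit iff x and 1 / x have denominators composed of
    primes in S. The passage rests on explicit primes (q, w - r) or (q) and explicit local inverses.
    From then on v_P at a split prime is an integer computation: a + b w is evaluated at a Hensel
    root modulo a power of p that exceeds the valuation of the norm. Working modulo cubes hides
    every quotient of exponent prime to 3, so it suffices that fourth powers of units are 1 for d <
    -3 and that squares of units are positive of norm 1 for d > 0. On the analytic side the sums for
    S and for the empty set are sieved with the same cutoff z. Their main terms have the same ratio
    for every z, so the limit in z is replaced by a lower bound for the product of local means that
    is uniform in z. The cutoff z is fixed from eps first, and only then does n grow, because the
    period of the sieved weight depends on z. *)

(* d is a fundamental discriminant (or 1) iff this holds for all primes p: the
   residues modulo 16 are those of d = 1 mod 4 and of d = 4 m, m = 2, 3 mod 4. *)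
Definition fundamental_at (p : nat) (d : int) : bool :=
  if p == 2%N then (d %% 16)%Z \in [:: 1; 5; 8; 9; 12; 13]
  else ~~ ((p ^ 2)%N%:Z %| d)%Z.

Definition fundamental (d : int) : Prop := forall p, prime p -> fundamental_at p d.

Definition splits_at (p : nat) (d : int) : bool :=
  if p == 2%N then (d %% 8)%Z == 1
  else ~~ (p%:Z %| d)%Z && [exists r : 'I_p, (p%:Z %| (r%:Z ^+ 2 - d))%Z].

(* The pair (a, b) stands for a + b w, where w ^ 2 = t w - n. *)
Definition qmul (t n : int) (x y : int * int) : int * int :=
  (x.1 * y.1 - n * x.2 * y.2, x.1 * y.2 + x.2 * y.1 + t * x.2 * y.2).
Definition qconj (t : int) (x : int * int) : int * int := (x.1 + t * x.2, - x.2).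
Definition qnorm (t n : int) (x : int * int) : int :=
  x.1 ^+ 2 + t * x.1 * x.2 + n * x.2 ^+ 2.
Definition charpoly_at (t n r : int) : int := r ^+ 2 - t * r + n.

Lemma prime_dvdzM (p : nat) (x y : int) :
  prime p -> (p%:Z %| x * y)%Z = (p%:Z %| x)%Z || (p%:Z %| y)%Z.
Proof. by move=> pp; rewrite !dvdzE abszM Euclid_dvdM. Qed.

Lemma prime_dvdzX (p : nat) (x : int) k :
  prime p -> (p%:Z %| x ^+ k)%Z -> (p%:Z %| x)%Z.
Proof. by move=> pp; rewrite !dvdzE abszX Euclid_dvdX // => /andP[]. Qed.

Lemma prime_power_inv_mod (p k : nat) (x : int) :
  prime p -> ~~ (p%:Z %| x)%Z -> exists u, ((p ^ k)%N%:Z %| u * x - 1)%Z.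
Proof.
move=> pp px; have: coprimez x (p ^ k)%N.
  by rewrite coprimez_sym coprimezE absz_nat coprimeXl // prime_coprime.
case/coprimezP=> -[u v] /= h; exists u; rewrite -h.
by apply/dvdzP; exists (- v); ring.
Qed.

Lemma prime_inv_mod (p : nat) (x : int) :
  prime p -> ~~ (p%:Z %| x)%Z -> exists u, (p%:Z %| u * x - 1)%Z.
Proof. by move=> pp px; have [u] := prime_power_inv_mod 1 pp px; rewrite expn1; exists u. Qed.

Lemma int_dvdn_small (N : nat) (x : int) : (N%:Z %| x)%Z -> (`|x| < N)%N -> x = 0.
Proof.
rewrite dvdzE absz_nat => /dvdn_leq h hx.
by apply/eqP; rewrite -absz_eq0; apply: contraLR hx; rewrite -lt0n -leqNgt => /h.
Qed.

(** Divisibility by p^j with j <= k depends only on the residue modulo p^k. This is what allows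
    valuations at a p-adic root to be computed with finite precision. *)
Lemma logn_congr (p k : nat) (x y : int) : prime p -> x != 0 ->
  (logn p `|x| < k)%N -> ((p ^ k)%N%:Z %| x - y)%Z ->
  y != 0 /\ logn p `|y| = logn p `|x|.
Proof.
move=> pp x0 hk hd.
have H j : (j <= k)%N -> ((p ^ j)%N%:Z %| y)%Z = ((p ^ j)%N%:Z %| x)%Z.
  move=> jk; have {}hd : ((p ^ j)%N%:Z %| x - y)%Z.
    by apply: dvdz_trans hd; rewrite dvdzE /= dvdn_exp2l.
  by rewrite -[x in RHS](subrK y) rpredDl.
have L (z : int) j : z != 0 -> ((p ^ j)%N%:Z %| z)%Z = (j <= logn p `|z|)%N.
  by move=> z0; rewrite dvdzE /= pfactor_dvdn // absz_gt0.
have y0 : y != 0.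
  apply/eqP=> y0; have := H k (leqnn _); rewrite y0 dvdz0 => /esym.
  by rewrite L // leqNgt hk.
split=> //; apply/eqP; rewrite eqn_leq; apply/andP; split.
  rewrite leqNgt; apply/negP=> h.
  have := H _ hk; rewrite L // (L x) // ltnn => /negP; exact.
by rewrite -L // H 1?ltnW // L.
Qed.

Lemma fundamental2 d : fundamental d -> (d %% 16)%Z \in [:: 1; 5; 8; 9; 12; 13].
Proof. by move=> /(_ 2%N isT). Qed.

Lemma fundamental_no_sq d p : fundamental d -> prime p -> p != 2%N ->
  ~~ ((p ^ 2)%N%:Z %| d)%Z.
Proof. by move=> fd pp p2; have := fd p pp; rewrite /fundamental_at (negbTE p2). Qed.

(** * Norms and roots of X^2 - t X + n modulo prime powers *)

Section QuadraticOrder.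
Variables t n : int.
Local Notation N := (qnorm t n).
Local Notation f := (charpoly_at t n).
Local Notation mul := (qmul t n).
Local Notation conj := (qconj t).
Local Notation d := (t ^+ 2 - 4 * n).

Lemma qnormM x y : N (mul x y) = N x * N y.
Proof. rewrite /qnorm /qmul /=; ring. Qed.

Lemma qnorm_conj x : N (conj x) = N x.
Proof. rewrite /qnorm /qconj /=; ring. Qed.

Lemma qmul_conj x : mul x (conj x) = (N x, 0).
Proof. rewrite /qmul /qnorm /qconj /=; congr pair; ring. Qed.

Lemma qconjM x y : conj (mul x y) = mul (conj x) (conj y).
Proof. rewrite /qmul /qconj /=; congr pair; ring. Qed.

Lemma charpoly_sum r : f (t - r) = f r.
Proof. rewrite /charpoly_at; ring. Qed.

(** As (2 k + 1)^2 = 4 k (k + 1) + 1, squares of odd integers take the form 8 j + 1, which makes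
    congruences modulo 8 and 16 linear. *)
Lemma consecutive_even (k : int) : exists j, k * (k + 1) = 2 * j.
Proof.
have [] : k = 2 * (k %/ 2)%Z \/ k = 2 * (k %/ 2)%Z + 1 by lia.
  by move=> ->; eexists; rewrite -mulrA; reflexivity.
move: (k %/ 2)%Z => u ->; exists ((2 * u + 1) * (u + 1)); ring.
Qed.

(** For odd p, 4 f(r) = (2 r - t)^2 - d, so simple roots r correspond to nonzero square roots 2 r -
    t of d. For p = 2, both sides mean that t is odd and n is even. *)
Lemma splits_root (p : nat) : prime p ->
  splits_at p d <-> exists r, (p%:Z %| f r)%Z /\ ~~ (p%:Z %| 2 * r - t)%Z.
Proof.
move=> pp; rewrite /splits_at; case: eqP => [->|/eqP p2].
  rewrite /charpoly_at; split.
    move=> h; have [k tk] : exists k, t = 2 * k + 1.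
      exists (t %/ 2)%Z; have [] : t = 2 * (t %/ 2)%Z \/ t = 2 * (t %/ 2)%Z + 1 by lia.
        move=> tt; move: h; rewrite tt; move: (t %/ 2)%Z => u.
        have -> : (2 * u) ^+ 2 - 4 * n = 4 * (u ^+ 2 - n) by ring.
        by lia.
      by [].
    exists 0; split; last by lia.
    have [j hj] := consecutive_even k; move: h.
    have -> : t ^+ 2 - 4 * n = 4 * (k * (k + 1)) + 1 - 4 * n by rewrite tk; ring.
    by rewrite hj; lia.
  case=> r [h1 h2].
  have [k tk] : exists k, t = 2 * k + 1 by exists (t %/ 2)%Z; lia.
  have [j hj] := consecutive_even k.
  have [i hi] := consecutive_even (r - 1).
  move: h1; have -> : r ^+ 2 - t * r + n = (r - 1) * (r - 1 + 1) - 2 * (k * r) + n.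
    by rewrite tk; ring.
  have -> : t ^+ 2 - 4 * n = 4 * (k * (k + 1)) + 1 - 4 * n by rewrite tk; ring.
  by rewrite hi hj; lia.
have p4 : ~~ (p%:Z %| 4)%Z.
  rewrite dvdzE /= (_ : 4 = 2 ^ 2)%N // Euclid_dvdX // andbT dvdn_prime2 //.
split.
  case/andP=> pd /existsP[x px].
  have [u hu] : exists u, (p%:Z %| u * 2 - 1)%Z.
    by apply: prime_inv_mod => //; rewrite dvdzE /= dvdn_prime2.
  have e : (p%:Z %| (2 * (u * (x%:Z + t)) - t) ^+ 2 - d)%Z.
    have -> : (2 * (u * (x%:Z + t)) - t) ^+ 2 - d = (x%:Z ^+ 2 - d) +
      (u * 2 - 1) * (x%:Z + t) * ((u * 2 - 1) * (x%:Z + t) + 2 * x%:Z) by ring.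
    by rewrite rpredD // -!mulrA dvdz_mulr.
  (* The quadratic formula (t + x) / 2, with u for 1 / 2 modulo p. *)
  exists (u * (x%:Z + t)); split.
    have : (p%:Z %| 4 * f (u * (x%:Z + t)))%Z.
      by apply: etrans e; congr (_ %| _)%Z; rewrite /charpoly_at; ring.
    by rewrite prime_dvdzM // (negbTE p4).
  apply: contra pd => h; set X := 2 * _ - t in e h.
  by rewrite -[d](subKr (X ^+ 2)) rpredB // expr2 dvdz_mull.
case=> r [h1 h2].
have fE : 4 * f r = (2 * r - t) ^+ 2 - d by rewrite /charpoly_at; ring.
apply/andP; split.
  apply: contra h2 => h; apply: (prime_dvdzX (k := 2)) => //.
  by rewrite -(subrK d ((2 * r - t) ^+ 2)) rpredD // -fE dvdz_mull.
have p0 : (0 < p)%N by rewrite prime_gt0.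
have hx : (`|((2 * r - t) %% p%:Z)%Z| < p)%N by lia.
apply/existsP; exists (Ordinal hx) => /=.
have -> : `|((2 * r - t) %% p%:Z)%Z|%N%:Z = (2 * r - t) - ((2 * r - t) %/ p%:Z)%Z * p%:Z by lia.
move: (_ %/ _)%Z => q.
have -> : (2 * r - t - q * p%:Z) ^+ 2 - d = 4 * f r + p%:Z * (q * (q * p%:Z - 2 * (2 * r - t))).
  by rewrite fE; ring.
by apply: rpredD; [exact: dvdz_mull | exact: dvdz_mulr].
Qed.


Lemma prime_not_dvd_one (p : nat) : prime p -> ~~ (p%:Z %| 1)%Z.
Proof. by move=> pp; rewrite dvdzE /= dvdn1; apply: contraTneq pp => ->. Qed.

(* Ramified primes are not ramified twice: Z[w] is maximal at p. *)
Lemma fundamental_root (p : nat) r : fundamental d -> prime p ->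
  (p%:Z %| 2 * r - t)%Z -> ~~ ((p ^ 2)%N%:Z %| f r)%Z.
Proof.
move=> fd pp h1; apply/negP=> h2.
have dE : d = (2 * r - t) ^+ 2 - 4 * f r by rewrite /charpoly_at; ring.
case/dvdzP: h1 dE => a -> ; case/dvdzP: h2 => b -> dE.
have [p2|p2] := eqVneq p 2%N; last first.
  have /negP[] := fundamental_no_sq fd pp p2.
  by rewrite dE; apply/dvdzP; exists (a ^+ 2 - 4 * b); rewrite PoszM -!expr2; ring.
have {}dE : d = (a * 2) ^+ 2 - 4 * (b * 4) by rewrite dE p2.
have := fundamental2 fd; rewrite dE !inE.
(* For p = 2 this makes d congruent to 0 or 4 modulo 16, which is excluded. *)
have [] : a = 2 * (a %/ 2)%Z \/ a = 2 * (a %/ 2)%Z + 1 by lia.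
  move=> ->; move: (_ %/ _)%Z => c.
  have -> : (2 * c * 2) ^+ 2 - 4 * (b * 4) = 16 * (c ^+ 2 - b) by ring.
  by lia.
move=> ->; move: (_ %/ _)%Z => c.
have -> : ((2 * c + 1) * 2) ^+ 2 - 4 * (b * 4) = 16 * (c ^+ 2 + c - b) + 4 by ring.
by lia.
Qed.

(** N x = x.2^2 f(- x.1 / x.2), and x.2 is invertible modulo p^k. *)
Lemma qnorm_root (p k : nat) (x : int * int) :
  prime p -> ~~ (p%:Z %| x.2)%Z -> ((p ^ k)%N%:Z %| N x)%Z ->
  exists s, ((p ^ k)%N%:Z %| x.1 + s * x.2)%Z /\ ((p ^ k)%N%:Z %| f s)%Z.
Proof.
move=> pp px hN; have [e he] := prime_power_inv_mod k pp px.
exists (- e * x.1); split.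
  have -> : x.1 + - e * x.1 * x.2 = - x.1 * (e * x.2 - 1) by ring.
  exact: dvdz_mull.
have -> : f (- e * x.1) = e ^+ 2 * N x +
  (e * x.2 - 1) * (- t * e * x.1 - n * (e * x.2 + 1)).
  by rewrite /charpoly_at /qnorm; ring.
by apply: rpredD; [exact: dvdz_mull | exact: dvdz_mulr].
Qed.

Lemma qnorm_dvd_fst (p : nat) x : prime p -> (p%:Z %| N x)%Z ->
  (p%:Z %| x.2)%Z -> (p%:Z %| x.1)%Z.
Proof.
move=> pp hN h; apply: (prime_dvdzX (k := 2)) => //.
have -> : x.1 ^+ 2 = N x - (t * x.1 + n * x.2) * x.2 by rewrite /qnorm; ring.
by apply: rpredB => //; exact: dvdz_mull.
Qed.

Lemma qnorm_dvd_inert (p : nat) x : prime p ->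
  (forall r, ~~ (p%:Z %| f r)%Z) -> (p%:Z %| N x)%Z ->
  (p%:Z %| x.1)%Z /\ (p%:Z %| x.2)%Z.
Proof.
move=> pp nr hN; have [h|h] := boolP (p%:Z %| x.2)%Z.
  by split=> //; exact: qnorm_dvd_fst.
have [|s [_]] := qnorm_root (k := 1) pp h; rewrite ?expn1 //.
by rewrite (negbTE (nr s)).
Qed.

(** Otherwise [qnorm_root] yields a root of f modulo p^2: a simple root would make p split, and a
    double one contradicts [fundamental_root]. *)
Lemma qnorm_dvd_nonsplit (p : nat) x : fundamental d -> prime p ->
  ~~ splits_at p d -> ((p ^ 2)%N%:Z %| N x)%Z ->
  (p%:Z %| x.1)%Z /\ (p%:Z %| x.2)%Z.
Proof.
move=> fd pp ns hN; have hp : (p%:Z %| (p ^ 2)%N%:Z)%Z by rewrite dvdzE /= dvdn_exp.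
have [h|h] := boolP (p%:Z %| x.2)%Z.
  by split=> //; apply: qnorm_dvd_fst => //; exact: dvdz_trans hN.
have [s [_ hs]] := qnorm_root pp h hN.
have [h2|h2] := boolP (p%:Z %| 2 * s - t)%Z.
  by have := fundamental_root fd pp h2; rewrite hs.
case/negP: ns; apply/splits_root => //; exists s; split=> //.
exact: dvdz_trans hs.
Qed.

(** * Hensel roots and the valuation at a split prime *)

Section SplitPrime.
Variable p : nat.
Hypothesis pp : prime p.

(** Newton iteration with the inverse u of f'(r0) = 2 r0 - t modulo p kept fixed: every step gains
    one factor p. *)
Lemma hensel r0 : (p%:Z %| f r0)%Z -> ~~ (p%:Z %| 2 * r0 - t)%Z ->
  exists r : nat -> int, [/\ forall k, ((p ^ k)%N%:Z %| f (r k))%Z,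
    forall k, ~~ (p%:Z %| 2 * r k - t)%Z & forall j k, (j <= k)%N -> ((p ^ j)%N%:Z %| r k - r j)%Z].
Proof.
move=> h1 h2; have [u hu] := prime_inv_mod pp h2.
pose step x := x - u * f x; exists (fun k => iter k step r0).
have I k : ((p ^ k.+1)%N%:Z %| f (iter k step r0))%Z /\ (p%:Z %| iter k step r0 - r0)%Z.
  elim: k => [|k [IH1 IH2]]; first by rewrite expn1 subrr dvdz0.
  rewrite iterS; set x := iter k step r0 in IH1 IH2 *.
  have hp : (p%:Z %| f x)%Z by apply: dvdz_trans IH1; rewrite dvdzE /= dvdn_exp.
  split; last first.
    have -> : step x - r0 = (x - r0) - u * f x by rewrite /step; ring.
    by apply: rpredB => //; exact: dvdz_mull.
  have -> : f (step x) = f x * (u ^+ 2 * f x - (u * (2 * r0 - t) - 1) - 2 * u * (x - r0)).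
    by rewrite /step /charpoly_at; ring.
  rewrite expnSr PoszM dvdz_mul //; apply: rpredB; last exact: dvdz_mull.
  by apply: rpredB => //; exact: dvdz_mull.
split=> [k|k|j k].
- by apply: dvdz_trans (I k).1; rewrite dvdzE /= dvdn_exp2l.
- apply: contra h2; set x := iter k step r0 => h.
  have -> : 2 * r0 - t = (2 * x - t) - 2 * (x - r0) by ring.
  by apply: rpredB => //; apply: dvdz_mull; exact: (I k).2.
elim: k => [|k IH]; first by rewrite leqn0 => /eqP->; rewrite subrr dvdz0.
rewrite leq_eqVlt => /orP[/eqP->|]; first by rewrite subrr dvdz0.
rewrite ltnS => jk; rewrite iterS {1}/step addrAC; apply: rpredB; first exact: IH.
apply: dvdz_mull; apply: dvdz_trans (I k).1.
by rewrite dvdzE /= dvdn_exp2l // leqW.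
Qed.

Variable r : nat -> int.
Hypothesis r_root : forall k, ((p ^ k)%N%:Z %| f (r k))%Z.
Hypothesis r_coh : forall j k, (j <= k)%N -> ((p ^ j)%N%:Z %| r k - r j)%Z.

(* The valuation at the prime (p, w - r): w is sent to the p-adic limit of
   r k, and the precision exceeds the valuation of the norm. *)
Definition qval (x : int * int) : nat :=
  logn p `|x.1 + x.2 * r (logn p `|N x|).+1|.

(** The evaluations of x and of its conjugate at w = r k multiply to N x up to a multiple of f (r
    k), hence modulo p^k, and p^k exceeds the power of p in N x. *)
Lemma qval_norm x k : N x != 0 -> (logn p `|N x| < k)%N ->
  [/\ x.1 + x.2 * r k != 0, (conj x).1 + (conj x).2 * r k != 0 &
  (logn p `|(x.1 + x.2 * r k)%R| + logn p `|((conj x).1 + (conj x).2 * r k)%R| =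
   logn p `|N x|)%N].
Proof.
move=> N0 hk; have e : (x.1 + x.2 * r k) * ((conj x).1 + (conj x).2 * r k) =
    N x - x.2 ^+ 2 * f (r k).
  by rewrite /qnorm /charpoly_at /qconj /=; ring.
have [|y0] := logn_congr (y := N x - x.2 ^+ 2 * f (r k)) pp N0 hk.
  by rewrite opprB addrC subrK; exact: dvdz_mull.
rewrite -e in y0 *; move: y0; rewrite mulf_eq0 negb_or => /andP[a0 b0].
by rewrite abszM lognM ?absz_gt0.
Qed.

Lemma qvalE x k : N x != 0 -> (logn p `|N x| < k)%N ->
  x.1 + x.2 * r k != 0 /\ logn p `|x.1 + x.2 * r k| = qval x.
Proof.
move=> N0 hk; have [a0 _ e] := qval_norm N0 (ltnSn _).
rewrite /qval; apply: (logn_congr (k := (logn p `|N x|).+1)) => //.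
  by rewrite ltnS -[leqRHS]e leq_addr.
have -> : x.1 + x.2 * r (logn p `|N x|).+1 - (x.1 + x.2 * r k) =
  - x.2 * (r k - r (logn p `|N x|).+1) by ring.
by apply: dvdz_mull; exact: r_coh.
Qed.

Lemma qval_conj x : N x != 0 -> (qval x + qval (conj x) = logn p `|N x|)%N.
Proof.
move=> N0; have [_ _] := qval_norm N0 (ltnSn _).
by rewrite /qval qnorm_conj.
Qed.

Lemma qvalM x y : N x != 0 -> N y != 0 -> (qval (mul x y) = qval x + qval y)%N.
Proof.
move=> x0 y0; have xy0 : N (mul x y) != 0 by rewrite qnormM mulf_neq0.
(* One precision that suffices for x, y and their product. *)
pose k := (logn p `|N (mul x y)|).+1.
have kE : k = (logn p `|N x| + logn p `|N y|).+1.
  by rewrite /k qnormM abszM lognM ?absz_gt0.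
have [z1 e1] := @qvalE x k x0 ltac:(by rewrite kE ltnS leq_addr).
have [z2 e2] := @qvalE y k y0 ltac:(by rewrite kE ltnS leq_addl).
have [z3 e3] := @qvalE _ k xy0 (ltnSn _).
have lt : (logn p `|((mul x y).1 + (mul x y).2 * r k)%R| < k)%N.
  by rewrite e3 ltnS -(qval_conj xy0) leq_addr.
rewrite -e1 -e2 -e3 -lognM ?absz_gt0 // -abszM; symmetry.
apply: (logn_congr pp z3 lt _).2.
have -> : (mul x y).1 + (mul x y).2 * r k - (x.1 + x.2 * r k) * (y.1 + y.2 * r k) =
  - (x.2 * y.2) * f (r k).
  by rewrite /qmul /charpoly_at /=; ring.
exact: dvdz_mull.
Qed.

Lemma qval_ge x j : N x != 0 -> ((p ^ j)%N%:Z %| x.1 + x.2 * r j)%Z -> (j <= qval x)%N.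
Proof.
move=> N0 h; pose k := maxn j (logn p `|N x|).+1.
have [z <-] := @qvalE x k N0 (leq_maxr _ _).
rewrite -pfactor_dvdn ?absz_gt0 // -[(p ^ j)%N]absz_nat -dvdzE.
have -> : x.1 + x.2 * r k = (x.1 + x.2 * r j) + x.2 * (r k - r j) by ring.
by apply: rpredD => //; apply: dvdz_mull; apply: r_coh; rewrite leq_maxl.
Qed.

Hypothesis r_simple : forall k, ~~ (p%:Z %| 2 * r k - t)%Z.

(** P and its conjugate intersect in (p): the evaluations of x and of its conjugate differ by x.2
    times 2 r - t, which is prime to p. *)
Lemma qval_dvd x : N x != 0 -> (0 < qval x)%N -> (0 < qval (conj x))%N ->
  (p%:Z %| x.1)%Z /\ (p%:Z %| x.2)%Z.
Proof.
move=> N0; have Nc0 : N (conj x) != 0 by rewrite qnorm_conj.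
pose k := (logn p `|N x|).+1.
have [z1 <-] := @qvalE x k N0 (ltnSn _).
have [|z2 <-] := @qvalE (conj x) k Nc0; first by rewrite qnorm_conj.
rewrite !logn_gt0 !mem_primes pp !absz_gt0 z1 z2 /=.
rewrite -[p in (p %| _)%N]absz_nat -!dvdzE /= => h1 h2.
have h3 : (p%:Z %| x.2)%Z.
  have : (p%:Z %| x.2 * (2 * r k - t))%Z.
    have -> : x.2 * (2 * r k - t) = (x.1 + x.2 * r k) - (x.1 + t * x.2 + - x.2 * r k) by ring.
    exact: rpredB.
  by rewrite prime_dvdzM // (negbTE (r_simple k)) orbF.
split=> //; have -> : x.1 = (x.1 + x.2 * r k) - r k * x.2 by ring.
by apply: rpredB => //; exact: dvdz_mull.
Qed.

End SplitPrime.

End QuadraticOrder.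

(** * Pigeonhole arguments *)

Lemma infinite_pigeonhole (T : finType) (c : nat -> T) :
  exists a, forall n, exists2 m, (n <= m)%N & c m = a.
Proof.
apply: contrapT => /forallNP H.
have /choice[b hb] a : exists n, forall m, (n <= m)%N -> c m <> a.
  have /existsNP[n hn] := H a; exists n => m nm cm; apply: hn; by exists m.
pose B := \max_(a : T) b a.
exact: (hb (c B) B (leq_bigmax _)).
Qed.

(** Colour k by m k and by the residues of x k modulo m k. The index i is fixed before the bound on
    j, so that j can be taken as far away as an application requires; the pair then satisfies the
    congruences of [qnorm_quotient]. *)
Lemma congruent_pair (x : nat -> int * int) (m : nat -> int) (C : nat) :
  (forall k, m k != 0 /\ (`|m k| <= C)%N) ->
  exists i, forall k, exists j, [/\ (k <= j)%N, m j = m i,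
    (m i %| (x j).1 - (x i).1)%Z & (m i %| (x j).2 - (x i).2)%Z].
Proof.
move=> hm.
(* The shift by C records the sign of m k. *)
pose c k : 'I_(C + C).+1 * 'I_C.+1 * 'I_C.+1 :=
  (inord `|m k + C%:Z|, inord `|((x k).1 %% m k)%Z|, inord `|((x k).2 %% m k)%Z|).
have [a ha] := infinite_pigeonhole c.
have [i _ hi] := ha 0%N; exists i => k; have [j kj hj] := ha k.
exists j; move: hj; rewrite -hi => -[].
have [i0 iC] := hm i; have [j0 jC] := hm j.
move=> /(congr1 val) /= h1.
have {h1} e : m j = m i by move: h1; rewrite !inordK; lia.
rewrite e.
have H (y : int) : (`|(y %% m i)%Z| < C.+1)%N.
  apply: leq_trans iC; have := ltz_mod y i0; have := modz_ge0 y i0; lia.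
move=> /(congr1 val) /=; rewrite !inordK // => h1.
move=> /(congr1 val) /=; rewrite !inordK // => h2.
have H2 (u v : int) : `|(u %% m i)%Z|%N = `|(v %% m i)%Z|%N -> (m i %| u - v)%Z.
  move=> /(congr1 Posz); rewrite !gez0_abs ?modz_ge0 // => h.
  by rewrite -eqz_mod_dvd; apply/eqP.
by split=> //; apply: H2.
Qed.

(** Otherwise d = c^2 with c different from 0, 1 and -1. An odd prime factor q of c puts q^2 into d,
    and an even c makes d congruent to 0 or 4 modulo 16. *)
Lemma fundamental_not_square (d a b : int) : fundamental d -> d != 1 ->
  b != 0 -> a ^+ 2 != d * b ^+ 2.
Proof.
move=> fd d1 b0; apply/eqP=> e.
have : (b %| a)%Z.
  have : (b ^+ 2 %| a ^+ 2)%Z by rewrite e; apply: dvdz_mull.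
  by rewrite !dvdzE !abszX dvdn_pexp2r.
case/dvdzP=> c ac; have {e} dc : d = c ^+ 2.
  by apply: (mulIf (expf_neq0 2 b0)); rewrite -e ac exprMn.
have c1 : `|c|%N != 1%N.
  apply: contra d1 => /eqP c1; rewrite dc.
  by have [->|->] : c = 1 \/ c = -1 by lia.
have c0 : c != 0.
  apply/eqP=> c0; by have := fundamental2 fd; rewrite dc c0 expr0n /= mod0z.
have [q pp] : exists2 q, prime q & (q%:Z %| c)%Z.
  exists (pdiv `|c|); last by rewrite dvdzE /= pdiv_dvd.
  by rewrite pdiv_prime // ltn_neqAle eq_sym c1 absz_gt0.
case/dvdzP=> u cu; have [p2|p2] := eqVneq q 2%N; last first.
  have /negP[] := fundamental_no_sq fd pp p2.
  by rewrite dc cu exprMn; apply/dvdzP; exists (u ^+ 2); rewrite PoszM.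
have := fundamental2 fd; rewrite dc cu p2 !inE.
have [] : u = 2 * (u %/ 2)%Z \/ u = 2 * (u %/ 2)%Z + 1 by lia.
  move=> ->; move: (_ %/ _)%Z => v.
  have -> : (2 * v * 2) ^+ 2 = 16 * (v ^+ 2) by ring.
  by lia.
move=> ->; move: (_ %/ _)%Z => v.
have -> : ((2 * v + 1) * 2) ^+ 2 = 16 * (v ^+ 2 + v) + 4 by ring.
by lia.
Qed.

Lemma absz_add3 (a b c : int) : (`|(a + b + c)%R| <= `|a| + `|b| + `|c|)%N.
Proof. lia. Qed.

(** * Quotients of elements of equal norm, and Thue's lemma *)

Section Pigeonhole.
Variables t n : int.
Local Notation N := (qnorm t n).
Local Notation f := (charpoly_at t n).
Local Notation mul := (qmul t n).
Local Notation conj := (qconj t).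
Local Notation d := (t ^+ 2 - 4 * n).
Hypothesis fd : fundamental d.
Hypothesis d1 : d != 1.

Lemma qnorm_eq0 x : (N x == 0) = (x == (0, 0)).
Proof.
apply/eqP/eqP => [h|->]; last by rewrite /qnorm /=; ring.
have e : (2 * x.1 + t * x.2) ^+ 2 = d * x.2 ^+ 2.
  have -> : d * x.2 ^+ 2 = (2 * x.1 + t * x.2) ^+ 2 - 4 * N x by rewrite /qnorm; ring.
  by rewrite h; ring.
have x2 : x.2 = 0.
  by apply/eqP/negPn/negP => /(fundamental_not_square (2 * x.1 + t * x.2) fd d1); rewrite e eqxx.
have x1 : x.1 = 0.
  move: h; rewrite /qnorm x2 expr0n /= !mulr0 !addr0 => /eqP.
  by rewrite expf_eq0 => /eqP.
by rewrite [x]surjective_pairing x1 x2.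
Qed.

(* w x / y = w + ((x - y) / m) conj(y) is integral. *)
Lemma qnorm_quotient (m u w : int) x y : m != 0 -> N x = m * u -> N y = m * w ->
  (m %| x.1 - y.1)%Z -> (m %| x.2 - y.2)%Z ->
  exists z, N z = u * w /\ mul z y = (w * x.1, w * x.2).
Proof.
move=> m0 Nx Ny /dvdzP[a ha] /dvdzP[b hb].
have xa : x.1 = y.1 + a * m by rewrite -ha; ring.
have xb : x.2 = y.2 + b * m by rewrite -hb; ring.
pose g := mul (a, b) (conj y); pose z := (w + g.1, g.2); exists z.
have e : mul z y = (w * x.1, w * x.2).
  have E : w + N (a, b) * 0 = w by rewrite mulr0 addr0.
  rewrite /z /g; apply/eqP; rewrite xpair_eqE; apply/andP; split; apply/eqP.
    transitivity (w * y.1 + a * N y); last by rewrite xa Ny; ring.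
    by rewrite /qmul /qconj /qnorm /=; ring.
  transitivity (w * y.2 + b * N y); last by rewrite xb Ny; ring.
  by rewrite /qmul /qconj /qnorm /=; ring.
split=> //.
have [w0|w0] := eqVneq w 0.
  rewrite w0 mulr0; have y0 : y = (0, 0) by apply/eqP; rewrite -qnorm_eq0 Ny w0 mulr0.
  by rewrite /z /g y0 w0 /qmul /qconj /qnorm /=; ring.
have Ny0 : N y != 0 by rewrite Ny mulf_neq0.
apply: (mulIf Ny0); rewrite -qnormM e.
have -> : N (w * x.1, w * x.2) = w ^+ 2 * N x by rewrite /qnorm /=; ring.
by rewrite Nx Ny; ring.
Qed.

(** There are (q + 1)^2 pairs with entries between 0 and q but only q^2 residues; two pairs with the
    same residue are subtracted. *)
Lemma thue (q : nat) (r : int) : (0 < q)%N ->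
  exists x, [/\ x != (0, 0), ((q ^ 2)%N%:Z %| x.1 + x.2 * r)%Z,
    (`|x.1| <= q)%N & (`|x.2| <= q)%N].
Proof.
move=> q0; have q20 : (q ^ 2)%N%:Z != 0 by lia.
have hlt (v : int) : (`|(v %% (q ^ 2)%N%:Z)%Z| < q ^ 2)%N.
  by have := ltz_mod v q20; have := modz_ge0 v q20; lia.
pose c (z : 'I_q.+1 * 'I_q.+1) : 'I_(q ^ 2) := Ordinal (hlt (z.1%:Z + z.2%:Z * r)).
have : ~~ injectiveb c.
  apply/negP=> /injectiveP /leq_card; rewrite card_prod !card_ord; nia.
case/injectivePn=> z [z' zz' /(congr1 val) /= h].
exists (z.1%:Z - z'.1%:Z, z.2%:Z - z'.2%:Z); split=> /=.
- apply: contra zz' => /eqP[h1 h2].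
  apply/eqP; case: z z' h1 h2 {h} => a b [a' b'] /= h1 h2.
  by congr pair; apply: val_inj => /=; lia.
- move: h => /(congr1 Posz); rewrite !gez0_abs ?modz_ge0 // => h.
  have -> : z.1%:Z - z'.1%:Z + (z.2%:Z - z'.2%:Z) * r =
    (z.1%:Z + z.2%:Z * r) - (z'.1%:Z + z'.2%:Z * r) by ring.
  by rewrite -eqz_mod_dvd; apply/eqP.
- by have /= := ltn_ord z.1; have /= := ltn_ord z'.1; move: (nat_of_ord z.1) (nat_of_ord z'.1); lia.
- by have /= := ltn_ord z.2; have /= := ltn_ord z'.2; move: (nat_of_ord z.2) (nat_of_ord z'.2); lia.
Qed.

(* For P = (p, w - r), every P^(2l) contains an element of norm m p^(2l) with m
   bounded. For two of them with the same m, congruent modulo m, the quotient is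
   a p-unit up to a power of p, and its valuations at P and at its conjugate
   differ if the two values of l are far apart. *)
Lemma split_unit (p : nat) (r : nat -> int) : prime p ->
  (forall k, ((p ^ k)%N%:Z %| f (r k))%Z) ->
  (forall j k, (j <= k)%N -> ((p ^ j)%N%:Z %| r k - r j)%Z) ->
  exists z j, N z = (p ^ j)%N%:Z /\ qval t n p r z != qval t n p r (conj z).
Proof.
move=> pp r_root r_coh; pose V := qval t n p r.
have p0 l : (0 < p ^ l)%N by rewrite expn_gt0 prime_gt0.
(* |N x| <= C q^2 when both coordinates are at most q = p^l in absolute value. *)
pose C := (1 + `|t| + `|n|)%N.
have /choice[x hx] l : exists x, [/\ N x != 0, (2 * l <= V x)%N &
    exists m, N x = m * (p ^ (2 * l))%N%:Z /\ (`|m| <= C)%N].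
  have [x [x0 hd h1 h2]] := thue (r (2 * l)%N) (p0 l).
  rewrite -expnM [(l * 2)%N]mulnC in hd.
  have N0 : N x != 0 by rewrite qnorm_eq0.
  exists x; split=> //; first exact: (qval_ge pp r_root r_coh).
  have : ((p ^ (2 * l))%N%:Z %| N x)%Z.
    have -> : N x = (x.1 + x.2 * r (2 * l)%N) * ((conj x).1 + (conj x).2 * r (2 * l)%N)
      + x.2 ^+ 2 * f (r (2 * l)%N).
      by rewrite /qnorm /charpoly_at /qconj /=; ring.
    by apply: rpredD; [exact: dvdz_mulr | exact: dvdz_mull].
  case/dvdzP=> m hm; exists m; split=> //.
  rewrite -(leq_pmul2r (p0 (2 * l)%N)) -[(p ^ (2 * l))%N in X in (X <= _)%N]absz_nat -abszM -hm.
  rewrite [(2 * l)%N]mulnC expnM /C.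
  move: h1 h2; move: (p ^ l)%N => q h1 h2; rewrite /qnorm.
  have B (k y z : int) : (`|y| <= q)%N -> (`|z| <= q)%N -> (`|(k * y * z)%R| <= `|k| * (q ^ 2))%N.
    by move=> hy hz; rewrite !abszM -mulnA leq_mul2l leq_mul ?orbT.
  have := B 1 _ _ h1 h1; have := B t _ _ h1 h2; have := B n _ _ h2 h2.
  rewrite mul1r !expr2 mulrA !mulnDl => b3 b2 b1.
  apply: leq_trans (absz_add3 _ _ _) _.
  by apply: leq_add => //; apply: leq_add.
have /choice[m hm] l : exists m, N (x l) = m * (p ^ (2 * l))%N%:Z /\ (`|m| <= C)%N.
  by case: (hx l).
have m0 l : m l != 0.
  by have [N0 _ _] := hx l; apply: contra N0 => /eqP e; rewrite (hm l).1 e mul0r.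
have [|i hi] := @congruent_pair x m C; first by move=> k; split=> //; exact: (hm k).2.
(* With L = logn p |m i|, the difference of the valuations at P and at its conjugate is at most 2 i
   + L for x i and at least 2 j - L for x j, so such a j separates them. *)
have [j [ij mji h1 h2]] := hi (2 * i + 2 * logn p `|m i|).+1.
have Nj : N (x j) = m i * (p ^ (2 * j))%N%:Z by rewrite -mji (hm j).1.
have [z [Nz hz]] := qnorm_quotient (m0 i) Nj (hm i).1 h1 h2.
set w := (p ^ (2 * i))%N%:Z in Nz hz.
exists z, (2 * j + 2 * i)%N; split.
  by rewrite Nz -PoszM -expnD.
apply/eqP=> Vz; have N0 l : N (x l) != 0 by case: (hx l).
have Vl l : (2 * l <= V (x l))%N by case: (hx l).
have VN l : (V (x l) + V (conj (x l)) = logn p `|m l| + 2 * l)%N.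
  rewrite /V qval_conj // (hm l).1 abszM absz_nat lognM ?absz_gt0 ?p0 //.
  by rewrite pfactorK.
have w0 : N (w, 0) != 0.
  by rewrite qnorm_eq0 xpair_eqE eqxx andbT; have := p0 (2 * i)%N; rewrite /w; lia.
have z0 : N z != 0 by rewrite Nz mulf_neq0 //; have := p0 (2 * i)%N; have := p0 (2 * j)%N; rewrite /w; lia.
have {}hz : mul z (x i) = mul (w, 0) (x j).
  by rewrite hz /qmul /=; congr pair; ring.
have VM a b : N a != 0 -> N b != 0 -> V (mul a b) = (V a + V b)%N by exact: qvalM.
have NC a : N a != 0 -> N (conj a) != 0 by rewrite qnorm_conj.
have e1 := congr1 V hz; rewrite !VM // in e1.
have e2 := congr1 (V \o conj) hz; rewrite /= !qconjM !VM ?NC // in e2.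
have cw : conj (w, 0) = (w, 0) by rewrite /qconj /=; congr pair; ring.
rewrite cw in e2.
have := VN i; have := VN j; have := Vl i; have := Vl j; rewrite mji.
rewrite -/V in Vz; rewrite {}Vz in e1; move: e1 e2 ij; clear; clearbody V.
move: (V _) (V _) (V _) (V _) (V _) (V _) (logn _ _); lia.
Qed.

End Pigeonhole.

(** * Dirichlet approximation and Pell's equation *)

Lemma dirichlet_approximation (R : realType) (s : R) (k : nat) :
  exists (a : int) (b : nat), [/\ (0 < b <= k.+1)%N & `|a%:~R - b%:R * s| * k.+1%:R < 1].
Proof.
pose fr (b : nat) : R := b%:R * s - (Num.floor (b%:R * s))%:~R.
have fr01 b : 0 <= fr b < 1.
  have := floor_itv (b%:R * s); rewrite /fr intrD subr_ge0 ltrBlDl.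
  by move=> /andP[-> /=].
pose q b := Num.trunc (fr b * k.+1%:R).
have q0 b : 0 <= fr b * k.+1%:R by rewrite mulr_ge0 //; case/andP: (fr01 b).
have qk b : (q b < k.+1)%N.
  rewrite /q truncn_lt_nat // -[ltRHS]mul1r ltr_pM2r //.
  by case/andP: (fr01 b).
pose c (b : 'I_k.+2) : 'I_k.+1 := Ordinal (qk b).
have : ~~ injectiveb c.
  by apply/negP=> /injectiveP /leq_card; rewrite !card_ord ltnn.
case/injectivePn=> b [b' bb' /(congr1 val) /= h].
wlog lt : b b' bb' h / (b < b')%N.
  move=> H; have : (b : nat) != b' by [].
  rewrite neq_ltn => /orP[]; first exact: H.
  by apply: (H b' b) => //; rewrite eq_sym.
exists (Num.floor (b'%:R * s) - Num.floor (b%:R * s)), (b' - b)%N; split.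
  by rewrite subn_gt0 lt /= (leq_trans (leq_subr _ _)) // -ltnS.
have -> : (Num.floor (b'%:R * s) - Num.floor (b%:R * s))%:~R - (b' - b)%:R * s =
    fr b - fr b' by rewrite /fr intrB natrB 1?ltnW //; ring.
rewrite -[X in _ * X](@ger0_norm _ k.+1%:R) // -normrM mulrBl.
have := trunc_itv (q0 b); have := trunc_itv (q0 b'); rewrite -/(q _) -/(q _) -h.
move: (fr b * _) (fr b' * _) => u v; rewrite -natr1 ltr_norml.
move: (q b)%:R => w; lra.
Qed.

(** Good approximations a / b to s = sqrt d have |a^2 - d b^2| <= 1 + 2 s, so two of them have a
    quotient of norm 1. The quotient is not 1 or -1, because j is chosen so late that its error e j
    is smaller than e i. *)
Lemma pell (R : realType) (t n : int) : let d := t ^+ 2 - 4 * n in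
  fundamental d -> d != 1 -> 0 < d -> exists z, qnorm t n z = 1 /\ z.2 != 0.
Proof.
move=> d fd d1 d0; pose s : R := Num.sqrt d%:~R.
have s2 : s ^+ 2 = d%:~R by rewrite sqr_sqrtr // ler0z ltW.
have s0 : 0 <= s by exact: sqrtr_ge0.
have /choice[a ha] k := dirichlet_approximation s k.
have /choice[b hb] := ha.
pose e k := `|(a k)%:~R - (b k)%:R * s|.
have e0 k : 0 <= e k by exact: normr_ge0.
have b0 k : (0 < b k)%N by have [/andP[]] := hb k.
pose m k := a k ^+ 2 - d * (b k)%:Z ^+ 2.
have mE k : (m k)%:~R = ((a k)%:~R - (b k)%:R * s) * ((a k)%:~R + (b k)%:R * s) :> R.
  transitivity ((a k)%:~R ^+ 2 - s ^+ 2 * (b k)%:R ^+ 2 : R); last by ring.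
  by rewrite s2 /m; ring.
have m0 k : m k != 0.
  by rewrite subr_eq0 fundamental_not_square //; have := b0 k; lia.
have ek k : e k * k.+1%:R < 1 by have [] := hb k.
have e1 k : e k < 1.
  by apply: le_lt_trans (ek k); rewrite ler_peMr // ler1n.
pose C := (Num.trunc (1 + 2 * s)).+1.
have mC k : (`|m k| <= C)%N.
  rewrite -(ler_nat R) natr_absz intr_norm mE normrM -/(e k).
  apply: (@le_trans _ _ (1 + 2 * s)); last first.
    by have /andP[_ /ltW] := @trunc_itv R (1 + 2 * s) ltac:(lra).
  have h1 : `|(a k)%:~R + (b k)%:R * s| <= e k + 2 * ((b k)%:R * s).
    have -> : (a k)%:~R + (b k)%:R * s = ((a k)%:~R - (b k)%:R * s) + 2 * ((b k)%:R * s) by ring.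
    apply: le_trans (ler_normD _ _) _; rewrite -/(e k) lerD2l ger0_norm //.
    by rewrite !mulr_ge0.
  have h2 : e k * (b k)%:R <= 1.
    apply: ltW; apply: le_lt_trans (ek k); rewrite ler_wpM2l // ler_nat.
    by have [/andP[]] := hb k.
  apply: le_trans (ler_wpM2l (e0 k) h1) _.
  rewrite mulrDr; apply: lerD; first by have := e1 k; have := e0 k; nra.
  have -> : e k * (2 * ((b k)%:R * s)) = 2 * ((e k * (b k)%:R) * s) by ring.
  by rewrite ler_pM2l // ler_piMl.
(* This is a - b sqrt d, written with sqrt d = 2 w - t. *)
pose x k := (a k + (b k)%:Z * t, - 2 * (b k)%:Z).
have xm k : qnorm t n (x k) = m k * 1.
  by rewrite /m /qnorm /d /=; ring.
have [i hi] := congruent_pair x (fun k => conj (m0 k) (mC k)).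
have ei : 0 < e i.
  rewrite lt_neqAle e0 andbT eq_sym normr_eq0.
  by apply: contra (m0 i) => /eqP h; rewrite -(intr_eq0 R) mE h mul0r.
have [j [ij mji h1 h2]] := hi (Num.trunc (e i)^-1).
have xj : qnorm t n (x j) = m i * 1 by rewrite xm mji.
have [z [Nz hz]] := qnorm_quotient fd d1 (m0 i) xj (xm i) h1 h2.
exists z; split; first by rewrite Nz mulr1.
apply/eqP=> z2; have z1 : z.1 = 1 \/ z.1 = -1.
  move: Nz; rewrite /qnorm z2 expr0n /= !mulr0 !addr0 mulr1.
  by move/eqP; rewrite sqrf_eq1 => /orP[] /eqP ->; [left|right].
have {}ij : e j < e i.
  have : (e i)^-1 < j.+1%:R.
    have /andP[_] := @trunc_itv R (e i)^-1 ltac:(by rewrite invr_ge0).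
    by move/lt_le_trans; apply; rewrite ler_nat ltnS.
  move=> h; rewrite -(ltr_pM2r (ltr0Sn R j)); apply: lt_trans (ek j) _.
  by rewrite mulrC -ltr_pdivrMr // div1r.
move: hz; rewrite /qmul z2 !mul1r /= !mulr0 !mul0r subr0 !addr0 => -[ha' hb'].
have bb : b j = b i by have := b0 j; have := b0 i; case: z1 hb' => ->; lia.
have aa : a j = a i.
  by case: z1 hb' ha' => ->; rewrite bb; have := b0 i; lia.
by move: ij; rewrite /e aa bb ltxx.
Qed.

(** * Counting fundamental discriminants *)

Lemma sum_blocks (g : nat -> nat) m k :
  (\sum_(0 <= e < m * k) g e = \sum_(0 <= j < k) \sum_(0 <= a < m) g (m * j + a))%N.
Proof.
elim: k => [|k IH]; first by rewrite muln0 !big_nil.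
rewrite big_nat_recr //= -IH mulnS addnC.
rewrite (@big_cat_nat _ _ _ (m * k)%N) ?leq_addr //=; congr addn.
rewrite -{1}[(m * k)%N]add0n big_addn addKn; apply: eq_bigr => a _.
by rewrite addnC.
Qed.

Definition periodic (m : nat) (u : nat -> nat) : Prop := forall e, u (e + m)%N = u e.

Lemma periodic_mul m u j e : periodic m u -> u (m * j + e)%N = u e.
Proof.
move=> pu; elim: j => [|j IH]; first by rewrite muln0.
by rewrite mulnS -addnA addnC pu IH.
Qed.

Lemma periodic_modn m u e : periodic m u -> u (e %% m)%N = u e.
Proof. by move=> pu; rewrite [in RHS](divn_eq e m) [(_ * m)%N]mulnC periodic_mul. Qed.

Lemma periodicX m k u : periodic m u -> periodic (m * k)%N u.
Proof. by move=> pu e; rewrite addnC periodic_mul. Qed.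

(** The map j |-> m j + a permutes the residues modulo k. *)
Lemma sum_periodic_affine m k v a : coprime m k -> (0 < k)%N -> periodic k v ->
  (\sum_(0 <= j < k) v (m * j + a) = \sum_(0 <= b < k) v b)%N.
Proof.
move=> cmk k0 pv; rewrite !big_mkord.
pose h (j : 'I_k) : 'I_k := Ordinal (ltn_pmod (m * j + a) k0).
have hinj : injective h.
  move=> i j /(congr1 val) /= /eqP; rewrite eqn_modDr => e.
  apply: val_inj => /=; move: e; wlog ij : i j / (i <= j)%N.
    by move=> H e; case/orP: (leq_total i j) => h'; [|symmetry]; apply: H => //; rewrite eq_sym.
  rewrite eq_sym eqn_mod_dvd ?leq_mul2l ?ij ?orbT // -mulnBr Gauss_dvdr 1?coprime_sym //.
  have lt : (j - i < k)%N by apply: leq_ltn_trans (leq_subr _ _) (ltn_ord j).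
  move=> h'; have : (j - i = 0)%N.
    by apply/eqP; apply: contraTT h' => h'; rewrite gtnNdvd // lt0n.
  by move/eqP; rewrite subn_eq0 => h''; apply/eqP; rewrite eqn_leq ij.
rewrite [RHS](reindex_inj hinj) /=; apply: eq_bigr => j _.
by rewrite periodic_modn.
Qed.

(** The Chinese remainder theorem for sums: with e = m j + a, u depends on a alone, and for fixed a
    the argument of v runs through all residues modulo k. *)
Lemma sum_periodic_coprime m k u v : coprime m k -> (0 < k)%N ->
  periodic m u -> periodic k v ->
  (\sum_(0 <= e < m * k) u e * v e =
   (\sum_(0 <= e < m) u e) * (\sum_(0 <= e < k) v e))%N.
Proof.
move=> cmk k0 pu pv; rewrite sum_blocks exchange_big big_distrl /=.
apply: eq_bigr => a _; rewrite -(sum_periodic_affine a cmk k0 pv) big_distrr /=.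
by apply: eq_bigr => j _; rewrite periodic_mul.
Qed.

(** * Local sums at a single prime *)

Section LocalWeights.
Variable sg : int.
Hypothesis sg2 : sg ^+ 2 = 1.

Lemma sgP : sg = 1 \/ sg = -1.
Proof. by move/eqP: sg2; rewrite sqrf_eq1 => /orP[] /eqP ->; [left | right]. Qed.

Definition modulus (p : nat) : nat := if p == 2%N then 16%N else (p ^ 2)%N.

(* The factor of [fundamental d] * 3 ^ #{split p in S} at p, where d = sg * e
   and b records whether p lies in S. *)
Definition local_weight (b : bool) (p e : nat) : nat :=
  (fundamental_at p (sg * e%:Z) * (if b && splits_at p (sg * e%:Z) then 3 else 1))%N.

Lemma fundamental_at_periodic p e :
  fundamental_at p (sg * (e + modulus p)%N%:Z) = fundamental_at p (sg * e%:Z).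
Proof.
rewrite /fundamental_at /modulus; case: eqP => _.
  by have [->|->] := sgP; rewrite !inE; lia.
by rewrite PoszD mulrDr rpredDr //; exact: dvdz_mull.
Qed.

Lemma splits_at_periodic p e k : p != 2%N ->
  splits_at p (sg * (e + p * k)%N%:Z) = splits_at p (sg * e%:Z).
Proof.
move=> p2; rewrite /splits_at (negbTE p2).
have D : (p%:Z %| sg * (p * k)%N%:Z)%Z by apply: dvdz_mull; rewrite PoszM; exact: dvdz_mulr.
rewrite PoszD mulrDr rpredDr //; congr andb; apply: eq_existsb => r.
by rewrite opprD addrA rpredBr.
Qed.

Lemma local_weight_periodic b p : periodic (modulus p) (local_weight b p).
Proof.
move=> e; rewrite /local_weight fundamental_at_periodic.
rewrite (_ : splits_at p (sg * (e + modulus p)%N%:Z) = splits_at p (sg * e%:Z)) //.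
rewrite /modulus; have [->|p2] := eqVneq p 2%N; last exact: splits_at_periodic.
rewrite /splits_at /=; have [->|->] := sgP; lia.
Qed.

(** Of the six admissible residues modulo 16, exactly 1 and 9 split, and each of them gains 2. *)
Lemma local_sum2 (b : bool) : (\sum_(0 <= e < 16) local_weight b 2 e = if b then 10 else 6)%N.
Proof.
rewrite /local_weight /index_iota subn0 unlock.
by have [->|->] := sgP; case: b; vm_compute.
Qed.

Section OddPrime.
Variable p : nat.
Hypothesis pp : prime p.
Hypothesis p2 : p != 2%N.
Let p0 : (0 < p)%N. Proof. exact: prime_gt0. Qed.

Lemma sum_fundamental_at :
  (\sum_(0 <= e < p ^ 2) fundamental_at p (sg * e%:Z) = (p ^ 2).-1)%N.
Proof.
have q0 : (0 < p ^ 2)%N by rewrite expn_gt0 p0.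
have fE e : fundamental_at p (sg * e%:Z) = ~~ (p ^ 2 %| e)%N.
  rewrite /fundamental_at (negbTE p2); congr negb.
  by rewrite dvdzE abszM; have [->|->] := sgP; rewrite mul1n.
rewrite big_ltn // fE dvdn0 /= add0n.
rewrite (eq_big_nat _ _ (F2 := fun _ => 1%N)) ?sum_nat_const_nat ?muln1 ?subn1 //.
by move=> e /andP[e0 eq]; rewrite fE gtnNdvd.
Qed.

(** If there is a nonzero root x0, then x0 and p - x0 are all of them, and they are distinct because
    p is odd. For e = 0 only x = 0 is a root, and it is left out on both sides. *)
Lemma count_square_roots (e : 'I_p) :
  (\sum_(x < p | x != 0 :> nat) ((p%:Z %| (x%:Z ^+ 2 - sg * e%:Z)%R)%Z : nat) =
   2 * splits_at p (sg * e%:Z))%N.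
Proof.
have podd : odd p by case: (even_prime pp) p2 => ->.
rewrite /splits_at (negbTE p2) -big_mkcondr /= sum1_card.
have nz (x : 'I_p) : (p%:Z %| x%:Z ^+ 2 - sg * e%:Z)%Z ->
    (p%:Z %| sg * e%:Z)%Z = (x == 0 :> nat).
  move=> h; rewrite -[sg * _](subKr (x%:Z ^+ 2)) rpredBr // expr2 prime_dvdzM // orbb.
  rewrite dvdzE /=; apply/idP/eqP => [/dvdn_leq h'|->] //.
  by apply/eqP; rewrite -leqn0 leqNgt; apply/negP => /h'; rewrite leqNgt ltn_ord.
case: existsP => [[x0 hx0]|nx]; last first.
  rewrite andbF muln0; apply: eq_card0 => x; rewrite !inE.
  by apply/negP=> /andP[_ h]; apply: nx; exists x.
have [x00|x00] := boolP (x0 == 0 :> nat).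
  rewrite (nz x0 hx0) x00 /= muln0; apply: eq_card0 => x; rewrite !inE.
  by apply/negP=> /andP[xn0 h]; move: xn0; rewrite -(nz x h) (nz x0 hx0) x00.
rewrite (nz x0 hx0) x00 /= muln1.
have x0' : (p - x0 < p)%N by rewrite ltn_subrL p0 lt0n x00.
pose x1 := Ordinal x0'.
have x01 : x0 != x1.
  apply/eqP=> /(congr1 val) /= h; move: podd.
  have -> : p = (x0 + x0)%N by rewrite {2}h subnKC // ltnW.
  by rewrite addnn odd_double.
transitivity #|pred2 x0 x1|; last by rewrite card2 x01.
apply: eq_card => x; rewrite !inE; apply/andP/orP.
  case=> xn0 hx; have : (p%:Z %| (x%:Z - x0%:Z) * (x%:Z + x0%:Z))%Z.
    have -> : (x%:Z - x0%:Z) * (x%:Z + x0%:Z) =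
      (x%:Z ^+ 2 - sg * e%:Z) - (x0%:Z ^+ 2 - sg * e%:Z) by ring.
    exact: rpredB.
  have := ltn_ord x; have := ltn_ord x0; rewrite prime_dvdzM // => l0 l1 /orP[h|h].
    left; apply/eqP/val_inj => /=; have := int_dvdn_small h; lia.
  right; apply/eqP/val_inj => /=.
  have : (p%:Z %| x%:Z + x0%:Z - p%:Z)%Z by rewrite rpredB // dvdzz.
  move/int_dvdn_small; have := x00; lia.
case=> /eqP -> //; split=> /=; first by rewrite subn_eq0 -ltnNge.
have -> : (p - x0)%N%:Z ^+ 2 - sg * e%:Z = (x0%:Z ^+ 2 - sg * e%:Z) + p%:Z * (p%:Z - 2 * x0%:Z).
  by rewrite -subzn 1?ltnW //; ring.
by apply: rpredD => //; exact: dvdz_mulr.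
Qed.

(** Double counting of the pairs (x, e) with x nonzero and x^2 = sg e modulo p: each x admits the
    single value e = sg x^2. *)
Lemma count_splits : (2 * \sum_(0 <= e < p) splits_at p (sg * e%:Z) = p.-1)%N.
Proof.
rewrite big_mkord big_distrr /=.
rewrite (eq_bigr _ (fun e _ => esym (count_square_roots e))) exchange_big /=.
transitivity (\sum_(x < p | x != 0 :> nat) 1)%N; last first.
  rewrite sum1_card -[in RHS](card_ord p); case: p p0 => // q _.
  rewrite -(cardC1 (ord0 : 'I_q.+1)).
  by apply: eq_card => x; rewrite !inE.
apply: eq_bigr => x _.
have hlt : (`|(sg * x%:Z ^+ 2 %% p%:Z)%Z| < p)%N.
  have pz : p%:Z != 0 by rewrite eqz_nat -lt0n.
  by have := ltz_mod (sg * x%:Z ^+ 2) pz; have := modz_ge0 (sg * x%:Z ^+ 2) pz; lia.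
have e0E : (Ordinal hlt)%:Z = sg * x%:Z ^+ 2 - (sg * x%:Z ^+ 2 %/ p%:Z)%Z * p%:Z.
  by rewrite /= gez0_abs ?modz_ge0 // eqz_nat -lt0n.
have P0 : (p%:Z %| x%:Z ^+ 2 - sg * (Ordinal hlt)%:Z)%Z.
  rewrite e0E; move: (_ %/ _)%Z => q.
  have -> : x%:Z ^+ 2 - sg * (sg * x%:Z ^+ 2 - q * p%:Z) = (1 - sg ^+ 2) * x%:Z ^+ 2 + (sg * q) * p%:Z.
    by ring.
  by rewrite sg2 subrr mul0r add0r; exact: dvdz_mull.
move: (Ordinal hlt) e0E P0 => {hlt} e0 _ P0; rewrite (bigD1 e0) //= P0 big1 // => e ne.
apply/eqP; rewrite eqb0; apply: contra ne => Pe; apply/eqP/val_inj => /=.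
have : (p%:Z %| sg * ((sg * e%:Z) - (sg * e0%:Z)))%Z.
  apply: dvdz_mull; have -> : sg * e%:Z - sg * e0%:Z =
    (x%:Z ^+ 2 - sg * e0%:Z) - (x%:Z ^+ 2 - sg * e%:Z) by ring.
  exact: rpredB.
have -> : sg * ((sg * e%:Z) - (sg * e0%:Z)) = sg ^+ 2 * (e%:Z - e0%:Z) by ring.
rewrite sg2 mul1r => /int_dvdn_small; have := ltn_ord e; have := ltn_ord e0.
by move: (nat_of_ord e0) (nat_of_ord e); lia.
Qed.

(** A value that splits at p is prime to p, hence fundamental at p, so for b = true the weight is
    [fundamental_at] plus twice [splits_at]. The p blocks of length p add up to p^2 - 1 + p (p - 1)
    = (p - 1)(2 p + 1). *)
Lemma local_sum_odd (b : bool) :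
  (\sum_(0 <= e < p ^ 2) local_weight b p e =
   if b then p.-1 * (2 * p + 1) else (p ^ 2).-1)%N.
Proof.
case: b; last first.
  by rewrite -sum_fundamental_at; apply: eq_bigr => e _; rewrite /local_weight muln1.
transitivity (\sum_(0 <= e < p ^ 2) (fundamental_at p (sg * e%:Z) + 2 * splits_at p (sg * e%:Z)))%N.
  apply: eq_bigr => e _; rewrite /local_weight /=.
  have [sp|nsp] := boolP (splits_at p _); last by rewrite muln1 muln0 addn0.
  rewrite /fundamental_at (negbTE p2).
  have -> : ((p ^ 2)%N%:Z %| sg * e%:Z)%Z = false.
    move: sp; rewrite /splits_at (negbTE p2) => /andP[np _].
    by apply: contraNF np => h; apply: dvdz_trans h; rewrite dvdzE /= dvdn_exp.
  by [].
rewrite big_split /= sum_fundamental_at -big_distrr /=.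
rewrite expnS expn1 sum_blocks.
rewrite (eq_bigr (fun _ => \sum_(0 <= e < p) splits_at p (sg * e%:Z))%N); last first.
  by move=> j _; apply: eq_bigr => a _; rewrite addnC splits_at_periodic.
rewrite sum_nat_const_nat subn0 mulnCA count_splits.
by case: p p0 => // q _ /=; lia.
Qed.

End OddPrime.

(** Origin of the factor 1 + p / (p + 1) = (2 p + 1) / (p + 1): the quotient of the two sums is (p -
    1)(2 p + 1) / (p^2 - 1) for odd p, and 10 / 6 for p = 2. *)
Lemma local_sum_ratio p : prime p ->
  (p.+1 * \sum_(0 <= e < modulus p) local_weight true p e =
   (2 * p + 1) * \sum_(0 <= e < modulus p) local_weight false p e)%N.
Proof.
move=> pp; rewrite /modulus; case: eqP => [->|/eqP p2]; first by rewrite !local_sum2.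
rewrite !local_sum_odd //; case: p pp {p2} => // q _ /=; lia.
Qed.

End LocalWeights.

(** Only the last incomplete block causes an error: its sum and its expected share both lie between
    0 and the sum over a full period. *)
Lemma periodic_sum_bound (R : realType) (m : nat) (u : nat -> nat) (n : nat) :
  (0 < m)%N -> periodic m u ->
  `|(\sum_(0 <= e < n) u e)%N%:R - n%:R * ((\sum_(0 <= e < m) u e)%N%:R / m%:R)|
    <= (\sum_(0 <= e < m) u e)%N%:R :> R.
Proof.
move=> m0 pu; set T : R := (\sum_(0 <= e < m) u e)%N%:R; have m0' : 0 < m%:R :> R by rewrite ltr0n.
have [q [r [-> rm]]] : exists q r, n = (m * q + r)%N /\ (r < m)%N.
  by exists (n %/ m)%N, (n %% m)%N; rewrite mulnC -divn_eq ltn_pmod.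
pose s := (\sum_(0 <= a < r) u a)%N.
have sE : (\sum_(0 <= e < m * q + r) u e = q * (\sum_(0 <= e < m) u e) + s)%N.
  rewrite (@big_cat_nat _ _ _ (m * q)%N) ?leq_addr //= sum_blocks; congr addn.
    rewrite (eq_bigr (fun _ => \sum_(0 <= e < m) u e)%N) ?sum_nat_const_nat ?subn0 //.
    by move=> j _; apply: eq_bigr => a _; rewrite periodic_mul.
  rewrite -{1}[(m * q)%N]add0n big_addn addKn; apply: eq_bigr => a _.
  by rewrite addnC periodic_mul.
have sT : (s <= \sum_(0 <= e < m) u e)%N.
  by rewrite (@big_cat_nat _ _ _ r 0 m) ?leq_addr // ltnW.
have {}sT : s%:R <= T by rewrite ler_nat.
have -> : (\sum_(0 <= e < m * q + r) u e)%N%:R - (m * q + r)%:R * (T / m%:R) =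
    s%:R - T * (r%:R / m%:R).
  by rewrite sE !natrD !natrM -/T; field; rewrite gt_eqF.
have s0 : 0 <= s%:R :> R by [].
have T0 : 0 <= T by [].
have f0 : 0 <= r%:R / m%:R :> R by rewrite divr_ge0.
have f1 : r%:R / m%:R <= 1 :> R by rewrite ler_pdivrMr // mul1r ler_nat ltnW.
rewrite ler_norml; move: (r%:R / m%:R) f0 f1 => x; nra.
Qed.

(** Comparison with the telescoping terms 1 / (k - 1) - 1 / k. *)
Lemma sum_inverse_squares (R : realType) (z n : nat) : (1 < z)%N ->
  \sum_(z <= k < n) (k%:R ^- 2 : R) <= (z%:R - 1)^-1.
Proof.
move=> z1; have zR : 1 < z%:R :> R by rewrite ltr1n.
have [nz|zn] := leqP n z.
  by rewrite big_geq // invr_ge0 subr_ge0 ltW.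
suff : \sum_(z <= k < n) (k%:R ^- 2 : R) <= (z%:R - 1)^-1 - (n%:R - 1)^-1.
  move=> h; apply: le_trans h _; rewrite gerBl invr_ge0 subr_ge0 ler1n.
  exact: leq_ltn_trans zn.
move: zn => /ltnW; elim: n => [|n IH]; first by rewrite leqn0 => /eqP z0; rewrite z0 in z1.
rewrite leq_eqVlt => /orP[/eqP<-|]; first by rewrite big_geq // subrr.
rewrite ltnS => zn; rewrite big_nat_recr //=; apply: le_trans (lerD (IH zn) (lexx _)) _.
have nR : 1 < n%:R :> R by rewrite ltr1n (leq_trans z1).
rewrite -natr1; move: (n%:R : R) nR => x x1.
rewrite -lerBrDl; have -> : (z%:R - 1)^-1 - (x + 1 - 1)^-1 - ((z%:R - 1)^-1 - (x - 1)^-1) =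
  (x * (x - 1))^-1 :> R by field; rewrite !gt_eqF //; lra.
rewrite lef_pV2 ?posrE; [nra|nra|nra].
Qed.

Lemma sum_square_multiples (R : realType) (z n : nat) : (1 < z)%N ->
  (\sum_(1 <= e < n) \sum_(z <= k < n) (k ^ 2 %| e))%N%:R <= n%:R * (z%:R - 1)^-1 :> R.
Proof.
move=> z1; case: n => [|n]; first by rewrite big_geq // mul0r.
rewrite exchange_big /= natr_sum.
apply: le_trans (ler_wpM2l _ (sum_inverse_squares R n.+1 z1)) => //.
rewrite mulr_sumr !big_nat; apply: ler_sum => k /andP[zk _].
rewrite -divn_count_dvd.
have k0 : 0 < k%:R ^+ 2 :> R by rewrite exprn_gt0 // ltr0n (leq_trans _ zk) // ltnW.
rewrite ler_pdivlMr // -natrX -natrM ler_nat.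
by rewrite (leq_trans (leq_trunc_div _ _)).
Qed.

(** * Sieving by the primes below z *)

Section Density.
Variable sg : int.
Hypothesis sg2 : sg ^+ 2 = 1.
Variable S : {fset nat}.
Hypothesis S_prime : forall p, p \in S -> prime p.

(** For the empty S this is the indicator of fundamental values, so its sums also serve as the
    denominators of the averages. *)
Definition weight (e : nat) : nat :=
  (`[< fundamental (sg * e%:Z) >] * 3 ^ count (fun p => splits_at p (sg * e%:Z)) S)%N.

Definition prime_weight (Q : seq nat) (e : nat) : nat :=
  (\prod_(p <- Q) local_weight sg (p \in S) p e)%N.

Definition prime_modulus (Q : seq nat) : nat := (\prod_(p <- Q) modulus p)%N.

Lemma modulus_gt0 p : prime p -> (0 < modulus p)%N.
Proof. by move=> pp; rewrite /modulus; case: eqP => // _; rewrite expn_gt0 prime_gt0. Qed.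

Lemma prime_modulus_gt0 Q : all prime Q -> (0 < prime_modulus Q)%N.
Proof.
move=> /allP hQ; rewrite /prime_modulus big_seq prodn_cond_gt0 // => p /hQ.
exact: modulus_gt0.
Qed.

Lemma coprime_modulus p q : prime p -> prime q -> p != q -> coprime (modulus p) (modulus q).
Proof.
move=> pp qq pq; rewrite /modulus.
case: eqP => [p2|_]; case: eqP => [q2|_].
- by rewrite p2 q2 in pq.
- by apply: (@coprimeXl 4 2); apply: coprimeXr; rewrite prime_coprime // dvdn_prime2 // -p2.
- by apply: (@coprimeXr 4 _ 2); apply: coprimeXl; rewrite prime_coprime // dvdn_prime2 // -q2.
- by apply: coprimeXl; apply: coprimeXr; rewrite prime_coprime // dvdn_prime2.
Qed.

Lemma prime_weight_sum Q : uniq Q -> all prime Q ->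
  periodic (prime_modulus Q) (prime_weight Q) /\
  (\sum_(0 <= e < prime_modulus Q) prime_weight Q e =
   \prod_(p <- Q) \sum_(0 <= e < modulus p) local_weight sg (p \in S) p e)%N.
Proof.
rewrite /prime_weight /prime_modulus.
elim: Q => [|p Q IH] /=.
  by move=> _ _; split=> [e|]; rewrite !big_nil // big_nat1 big_nil.
case/andP=> pQ uQ /andP[pp aQ]; have [per sumE] := IH uQ aQ.
have lper := local_weight_periodic sg2 (p \in S) p.
split.
  move=> e; rewrite !big_cons; congr muln; first exact: (periodicX _ lper).
  by rewrite mulnC; exact: (periodicX _ per).
rewrite !big_cons -sumE -sum_periodic_coprime //.
- by apply: eq_bigr => e _; rewrite big_cons.
- rewrite big_seq; elim/big_rec: _ => [|q x qQ cx]; first exact: coprimen1.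
  rewrite coprimeMr cx andbT; apply: coprime_modulus => //; first exact: (allP aQ).
  by apply: contraNneq pQ => ->.
- exact: (prime_modulus_gt0 aQ).
Qed.

Definition primes_below (z : nat) : seq nat := [seq p <- iota 0 z | prime p].

Lemma primes_below_uniq z : uniq (primes_below z).
Proof. by rewrite filter_uniq // iota_uniq. Qed.

Lemma primes_below_prime z : all prime (primes_below z).
Proof. exact: filter_all. Qed.

Lemma mem_primes_below z p : (p \in primes_below z) = prime p && (p < z)%N.
Proof. by rewrite mem_filter mem_iota. Qed.

Lemma prime_weight_split z e : (forall p, p \in S -> p < z)%N ->
  prime_weight (primes_below z) e =
  (all (fun p => fundamental_at p (sg * e%:Z)) (primes_below z) *
   3 ^ count (fun p => splits_at p (sg * e%:Z)) S)%N.
Proof.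
move=> Sz; rewrite /prime_weight big_split /=; congr muln.
  elim: (primes_below z) => [|p Q IH]; first by rewrite big_nil.
  by rewrite big_cons IH /= mulnb.
transitivity (3 ^ count (fun p => (p \in S) && splits_at p (sg * e%:Z)) (primes_below z))%N.
  elim: (primes_below z) => [|p Q IH]; first by rewrite big_nil.
  by rewrite big_cons IH /=; case: (_ && _); rewrite ?mul1n // add1n expnS.
congr (3 ^ _)%N.
rewrite [LHS](eq_count (a2 := predI (fun p => splits_at p (sg * e%:Z)) (mem S))); last first.
  by move=> p; rewrite /= andbC.
rewrite -count_filter; apply/permP/uniq_perm; rewrite ?filter_uniq ?fset_uniq ?iota_uniq //.
move=> p; rewrite mem_filter mem_primes_below /=.
by case pS: (p \in S) => //=; rewrite (S_prime pS) (Sz _ pS).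
Qed.

Lemma prime_weight_approx z n e : (2 < z)%N -> (forall p, p \in S -> p < z)%N -> (e < n)%N ->
  (weight e <= prime_weight (primes_below z) e)%N /\
  (prime_weight (primes_below z) e <= weight e +
     3 ^ #|` S| * ((0 < e) * \sum_(z <= k < n) (k ^ 2 %| e)))%N.
Proof.
move=> z2 Sz en; rewrite (prime_weight_split e Sz).
have hall : fundamental (sg * e%:Z) -> all (fun p => fundamental_at p (sg * e%:Z)) (primes_below z).
  by move=> fe; apply/allP => p; rewrite mem_primes_below => /andP[pp _]; exact: fe.
rewrite /weight; case: asboolP => [fe|nfe]; first by rewrite hall // mul1n leq_addr.
rewrite mul0n add0n; split=> //.
case: allP => [ha|]; last by rewrite mul0n.
rewrite mul1n.
apply: (@leq_trans (3 ^ #|` S| * 1)); first by rewrite muln1 leq_exp2l // count_size.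
rewrite leq_mul2l; apply/orP; right.
(* The value 0 fails the condition at 2, which is among those tested because 2 < z. The same
   inequality makes the failing prime q below odd. *)
have e0 : (0 < e)%N.
  rewrite lt0n; apply/eqP=> e0; have := ha 2%N; rewrite mem_primes_below z2 => /(_ isT).
  by rewrite e0 mulr0 /fundamental_at /= mod0z.
rewrite e0 mul1n.
have /existsNP[q /not_implyP[pq /negP nq]] : ~ (forall p, prime p -> fundamental_at p (sg * e%:Z)) by [].
have zq : (z <= q)%N.
  by rewrite leqNgt; apply: contra nq => qz; apply: ha; rewrite mem_primes_below pq.
have qe : (q ^ 2 %| e)%N.
  move: nq; rewrite /fundamental_at gtn_eqF ?(leq_trans z2) // negbK dvdzE abszM.
  by have [->|->] := sgP sg2; rewrite mul1n.
have qn : (q < n)%N.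
  apply: leq_ltn_trans en; apply: leq_trans (dvdn_leq e0 qe).
  by rewrite expnS expn1 leq_pmulr // prime_gt0.
rewrite (bigD1_seq q) ?mem_index_iota ?zq ?iota_uniq //= qe.
by rewrite leq_addr.
Qed.

Definition local_mean (R : realType) (p : nat) : R :=
  (\sum_(0 <= e < modulus p) local_weight sg (p \in S) p e)%N%:R / (modulus p)%:R.

(* A nonfundamental d = sg * e that looks fundamental at all p < z is
   divisible by the square of some prime q >= z. *)
Lemma weight_sum_approx (R : realType) z : (2 < z)%N -> (forall p, p \in S -> p < z)%N ->
  exists C : R, forall n,
    `|(\sum_(0 <= e < n) weight e)%N%:R - n%:R * \prod_(p <- primes_below z) local_mean R p|
      <= C + 3 ^+ #|` S| * (n%:R * (z%:R - 1)^-1).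
Proof.
move=> z2 Sz; have [per sumE] := prime_weight_sum (primes_below_uniq z) (primes_below_prime z).
set W := prime_weight (primes_below z) in per sumE; set M := prime_modulus (primes_below z) in per sumE.
have M0 : (0 < M)%N := prime_modulus_gt0 (primes_below_prime z).
exists (\sum_(0 <= e < M) W e)%N%:R => n.
have mE : \prod_(p <- primes_below z) local_mean R p = (\sum_(0 <= e < M) W e)%N%:R / M%:R.
  rewrite /local_mean big_split /= prodfV sumE /M /prime_modulus.
  by rewrite !natr_prod.
have h1 := periodic_sum_bound R n M0 per; rewrite -mE in h1.
have h2 : (\sum_(0 <= e < n) weight e <= \sum_(0 <= e < n) W e)%N.
  rewrite !big_mkord; apply: leq_sum => e _.
  by have [] := prime_weight_approx z2 Sz (ltn_ord e).
have h3 : (\sum_(0 <= e < n) W e <= \sum_(0 <= e < n) weight e +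
    3 ^ #|` S| * \sum_(1 <= e < n) \sum_(z <= k < n) (k ^ 2 %| e))%N.
  have -> : (\sum_(1 <= e < n) \sum_(z <= k < n) (k ^ 2 %| e) =
      \sum_(0 <= e < n) (0 < e) * \sum_(z <= k < n) (k ^ 2 %| e))%N.
    case: n {h1 h2} => [|n]; first by rewrite !big_geq.
    rewrite [RHS]big_ltn // mul0n add0n !big_nat; apply: eq_bigr => e /andP[e0 _].
    by rewrite e0 mul1n.
  rewrite big_distrr -big_split !big_mkord /=; apply: leq_sum => e _.
  by have [] := prime_weight_approx z2 Sz (ltn_ord e).
have h4 := sum_square_multiples R n (ltnW z2).
move: h1 h2 h3 h4; set P := \prod_(p <- _) _; set T := (\sum_(_ <= e < M) _)%N.
set A := (\sum_(_ <= e < n) weight e)%N; set B := (\sum_(_ <= e < n) W e)%N.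
set D := (\sum_(_ <= e < n) _)%N => h1 h2 h3 h4.
rewrite -(ler_nat R) in h2; rewrite -(ler_nat R) natrD natrM natrX in h3.
have h5 : 3 ^+ #|` S| * D%:R <= 3 ^+ #|` S| * (n%:R * (z%:R - 1)^-1) :> R.
  by rewrite ler_pM2l // exprn_gt0.
move: h1 h2 h3 h5; rewrite !ler_norml.
move: (A%:R) (B%:R) (3 ^+ _ * _) (3 ^+ _ * _) (n%:R * P) (T%:R) => a b x y v c.
lra.
Qed.

End Density.

(** * The ratio of the two densities *)

Section DensityRatio.
Variables (R : realType) (sg : int).
Hypothesis sg2 : sg ^+ 2 = 1.

Lemma primes_belowS z : primes_below z.+1 =
  if prime z then rcons (primes_below z) z else primes_below z.
Proof.
by rewrite /primes_below -addn1 iotaD filter_cat /= add0n; case: ifP; rewrite ?cats1 ?cats0.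
Qed.

Lemma local_mean0 p : prime p ->
  local_mean sg fset0 R p = if p == 2%N then 3 / 8 else 1 - p%:R ^- 2.
Proof.
move=> pp; rewrite /local_mean /modulus inE; case: eqP => [->|/eqP p2].
  by rewrite (local_sum2 sg2 false); field.
rewrite (local_sum_odd sg2 pp p2 false) -subn1 natrB ?expn_gt0 ?prime_gt0 // natrX.
by field; rewrite pnatr_eq0 -lt0n prime_gt0.
Qed.

(* Telescoping: prod_(3 <= k < z) (1 - k^-2) = 2/3 * z / (z - 1). *)
Lemma mean_product_ge z : (2 < z)%N ->
  4^-1 * (z%:R / (z%:R - 1)) <= \prod_(p <- primes_below z) local_mean sg fset0 R p.
Proof.
elim: z => // z IH; rewrite ltnS leq_eqVlt => /orP[/eqP <-|z2].
  rewrite (_ : primes_below 3 = [:: 2%N]) // big_seq1 local_mean0 // eqxx.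
  by rewrite (_ : 3%:R - 1 = 2 :> R); [lra | ring].
have {}IH := IH z2; have zR : 2 < z%:R :> R by rewrite ltr_nat.
rewrite primes_belowS -(natr1 z); case: ifP => [zp|_]; last first.
  apply: le_trans IH; rewrite ler_pM2l ?invr_gt0 // addrK.
  move: (z%:R : R) zR => x x2; rewrite ler_pdivrMr; last by lra.
  rewrite mulrAC ler_pdivlMr; last by lra.
  by nra.
rewrite -cats1 big_cat big_seq1 /= local_mean0 // gtn_eqF //.
move: IH; set P := \prod_(_ <- _) _; move: (z%:R : R) zR => x x2 IH.
have x0 : x != 0 by rewrite gt_eqF //; lra.
have x10 : x - 1 != 0 by rewrite gt_eqF //; lra.
have f0 : 0 <= 1 - x ^- 2 :> R.
  have xpos : 0 < x by lra.
  by rewrite subr_ge0 invf_le1 ?exprn_gt0 //; nra.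
apply: le_trans (ler_wpM2r f0 IH).
by rewrite le_eqVlt; apply/orP; left; apply/eqP; field; rewrite ?x0 ?x10 ?addrK ?x0.
Qed.

Variable S : {fset nat}.
Hypothesis S_prime : forall p, p \in S -> prime p.

Definition split_density : R := \prod_(p <- S) (1 + p%:R / (p%:R + 1)).

Lemma split_density_ge0 : 0 <= split_density.
Proof. by apply: prodr_ge0 => p _; rewrite addr_ge0 // divr_ge0 // addr_ge0. Qed.

Lemma mean_product_ratio z : (forall p, p \in S -> p < z)%N ->
  \prod_(p <- primes_below z) local_mean sg S R p =
  split_density * \prod_(p <- primes_below z) local_mean sg fset0 R p.
Proof.
move=> Sz.
have -> : split_density = \prod_(p <- primes_below z) (if p \in S then 1 + p%:R / (p%:R + 1) else 1).
  rewrite -big_mkcond -big_filter /split_density; apply: perm_big.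
  apply: uniq_perm; rewrite ?filter_uniq ?fset_uniq ?iota_uniq // => p.
  rewrite mem_filter mem_primes_below.
  by case pS: (p \in S) => //=; rewrite (S_prime pS) (Sz _ pS).
rewrite -big_split /= big_seq [RHS]big_seq; apply: eq_bigr => p.
rewrite mem_primes_below => /andP[pp _]; rewrite /local_mean inE.
case: ifP => pS; last by rewrite mul1r.
have m0 : (modulus p)%:R != 0 :> R by rewrite pnatr_eq0 -lt0n modulus_gt0.
have p1 : p%:R + 1 != 0 :> R by rewrite natr1 pnatr_eq0.
have := congr1 (fun k => k%:R : R) (local_sum_ratio sg2 pp).
rewrite !natrM -natr1 natrD natrM => h.
apply: (mulfI p1); rewrite mulrA h; field; by rewrite m0 p1.
Qed.

(** First z is chosen so that the sieve errors, 3^|S| n / (z - 1) for the numerator and rho n / (z -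
    1) for rho times the denominator, total at most eps n / 16. Then n0 makes the constants C and
    C', which depend on z, cost at most eps n / 16 more. The sum eps n / 8 is at most eps times the
    denominator, which is at least n / 4 - n / 8. *)
Lemma weight_density (eps : R) : 0 < eps -> exists n0, forall n, (n0 <= n)%N ->
  `|(\sum_(0 <= e < n) weight sg S e)%N%:R
     - split_density * (\sum_(0 <= e < n) weight sg fset0 e)%N%:R|
    <= eps * (\sum_(0 <= e < n) weight sg fset0 e)%N%:R
  /\ n%:R / 8 <= (\sum_(0 <= e < n) weight sg fset0 e)%N%:R :> R.
Proof.
move=> eps0; set rho := split_density; have rho0 : 0 <= rho := split_density_ge0.
pose K : R := 3 ^+ #|` S| + rho.
have K0 : 0 < K by rewrite ltr_wpDr // exprn_gt0.
pose z := (17 + Num.trunc (16 * K / eps) + \max_(p <- S) p)%N.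
have z17 : (16 < z)%N by rewrite /z -addnA ltn_addr.
have z2 : (2 < z)%N by apply: ltn_trans z17.
have Sz p : p \in S -> (p < z)%N.
  move=> pS; rewrite /z -addnA addSn ltnS.
  apply: leq_trans (leq_addl _ _); apply: leq_trans (leq_addl _ _).
  exact: (@leq_bigmax_seq _ (enum_fset S) xpredT id p pS isT).
have zR : 16 <= z%:R - 1 :> R by rewrite lerBrDr natr1 ler_nat.
have zinv0 : 0 <= (z%:R - 1)^-1 :> R by rewrite invr_ge0; lra.
have zinv : (z%:R - 1)^-1 <= 16^-1 :> R by rewrite lef_pV2 ?posrE //; lra.
have Kz : K * (z%:R - 1)^-1 <= eps / 16.
  rewrite ler_pdivrMr; last by lra.
  have /andP[_ h] := @trunc_itv R (16 * K / eps) ltac:(by rewrite divr_ge0 ?mulr_ge0 // ltW).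
  have : 16 * K / eps <= z%:R - 1.
    apply: le_trans (ltW h) _; rewrite lerBrDr natr1 ler_nat /z.
    by move: (Num.trunc _) (\max_(_ <- _) _)%N; lia.
  rewrite ler_pdivrMr // => h2; nra.
have [C hC] := weight_sum_approx sg2 S_prime R z2 Sz.
have [C' hC'] := @weight_sum_approx sg sg2 fset0 ltac:(by move=> p; rewrite inE) R z z2
  ltac:(by move=> p; rewrite inE).
rewrite mean_product_ratio // in hC; rewrite cardfs0 expr0 in hC'.
have mu4 := mean_product_ge z2; set mu := \prod_(_ <- _) _ in hC hC' mu4.
have {}mu4 : 4^-1 <= mu.
  apply: le_trans mu4; rewrite ler_peMr ?invr_ge0 // ler_pdivlMr; last by lra.
  by rewrite mul1r gerBl.
pose n0 := (Num.trunc (16 * `|C'|) + Num.trunc (16 * (`|C| + rho * `|C'|) / eps)).+2.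
exists n0 => n nn0.
have c1 : 16 * `|C'| <= n%:R.
  have /andP[_ h] := @trunc_itv R (16 * `|C'|) ltac:(by rewrite mulr_ge0).
  apply: le_trans (ltW h) _; rewrite ler_nat; apply: leq_trans nn0.
  by rewrite /n0 ltnS leqW // leq_addr.
have c2 : `|C| + rho * `|C'| <= eps * n%:R / 16.
  have h0 : 0 <= 16 * (`|C| + rho * `|C'|) / eps.
    apply: divr_ge0; last exact: ltW.
    by apply: mulr_ge0 => //; apply: addr_ge0 => //; exact: mulr_ge0.
  have /andP[_ h] := trunc_itv h0.
  have : 16 * (`|C| + rho * `|C'|) / eps <= n%:R.
    apply: le_trans (ltW h) _; rewrite ler_nat; apply: leq_trans nn0.
    by rewrite /n0 ltnS leqW // leq_addl.
  rewrite ler_pdivrMr // => h2; lra.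
have {hC} hC := hC n; have {hC'} hC' := hC' n; rewrite mul1r in hC'.
move: hC hC'; set a := (\sum_(_ <= e < n) _)%N%:R; set b := (\sum_(_ <= e < n) _)%N%:R.
set x := n%:R in c1 c2 *; move=> hC hC'.
have x0 : 0 <= x by [].
have b8 : x / 8 <= b.
  have h1 : x * (z%:R - 1)^-1 <= x * 16^-1 by rewrite ler_wpM2l.
  have h2 : x * 4^-1 <= x * mu by rewrite ler_wpM2l.
  have h3 := ler_norm C'.
  by move: hC'; rewrite ler_norml => /andP[h _]; lra.
split=> //; apply: (@le_trans _ _ (eps * (x / 8))); last by rewrite ler_pM2l.
have -> : a - rho * b = (a - x * (rho * mu)) - rho * (b - x * mu) by ring.
apply: le_trans (ler_normB _ _) _; rewrite normrM (ger0_norm rho0).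
apply: le_trans (lerD hC (ler_wpM2l rho0 hC')) _.
have h4 : x * (K * (z%:R - 1)^-1) <= x * (eps / 16) by rewrite ler_wpM2l.
have h5 := ler_norm C; have h6 : rho * C' <= rho * `|C'| by rewrite ler_wpM2l // ler_norm.
move: h4; rewrite /K; move: (3 ^+ _) ((z%:R - 1)^-1) c2 h5 h6 => k y c2 h5 h6 h4.
have -> : C + k * (x * y) + rho * (C' + x * y) = C + rho * C' + x * ((k + rho) * y) by ring.
apply: le_trans (lerD (lerD h5 h6) h4) _; lra.
Qed.

End DensityRatio.

(** * Quadratic fields *)

(** Coprimality gives v^2 | d. An odd prime in v contradicts the condition at that prime, and 4 | v
    would give 16 | d. *)
Lemma fundamental_denominator (d u v k : int) : fundamental d ->
  coprimez u v -> v != 0 -> d * u ^+ 2 = k * v ^+ 2 -> `|v|%N = 1%N \/ `|v|%N = 2%N.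
Proof.
move=> fd cuv v0 e; have vd : (v ^+ 2 %| d)%Z.
  have : (v ^+ 2 %| d * u ^+ 2)%Z by rewrite e; apply: dvdz_mull.
  rewrite Gauss_dvdzl // coprimezE !abszX coprimeXl // coprimeXr // coprime_sym.
  by rewrite -coprimezE.
have nsq (m : nat) : (m%:Z %| v)%Z -> ((m ^ 2)%N%:Z %| d)%Z.
  move=> mv; apply: dvdz_trans vd.
  by rewrite !dvdzE abszX /= dvdn_exp2r // -[m]absz_nat -dvdzE.
have P q : prime q -> (q%:Z %| v)%Z -> q = 2%N.
  move=> pq qv; apply/eqP; apply: contraT => q2.
  by have := fundamental_no_sq fd pq q2; rewrite nsq.
have n4 : ~~ (4%N%:Z %| v)%Z.
  by apply/negP=> /nsq; have := fundamental2 fd; rewrite !inE; lia.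
have [->|v1] := eqVneq `|v|%N 1%N; [by left|right].
have qd : pdiv `|v| = 2%N.
  by apply: P; rewrite ?dvdzE /= ?pdiv_dvd // pdiv_prime // ltn_neqAle eq_sym v1 absz_gt0.
have := pdiv_dvd `|v|; rewrite qd => /dvdnP[m mv].
have [m1|m1] := eqVneq m 1%N; first by rewrite mv m1.
have pm : prime (pdiv m) by rewrite pdiv_prime //; lia.
have : pdiv m = 2%N.
  by apply: P => //; rewrite dvdzE /= mv dvdn_mulr // pdiv_dvd.
have /dvdnP[l ml] := pdiv_dvd m => m2; rewrite m2 in ml.
by case/negP: n4; rewrite dvdzE mv ml -mulnA dvdn_mull.
Qed.

(** The maximality of Z[w] in coordinates: T^2 - 4 M = d b^2 leaves 1 or 2 as denominator of b. For
    1, the norm shows that 2 a is even; for 2, d has a forbidden residue. *)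
Lemma int_trace_norm (t n : int) (a b : rat) (T M : int) :
  fundamental (t ^+ 2 - 4 * n) ->
  2 * a + t%:~R * b = T%:~R -> a ^+ 2 + t%:~R * a * b + n%:~R * b ^+ 2 = M%:~R ->
  exists z : int * int, a = z.1%:~R /\ b = z.2%:~R.
Proof.
set d := _ - _ => fd hT hM; set u := numq b; set v := denq b.
have bE : b = u%:~R / v%:~R by rewrite divq_num_den.
have v0 : v != 0 by rewrite denq_neq0.
have vq : v%:~R != 0 :> rat by rewrite intr_eq0.
have e0 : T%:~R ^+ 2 - 4 * M%:~R = d%:~R * b ^+ 2 by rewrite -hT -hM /d; ring.
have e : d * u ^+ 2 = (T ^+ 2 - 4 * M) * v ^+ 2.
  apply/(@intr_inj rat); transitivity (d%:~R * b ^+ 2 * v%:~R ^+ 2 : rat).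
    by rewrite bE; field.
  by rewrite -e0; ring.
have cuv : coprimez u v by rewrite coprimezE coprime_num_den.
have [v1|v2] := fundamental_denominator fd cuv v0 e.
  have {}v1 : v = 1 by have := denq_gt0 b; rewrite -/v; lia.
  have {}bE : b = u%:~R by rewrite bE v1 divr1.
  pose c := T - t * u.
  have cE : 2 * a = c%:~R by rewrite /c intrB -hT intrM bE; ring.
  have : c * (c + 2 * (t * u)) = 4 * (M - n * u ^+ 2).
    apply/(@intr_inj rat); transitivity ((2 * a) * (2 * a + 2 * (t%:~R * b))).
      by rewrite cE bE; ring.
    transitivity (4 * (M%:~R - n%:~R * b ^+ 2)); first by rewrite -hM; ring.
    by rewrite bE; ring.
  have [] : c = 2 * (c %/ 2)%Z \/ c = 2 * (c %/ 2)%Z + 1 by lia.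
    move=> c2 _; exists ((c %/ 2)%Z, u); split=> //=.
    have q2 : 2 != 0 :> rat by [].
    by apply: (mulfI q2); rewrite cE {1}c2 intrM.
  move=> ->; move: (_ %/ _)%Z (t * u) (n * u ^+ 2) => x y z.
  have -> : (2 * x + 1) * (2 * x + 1 + 2 * y) = 4 * (x * x + x * y + x) + 2 * y + 1 by ring.
  by move: (_ + _ + x); lia.
(* With u odd, d u^2 = 4 (T^2 - 4 M) makes d congruent to 0 or 4 modulo 16, which is excluded. *)
have {}v2 : v = 2 by have := denq_gt0 b; rewrite -/v; lia.
have [k uk] : exists k, u = 2 * k + 1.
  exists (u %/ 2)%Z; move: cuv; rewrite v2 coprimezE /= coprimen2; lia.
have [j jk] := consecutive_even k.
move: e; rewrite v2 uk.
have -> : (2 * k + 1) ^+ 2 = 4 * (k * (k + 1)) + 1 by ring.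
have -> : (2 : int) ^+ 2 = 4 by [].
rewrite jk; have := fundamental2 fd; rewrite -/d !inE.
have [] : T = 2 * (T %/ 2)%Z \/ T = 2 * (T %/ 2)%Z + 1 by lia.
  move=> ->; move: (_ %/ _)%Z => y; have -> : (2 * y) ^+ 2 = 4 * y ^+ 2 by ring.
  by move: (y ^+ 2); lia.
move=> ->; move: (_ %/ _)%Z => y.
have -> : (2 * y + 1) ^+ 2 = 4 * (y ^+ 2 + y) + 1 by ring.
by move: (y ^+ 2 + y); lia.
Qed.

Definition ratK (K : fieldExtType rat) : {rmorphism rat -> K} := GRing.in_alg K.

Lemma natrK_eq0 (K : fieldExtType rat) (m : nat) : (m%:R == 0 :> K) = (m == 0%N).
Proof. by rewrite -(rmorph_nat (ratK K)) fmorph_eq0 pnatr_eq0. Qed.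

Lemma rat_integral (K : fieldExtType rat) (q : rat) :
  integralOver (intr : int -> K) (ratK K q) -> exists m : int, q = m%:~R.
Proof.
case=> p pm pr.
have rq : root (map_poly intr p) q.
  rewrite -(fmorph_root (ratK K)) -map_poly_comp.
  by rewrite (eq_map_poly (g := intr)) // => x; exact: (rmorph_int (ratK K)).
have ra : root (map_poly intr p) (ratr q : algC).
  have := rq; rewrite -(fmorph_root (@ratr algC)) -map_poly_comp /=.
  by rewrite (eq_map_poly (g := intr)) // => x /=; rewrite ratr_int.
have : (ratr q : algC) \in Aint.
  apply: root_monic_Aint ra _ _.
    by rewrite monicE lead_coef_map_eq (monicP pm) ?oner_eq0.
  by apply/polyOverP=> i; rewrite coef_map /= intr_int.
move/(Cint_rat_Aint (Crat_rat q)) => /intrP[m hm]; exists m.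
by apply: (fmorph_inj (@ratr algC)); exact: etrans hm (esym (ratr_int _ _)).
Qed.

Definition quadratic_gen (K : fieldExtType rat) (t n : int) (w : K) : Prop :=
  [/\ w ^+ 2 = t%:~R * w - n%:~R,
    forall x, exists a b : rat, x = ratK K a + ratK K b * w
  & forall a b : rat, ratK K a + ratK K b * w = 0 -> a = 0 /\ b = 0].

Section QuadraticField.
Variables (K : fieldExtType rat) (t n : int) (w : K).
Hypothesis gen : quadratic_gen t n w.
Local Notation N := (qnorm t n).
Local Notation mul := (qmul t n).
Local Notation conj := (qconj t).
Local Notation d := (t ^+ 2 - 4 * n).

(** The universal property of Q[X] / (X^2 - t X + n). It provides the conjugation, the embeddings
    into [algC] and into the reals, and the isomorphisms between fields of equal discriminant. *)
Lemma quadratic_gen_lift (F : fieldType) (i : {rmorphism rat -> F}) (e : F) :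
  e ^+ 2 = t%:~R * e - n%:~R ->
  exists f : {rmorphism K -> F}, f w = e /\ forall a, f (ratK K a) = i a.
Proof.
move=> he; have [hw span indep] := gen.
have /choice[c0 hc0] := span; have /choice[c1 hc1] := hc0.
pose f x := i (c0 x) + i (c1 x) * e.
have uniq (x : K) a b : x = ratK K a + ratK K b * w -> f x = i a + i b * e.
  move=> hx; have [|h0 h1] := indep (c0 x - a) (c1 x - b).
    transitivity ((ratK K (c0 x) + ratK K (c1 x) * w) - (ratK K a + ratK K b * w)).
      by ring.
    by rewrite -hc1 -hx subrr.
  by rewrite /f; move/eqP: h0; rewrite subr_eq0 => /eqP->; move/eqP: h1; rewrite subr_eq0 => /eqP->.
have fB : zmod_morphism f.
  move=> x y; rewrite (uniq _ (c0 x - c0 y) (c1 x - c1 y)).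
    by rewrite /f; ring.
  by rewrite {1}(hc1 x) {1}(hc1 y); ring.
have fM : monoid_morphism f.
  split; first by rewrite (uniq _ 1 0) ?rmorph0 ?rmorph1 ?mul0r ?addr0.
  move=> x y; rewrite (uniq _ (c0 x * c0 y - c1 x * c1 y * n%:~R)
      (c0 x * c1 y + c1 x * c0 y + c1 x * c1 y * t%:~R)).
    transitivity (i (c0 x) * i (c0 y) + (i (c0 x) * i (c1 y) + i (c1 x) * i (c0 y)) * e
      + i (c1 x) * i (c1 y) * e ^+ 2); last by rewrite /f; ring.
    by rewrite he; ring.
  rewrite {1}(hc1 x) {1}(hc1 y); move: (c0 x) (c1 x) (c0 y) (c1 y) => a b a' b'.
  transitivity (ratK K a * ratK K a' + (ratK K a * ratK K b' + ratK K b * ratK K a') * w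
    + ratK K b * ratK K b' * w ^+ 2); first by ring.
  by rewrite hw; ring.
pose fz := GRing.isZmodMorphism.Build K F f fB.
pose fm := GRing.isMonoidMorphism.Build K F f fM.
pose g : {rmorphism K -> F} := HB.pack f fz fm.
exists g; split=> [|a] /=.
  by rewrite (uniq _ 0 1) ?rmorph0 ?rmorph1 ?mul1r ?add0r.
by rewrite (uniq _ a 0) ?rmorph0 ?mul0r ?addr0.
Qed.

Definition qelt (x : int * int) : K := x.1%:~R + x.2%:~R * w.

Lemma qeltM x y : qelt (mul x y) = qelt x * qelt y.
Proof.
have [hw _ _] := gen; rewrite /qelt /qmul /=.
transitivity (x.1%:~R * y.1%:~R + (x.1%:~R * y.2%:~R + x.2%:~R * y.1%:~R) * w
  + x.2%:~R * y.2%:~R * w ^+ 2); last by ring.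
by rewrite hw; ring.
Qed.

Lemma qeltD x y : qelt (x.1 + y.1, x.2 + y.2) = qelt x + qelt y.
Proof. rewrite /qelt /=; ring. Qed.

Lemma qelt_lin a b x y :
  qelt (a * x.1 + b * y.1, a * x.2 + b * y.2) = a%:~R * qelt x + b%:~R * qelt y.
Proof. rewrite /qelt /=; ring. Qed.

Lemma qelt_int (m : int) : qelt (m, 0) = m%:~R.
Proof. by rewrite /qelt /= mul0r addr0. Qed.

Lemma qelt_inj : injective qelt.
Proof.
have [_ _ indep] := gen; move=> x y h.
have [|h1 h2] := indep (x.1 - y.1)%:~R (x.2 - y.2)%:~R.
  by transitivity (qelt x - qelt y); [rewrite /qelt; ring | rewrite h subrr].
move/eqP: h1; move/eqP: h2; rewrite !intr_eq0 !subr_eq0 => /eqP h2 /eqP h1.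
by rewrite [x]surjective_pairing [y]surjective_pairing h1 h2.
Qed.

Lemma qelt_eq0 x : (qelt x == 0) = (x == (0, 0)).
Proof. by rewrite -(inj_eq qelt_inj) qelt_int. Qed.

Lemma qelt_norm x : qelt x * qelt (conj x) = (N x)%:~R.
Proof. by rewrite -qeltM qmul_conj qelt_int. Qed.

Hypothesis fd : fundamental d.

(** The conjugation s : w |-> t - w preserves integrality, so the trace and the norm of an integral
    x are rational and integral, hence integers, and [int_trace_norm] applies. *)
Lemma ring_of_integersE x : @ring_of_integers K x <-> exists z, x = qelt z.
Proof.
have [hw span indep] := gen; split; last first.
  case=> z ->; apply: integral_add; first exact: integral_id.
  apply: integral_mul; first exact: integral_id.
  exists ('X^2 - t *: 'X + n%:P).
    rewrite monicE -addrA lead_coefDl ?lead_coefXn // size_polyXn.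
    rewrite (leq_ltn_trans (size_polyD _ _)) // size_polyN gtn_max.
    rewrite (leq_ltn_trans (size_polyC_leq1 _)) // andbT.
    by rewrite (leq_ltn_trans (size_scale_leq _ _)) // size_polyX.
  rewrite /root rmorphD rmorphB /= map_polyXn map_polyZ map_polyX map_polyC /=.
  by rewrite !hornerE /= hw; apply/eqP; ring.
case: (span x) => a [b xE] Ox.
have [s [sw si]] := @quadratic_gen_lift K (ratK K) (t%:~R - w) ltac:(
  transitivity (t%:~R ^+ 2 - 2 * t%:~R * w + w ^+ 2); [ring | rewrite hw; ring]).
have Osx : integralOver (intr : int -> K) (s x).
  case: Ox => p pm pr; exists p => //.
  move: pr; rewrite -(fmorph_root s) -map_poly_comp.
  by rewrite (eq_map_poly (g := intr)) // => y; exact: (rmorph_int s).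
have sx : s x = ratK K a + ratK K b * (t%:~R - w).
  by rewrite xE rmorphD rmorphM !si sw.
have [T hT] : exists T : int, 2 * a + t%:~R * b = T%:~R.
  apply: (@rat_integral K); have := integral_add Ox Osx.
  rewrite sx {1}xE; congr (integralOver _ _).
  by ring.
have [M hM] : exists M : int, a ^+ 2 + t%:~R * a * b + n%:~R * b ^+ 2 = M%:~R.
  apply: (@rat_integral K); have := integral_mul Ox Osx.
  rewrite sx {1}xE; congr (integralOver _ _).
  transitivity (ratK K a ^+ 2 + t%:~R * ratK K a * ratK K b
    + t%:~R * ratK K b ^+ 2 * w - ratK K b ^+ 2 * w ^+ 2); first by ring.
  by rewrite hw; ring.
have [z [h1 h2]] := int_trace_norm fd hT hM; exists z.
by rewrite xE h1 h2 !rmorph_int.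
Qed.

End QuadraticField.

(** Expanding each basis in the other one gives the same double sum. This frees [field_trace] from
    the unspecified [vbasis]. *)
Lemma field_trace_basis (K : fieldExtType rat) (m : nat) (e : m.-tuple K) x :
  basis_of {:K} e -> field_trace x = \sum_(i < m) coord e i (x * e`_i).
Proof.
move=> be; have bb := vbasisP {:K}; rewrite /field_trace.
transitivity (\sum_(i < \dim {:K}) \sum_(j < m)
    coord (vbasis {:K}) i (x * e`_j) * coord e j (vbasis {:K})`_i).
  apply: eq_bigr => i _; rewrite [in LHS](coord_basis be (memvf (vbasis {:K})`_i)).
  rewrite mulr_sumr linear_sum; apply: eq_bigr => j _.
  by rewrite -scalerAr linearZ /= mulrC.
rewrite exchange_big; apply: eq_bigr => j _.
rewrite [in RHS](coord_basis bb (memvf (x * e`_j))) linear_sum.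
by apply: eq_bigr => i _; rewrite linearZ.
Qed.

Lemma det_mx22 (F : comNzRingType) (M : 'M[F]_2) :
  \det M = M ord0 ord0 * M (lift ord0 ord0) (lift ord0 ord0)
    - M ord0 (lift ord0 ord0) * M (lift ord0 ord0) ord0.
Proof.
rewrite (expand_det_row _ ord0) !big_ord_recl big_ord0 addr0 /cofactor !det_mx11 !mxE /=.
have -> : lift (lift ord0 ord0 : 'I_2) 0 = ord0 by apply: val_inj.
have -> : lift (ord0 : 'I_2) 0 = lift ord0 ord0 by apply: val_inj.
by rewrite /= /bump /= addn0 expr0 mul1r expr1 mulN1r mulrN.
Qed.

Definition irrational (K : fieldExtType rat) (x : K) : Prop := forall a, x <> ratK K a.

Lemma pair_free (K : fieldExtType rat) (w : K) : irrational w -> free [tuple 1; w].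
Proof.
move=> irr; apply/freeP => k; rewrite !big_ord_recl big_ord0 addr0 /= => e.
have k1 : k (lift ord0 ord0) = 0.
  apply/eqP/negPn/negP => k1; apply: (irr (- k ord0 / k (lift ord0 ord0))).
  have : k (lift ord0 ord0) *: w = k (lift ord0 ord0) *: ratK K (- k ord0 / k (lift ord0 ord0)).
    rewrite scalerA mulrC divfK //; apply/eqP; rewrite scaleNr -addr_eq0 addrC.
    exact/eqP.
  by move/(scalerI k1).
have k0 : k ord0 = 0.
  by move/eqP: e; rewrite k1 scale0r addr0 scaler_eq0 oner_eq0 orbF => /eqP.
by move=> i; case: (unliftP ord0 i) => [j ->|-> //]; rewrite ord1.
Qed.

Lemma pair_basis (K : fieldExtType rat) (w : K) :
  quadratic K -> irrational w -> basis_of {:K} [tuple 1; w].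
Proof.
move=> qK irr; rewrite basisEfree (pair_free irr) qK /= andbT.
by apply/subvP => x _; rewrite memvf.
Qed.

Lemma quadratic_genI (K : fieldExtType rat) (t n : int) (w : K) :
  quadratic K -> irrational w -> w ^+ 2 = t%:~R * w - n%:~R -> quadratic_gen t n w.
Proof.
move=> qK irr hw; split=> // [x|a b h].
  exists (coord [tuple 1; w] ord0 x), (coord [tuple 1; w] (lift ord0 ord0) x).
  rewrite [LHS](coord_basis (pair_basis qK irr) (memvf x)).
  by rewrite !big_ord_recl big_ord0 addr0 /= mulr_algl.
have b0 : b = 0.
  apply/eqP/negPn/negP => b0; apply: (irr (- a / b)).
  have b0' : ratK K b != 0 by rewrite fmorph_eq0.
  apply: (mulfI b0'); transitivity (- ratK K a).
    by apply/eqP; rewrite -addr_eq0 addrC h.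
  by rewrite -rmorphM mulrC divfK // rmorphN.
split=> //; move: h; rewrite b0 rmorph0 mul0r addr0 => /eqP.
by rewrite fmorph_eq0 => /eqP.
Qed.

(** * Trace form and discriminant *)

Section Discriminant.
Variables (K : fieldExtType rat) (t n : int) (w : K).
Hypothesis gen : quadratic_gen t n w.
Local Notation d := (t ^+ 2 - 4 * n).
Hypothesis fd : fundamental d.
Local Notation N := (qnorm t n).
Local Notation qelt := (qelt w).

Lemma quadratic_gen_irrational : irrational w.
Proof.
have [_ _ indep] := gen => a h; have [|_] := indep (- a) 1.
  by rewrite h rmorphN rmorph1 mul1r addNr.
by move/eqP; rewrite oner_eq0.
Qed.

Lemma quadratic_gen_basis : basis_of {:K} [tuple 1; w].
Proof.
rewrite basisEdim; apply/andP; split.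
  apply/subvP => x _; have [_ span _] := gen; have [a [b ->]] := span x.
  rewrite /= !mulr_algl; apply: memvD; apply: memvZ; apply: memv_span; rewrite !inE eqxx ?orbT //.
rewrite -(eqP (pair_free quadratic_gen_irrational)) /=.
exact: dimvS (subvf _).
Qed.

Lemma quadratic_gen_quadratic : quadratic K.
Proof. by have := size_basis quadratic_gen_basis. Qed.

Lemma field_trace_gen (a b : rat) :
  field_trace (ratK K a + ratK K b * w) = 2 * a + t%:~R * b.
Proof.
have fr := pair_free quadratic_gen_irrational.
have C (u v : rat) (i : 'I_2) : coord [tuple 1; w] i (ratK K u + ratK K v * w) =
    if i == ord0 then u else v.
  have -> : ratK K u + ratK K v * w =
      \sum_(j < 2) (if j == ord0 then u else v) *: [tuple 1; w]`_j.
    by rewrite !big_ord_recl big_ord0 /= addr0 !mulr_algl.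
  by rewrite coord_sum_free.
have [hw _ _] := gen.
rewrite (field_trace_basis _ quadratic_gen_basis) !big_ord_recl big_ord0 addr0 /=.
rewrite mulr1 C /=.
have -> : (ratK K a + ratK K b * w) * w =
    ratK K (- (n%:~R * b)) + ratK K (a + t%:~R * b) * w.
  transitivity (ratK K a * w + ratK K b * w ^+ 2); first by ring.
  by rewrite hw; ring.
by rewrite C /=; ring.
Qed.

Lemma field_trace_qelt z : field_trace (qelt z) = (2 * z.1 + t * z.2)%:~R.
Proof.
have -> : qelt z = ratK K z.1%:~R + ratK K z.2%:~R * w by rewrite !rmorph_int.
by rewrite field_trace_gen; ring.
Qed.

(** The determinant D of the change from (1, w) to W is invertible over the integers, so D^2 = 1.
    The variable m stands for the dimension of K, which equals 2 only propositionally. *)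
Lemma det_integral_basis (m : nat) (W : m.-tuple K) : m = 2%N ->
  (forall x, ring_of_integers x <->
    exists c : 'I_m -> int, x = \sum_(i < m) W`_i *~ c i) ->
  \det (\matrix_(i < m, j < m) field_trace (W`_i * W`_j)) = d%:~R.
Proof.
move=> m2; subst m => hW.
have hO (i : 'I_2) : exists z, W`_i = qelt z.
  apply/(ring_of_integersE gen fd)/hW; exists (fun j => (j == i)%:Z).
  by rewrite (bigD1 i) //= eqxx mulr1z big1 ?addr0 // => j /negbTE ->; rewrite mulr0z.
have [z0 /= h0] := hO ord0; have [z1 /= h1] := hO (lift ord0 ord0).
have hS z : exists a b : int, z = (a * z0.1 + b * z1.1, a * z0.2 + b * z1.2).
  have /hW[c] : ring_of_integers (qelt z) by apply/(ring_of_integersE gen fd); exists z.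
  rewrite !big_ord_recl big_ord0 addr0 /= h0 h1 => e.
  exists (c ord0), (c (lift ord0 ord0)); apply: (qelt_inj gen).
  by rewrite e qelt_lin !mulrzl.
have [x [y [e1 e2]]] := hS (1, 0); have [u [v [e3 e4]]] := hS (0, 1).
pose D := z0.1 * z1.2 - z0.2 * z1.1.
have D1 : D ^+ 2 = 1.
  have : (x * v - y * u) * D = 1.
    transitivity ((x * z0.1 + y * z1.1) * (u * z0.2 + v * z1.2)
      - (x * z0.2 + y * z1.2) * (u * z0.1 + v * z1.1)); first by rewrite /D; ring.
    by rewrite -e1 -e2 -e3 -e4.
  move/(congr1 absz); rewrite abszM => /eqP; rewrite muln_eq1 => /andP[_ /eqP hD].
  by have [->|->] : D = 1 \/ D = -1 by lia.
rewrite det_mx22 !mxE /= h0 h1 -!(qeltM gen) !field_trace_qelt.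
have -> : d = d * D ^+ 2 by rewrite D1 mulr1.
by rewrite /qmul /D /=; ring.
Qed.

Lemma exists_integral_basis (m : nat) : m = 2%N -> exists W : m.-tuple K,
  basis_of {:K} W /\ forall x, ring_of_integers x <->
    exists c : 'I_m -> int, x = \sum_(i < m) W`_i *~ c i.
Proof.
move=> ->; exists [tuple 1; w]; split; first exact: quadratic_gen_basis.
move=> x; rewrite (ring_of_integersE gen fd); split=> [[z ->]|[c ->]].
  exists (fun i => if i == ord0 then z.1 else z.2).
  by rewrite !big_ord_recl big_ord0 addr0 /= /qelt mulrzl.
exists (c ord0, c (lift ord0 ord0)).
by rewrite !big_ord_recl big_ord0 addr0 /= /qelt /= mulrzl.
Qed.

Lemma discriminantE : discriminant K = d.
Proof.
have qK := quadratic_gen_quadratic.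
apply: xget_unique; last first.
  move=> d' [W [_ hW]]; rewrite (det_integral_basis qK hW) => /eqP.
  by rewrite eqr_int => /eqP.
have [W [bW hW]] := exists_integral_basis qK.
by exists W; [split | rewrite (det_integral_basis qK hW)].
Qed.

End Discriminant.

(** * Generators, existence and isomorphism of quadratic fields *)

Lemma irrational_square (K : fieldExtType rat) (x : K) (m : int) :
  irrational x -> x ^+ 2 = m%:~R -> forall a, m != a ^+ 2.
Proof.
move=> irr hx a; apply/eqP=> ma; have : (x - a%:~R) * (x + a%:~R) = 0.
  transitivity (x ^+ 2 - a%:~R ^+ 2); first by ring.
  by rewrite hx ma; ring.
move/eqP; rewrite mulf_eq0 subr_eq0 addr_eq0 => /orP[] /eqP h.
  by apply: (irr a%:~R); rewrite rmorph_int.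
by apply: (irr (- a%:~R)); rewrite rmorphN rmorph_int.
Qed.

Lemma irrationalZ (K : fieldExtType rat) (x : K) (a : rat) :
  a != 0 -> irrational x -> irrational (ratK K a * x).
Proof.
move=> a0 irr b h; apply: (irr (b / a)); rewrite rmorphM fmorphV -h mulrC mulKf //.
by rewrite fmorph_eq0.
Qed.

Lemma irrationalD (K : fieldExtType rat) (x : K) (a : rat) :
  irrational x -> irrational (x + ratK K a).
Proof.
move=> irr b h; apply: (irr (b - a)).
by rewrite rmorphB -h addrK.
Qed.

Lemma exists_irrational_sqrt (K : fieldExtType rat) : quadratic K ->
  exists (z : K) (m : int), irrational z /\ z ^+ 2 = m%:~R.
Proof.
move=> qK.
have [y irr] : exists y : K, irrational y.
  apply: contrapT => /forallNP H.
  have : ({:K} <= 1)%VS.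
    apply/subvP => y _; have /existsNP[a /contrapT ->] := H y.
    by rewrite /= memvZ // mem1v.
  by move/dimvS; rewrite qK dimv1.
have yb := pair_basis qK irr.
have [a [b yE]] : exists a b, y ^+ 2 = ratK K a + ratK K b * y.
  exists (coord [tuple 1; y] ord0 (y ^+ 2)), (coord [tuple 1; y] (lift ord0 ord0) (y ^+ 2)).
  rewrite [LHS](coord_basis yb (memvf _)).
  by rewrite !big_ord_recl big_ord0 addr0 /= mulr_algl.
pose c := 4 * a + b ^+ 2.
have dc0 : (denq c)%:~R != 0 :> rat by rewrite intr_eq0 denq_neq0.
(* Completing the square, (2 y - b)^2 = 4 a + b^2 = c; scaling by the denominator of c makes the
   square an integer. *)
exists (ratK K (denq c)%:~R * (ratK K 2 * y + ratK K (- b))), (numq c * denq c); split.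
  by apply: irrationalZ => //; apply: irrationalD; apply: irrationalZ.
transitivity (ratK K (denq c)%:~R ^+ 2 * (4 * y ^+ 2 - 4 * ratK K b * y + ratK K b ^+ 2)).
  by ring.
transitivity (ratK K ((denq c)%:~R ^+ 2 * c)).
  by rewrite yE /c; ring.
rewrite -(rmorph_int (ratK K)); congr (ratK K _).
by rewrite intrM numqE; ring.
Qed.

(* Among the integers that become nonrational squares in K, one of minimal
   absolute value is squarefree. *)
Lemma quadratic_genP (K : fieldExtType rat) : quadratic K ->
  exists t n w, [/\ @quadratic_gen K t n w, fundamental (t ^+ 2 - 4 * n)
    & t ^+ 2 - 4 * n != 1].
Proof.
move=> qK; have [z0 [m0 [irr0 hz0]]] := exists_irrational_sqrt qK.
pose P (k : nat) := `[< exists (z : K) (m : int), [/\ irrational z, z ^+ 2 = m%:~R & `|m|%N = k] >].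
have exP : exists k, P k by exists `|m0|%N; apply/asboolP; exists z0, m0.
case: (ex_minnP exP) => k /asboolP[z [m [irr hz mk]]] kmin.
have m0' : m != 0.
  apply/eqP=> m0'; move: hz; rewrite m0' => /eqP; rewrite expf_eq0 /= => /eqP z0'.
  by apply: (irr 0); rewrite z0' rmorph0.
have nsq (p : nat) : (1 < p)%N -> ~~ ((p ^ 2)%N%:Z %| m)%Z.
  move=> p1; apply/negP=> /dvdzP[m' mm'].
  have p0 : p%:R != 0 :> rat by rewrite pnatr_eq0; lia.
  have p0' : p%:R != 0 :> K by rewrite natrK_eq0 -(pnatr_eq0 rat).
  have : (k <= `|m'|)%N.
    apply: kmin; apply/asboolP; exists (ratK K p%:R^-1 * z), m'; split=> //.
      by apply: irrationalZ => //; rewrite invr_eq0.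
    rewrite fmorphV rmorph_nat exprMn hz mm' intrM; field.
    exact: p0'.
  move: mk; rewrite mm' abszM absz_nat => <-; apply/negP; rewrite -ltnNge.
  rewrite -[X in (X < _)%N]muln1 ltn_pmul2l; last by lia.
  by rewrite -[1%N](exp1n 2) ltn_exp2r.
have fnsq := irrational_square irr hz.
have n4 : ~~ (4 %| m)%Z := nsq 2%N isT.
have F d : (d %% 16)%Z \in [:: 1; 5; 8; 9; 12; 13] -> d = m \/ d = 4 * m -> fundamental d.
  move=> h2 dm p pp; rewrite /fundamental_at; case: eqP => [//|/eqP p2].
  apply: contra (nsq p (prime_gt1 pp)); case: dm => -> //.
  rewrite Gauss_dvdzr // coprimezE /= coprimeXl //.
  by apply: (@coprimeXr 2 p 2); rewrite prime_coprime // dvdn_prime2.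
(* If m = 1 mod 4, then w = (1 + z) / 2 and d = m; otherwise w = z and d = 4 m. *)
have [m1|m1] := eqVneq (m %% 4)%Z 1.
  have [n mn] : exists n, m = 1 - 4 * n by exists (- (m %/ 4)%Z); lia.
  exists 1, n, (ratK K 2^-1 * z + ratK K 2^-1); rewrite expr1n -mn; split.
  - apply: quadratic_genI => //.
      by apply: irrationalD; apply: irrationalZ.
    transitivity (ratK K (2^-1 ^+ 2) * (z ^+ 2 + 2 * z + 1)); first by ring.
    rewrite hz mn.
    transitivity (ratK K (2^-1 ^+ 2 * 2) * z + ratK K (2^-1 ^+ 2 * (2 - 4 * n%:~R))).
      by ring.
    transitivity (ratK K 2^-1 * z + ratK K (2^-1 - n%:~R)); last by ring.
    by congr (ratK K _ * z + ratK K _); field.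
  - by apply: F; [rewrite !inE; lia | left].
  - by have := fnsq 1; rewrite expr1n.
exists 0, (- m), z; split.
- by apply: quadratic_genI => //; rewrite hz; ring.
- by apply: F; [rewrite !inE; lia | right; ring].
- by lia.
Qed.

Lemma fundamental_form d : fundamental d -> exists t n, d = t ^+ 2 - 4 * n.
Proof.
move=> /fundamental2 h; have [h0|h1] : (d %% 4)%Z = 0 \/ (d %% 4)%Z = 1.
- by move: h; rewrite !inE; lia.
- by exists 0, (- (d %/ 4)%Z); lia.
- by exists 1, (- (d %/ 4)%Z); lia.
Qed.

(** Adjoin a root of X^2 - t X + n. A rational root would make d a rational square, against
    [fundamental_not_square], and a quadratic polynomial without roots is irreducible. *)
Lemma quadratic_gen_exists (t n : int) : fundamental (t ^+ 2 - 4 * n) ->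
  t ^+ 2 - 4 * n != 1 -> exists (K : fieldExtType rat) (w : K), quadratic_gen t n w.
Proof.
move=> fd d1; pose p : {poly rat} := 'X^2 - t%:~R *: 'X + n%:~R%:P.
have sp : size p = 3%N.
  rewrite /p -addrA size_polyDl size_polyXn //.
  rewrite (leq_ltn_trans (size_polyD _ _)) // size_polyN gtn_max.
  rewrite (leq_ltn_trans (size_polyC_leq1 _)) // andbT.
  by rewrite (leq_ltn_trans (size_scale_leq _ _)) // size_polyX.
have nr q : ~~ root p q.
  rewrite /root /p !hornerE /=; apply/eqP=> h.
  have dq0 : denq q != 0 by rewrite denq_neq0.
  have /eqP[] := fundamental_not_square (2 * numq q - t * denq q) fd d1 dq0.
  apply/(@intr_inj rat); have dq0' : (denq q)%:~R != 0 :> rat by rewrite intr_eq0.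
  transitivity ((2 * q - t%:~R) ^+ 2 * (denq q)%:~R ^+ 2).
    by rewrite rmorphXn rmorphB !rmorphM /= numqE; ring.
  transitivity ((t ^+ 2 - 4 * n)%:~R * (denq q)%:~R ^+ 2 : rat); last by ring.
  congr (_ * _); apply/eqP; rewrite -subr_eq0; apply/eqP.
  by transitivity (4 * (q ^+ 2 - t%:~R * q + n%:~R)); [ring | rewrite h mulr0].
have irp : irreducible_poly p by apply: cubic_irreducible; rewrite ?sp.
have [L dL [w rw _]] := irredp_FAdjoin irp.
have qL : quadratic L by rewrite /quadratic dL sp.
exists L, w; apply: quadratic_genI => //.
  move=> a wa; have /negP[] := nr a; rewrite -(fmorph_root (ratK L)).
  by rewrite -wa.
move: rw; rewrite /root rmorphD rmorphB /= map_polyXn map_polyZ /= map_polyX map_polyC /=.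
rewrite !hornerE /= => /eqP h; apply/eqP; rewrite -subr_eq0; apply/eqP.
rewrite -h -(rmorph_int (ratK L) t) -(rmorph_int (ratK L) n) /=; ring.
Qed.

Lemma ratK_lift (K : fieldExtType rat) (F : fieldType) (f : {rmorphism K -> F}) a :
  f (ratK K a) = ratr a.
Proof. exact: (fmorph_eq_rat (f \o ratK K)). Qed.

(** Equal discriminants force t = t' + 2 k, and then w' + k satisfies the equation of w. *)
Lemma isomorphic_of_disc (K L : fieldExtType rat) (t n t' n' : int) (w : K) (w' : L) :
  quadratic_gen t n w -> quadratic_gen t' n' w' ->
  t ^+ 2 - 4 * n = t' ^+ 2 - 4 * n' -> field_isomorphic K L.
Proof.
move=> gK [hw' span' _] e.
have [k tk] : exists k, t = t' + 2 * k.
  have [j hj] : exists j, (t - t') * (t - t') = 2 * j - 2 * t' * (t - t').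
    by exists (2 * (n - n')); rewrite -[RHS]addr0 -(subrr (t ^+ 2 - 4 * n)) {2}e; ring.
  exists ((t - t') %/ 2)%Z.
  have [] : t - t' = 2 * ((t - t') %/ 2)%Z \/ t - t' = 2 * ((t - t') %/ 2)%Z + 1 by lia.
    by lia.
  move: hj; move: (t - t') => x hj hx; exfalso; move: hj; rewrite {}hx.
  move: (_ %/ _)%Z => y.
  have -> : (2 * y + 1) * (2 * y + 1) = 2 * (2 * (y * y + y)) + 1 by ring.
  have -> : 2 * j - 2 * t' * (2 * y + 1) = 2 * (j - t' * (2 * y + 1)) by ring.
  by move: (2 * (y * y + y)) (j - _); lia.
have nn : n = n' + k * (t' + k).
  by apply: (mulfI (isT : (4 : int) != 0)); rewrite -[LHS](subrK (t ^+ 2)) -opprB e tk; ring.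
have [|f [fw fr]] := quadratic_gen_lift gK (ratK L) (e := w' + k%:~R).
  transitivity (w' ^+ 2 + 2 * k%:~R * w' + k%:~R ^+ 2); first by ring.
  by rewrite hw' nn tk; ring.
have fsurj y : exists x, f x = y.
  have [a [b ->]] := span' y; exists (ratK K (a - k%:~R * b) + ratK K b * w).
  by rewrite rmorphD rmorphM !fr fw; ring.
have /choice[g hg] := fsurj.
by exists f; exists g => [x|y]; [apply: (fmorph_inj f) |]; rewrite hg.
Qed.

Lemma isomorphic_disc (K L : fieldExtType rat) :
  quadratic K -> quadratic L -> field_isomorphic K L -> discriminant K = discriminant L.
Proof.
move=> qK qL [f _]; have [t [n [w [gK fd _]]]] := quadratic_genP qK.
rewrite (discriminantE gK fd); symmetry.
have irr : irrational (f w).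
  move=> a h; apply: (quadratic_gen_irrational gK (a := a)); apply: (fmorph_inj f).
  by rewrite ratK_lift h (fmorph_eq_rat (ratK L)).
apply: (@discriminantE L t n (f w) _ fd); apply: quadratic_genI => //.
by have [hw _ _] := gK; rewrite -rmorphXn hw rmorphB rmorphM !rmorph_int.
Qed.

(** * Real and imaginary embeddings *)

Section Signature.
Variables (K : fieldExtType rat) (t n : int) (w : K).
Hypothesis gen : quadratic_gen t n w.
Local Notation d := (t ^+ 2 - 4 * n).

Lemma embedding_sqr (s : {rmorphism K -> algC}) :
  (2 * s w - t%:~R) ^+ 2 = d%:~R.
Proof.
have [hw _ _] := gen.
transitivity (s (4 * w ^+ 2 - 4 * t%:~R * w + t%:~R ^+ 2)); first by ring.
by rewrite hw; ring.
Qed.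

(** Being real or imaginary quantifies over all embeddings; one embedding excludes the vacuous
    case. *)
Lemma exists_embedding : exists s : {rmorphism K -> algC}, True.
Proof.
pose e : algC := (t%:~R + sqrtC d%:~R) / 2.
have he : e ^+ 2 = t%:~R * e - n%:~R.
  transitivity ((t%:~R ^+ 2 + 2 * t%:~R * sqrtC d%:~R + sqrtC d%:~R ^+ 2) / 4 : algC).
    by rewrite /e; field.
  by rewrite sqrtCK /e; field.
by have [s _] := quadratic_gen_lift gen (@ratr algC) he; exists s.
Qed.

Lemma embedding_real (s : {rmorphism K -> algC}) x : 0 <= d -> s x \is Num.real.
Proof.
move=> d0; have [hw span _] := gen; have [a [b ->]] := span x.
have rr q : ratr q \is @Num.real algC by apply: Creal_Crat; exact: Crat_rat.
rewrite rmorphD rmorphM !ratK_lift; apply: rpredD => //; apply: rpredM => //.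
have sq : (2 * s w - t%:~R - sqrtC d%:~R) * (2 * s w - t%:~R + sqrtC d%:~R) = 0.
  rewrite -subr_sqr embedding_sqr sqrtCK subrr //.
have sr : sqrtC (d%:~R : algC) \is Num.real by rewrite sqrtC_real // ler0z.
have -> : s w = (2 * s w - t%:~R + t%:~R) / 2 by field.
have h2 : (2 * s w - t%:~R) \is Num.real.
  by move/eqP: sq; rewrite mulf_eq0 subr_eq0 addr_eq0 => /orP[] /eqP ->; rewrite ?rpredN.
by apply: rpred_div; [apply: rpredD => //; exact: realz | exact: realn].
Qed.

Lemma embedding_not_real (s : {rmorphism K -> algC}) : d < 0 -> s w \isn't Num.real.
Proof.
move=> d0; apply/negP=> h; have := embedding_sqr s.
have : (2 * s w - t%:~R) \is Num.real.
  by apply: rpredB; [apply: rpredM => //; exact: realn | exact: realz].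
move/(@real_exprn_even_ge0 _ 2) => /(_ isT) /[swap] ->; rewrite ler0z => h2.
by move: d0; rewrite ltNge h2.
Qed.

End Signature.

Lemma quadratic_gen_disc_neq0 (t n : int) : fundamental (t ^+ 2 - 4 * n) -> t ^+ 2 - 4 * n != 0.
Proof. by move=> /fundamental2 h; apply/eqP => e; move: h; rewrite e !inE; lia. Qed.

Lemma real_quadraticE (K : fieldExtType rat) t n (w : K) : quadratic_gen t n w ->
  fundamental (t ^+ 2 - 4 * n) -> real_quadratic K <-> 0 < t ^+ 2 - 4 * n.
Proof.
move=> gK fd; split=> [[_ H]|d0]; last first.
  by split; [exact: quadratic_gen_quadratic gK | move=> s x; exact: (embedding_real gK s x (ltW d0))].
rewrite ltNge le_eqVlt (negbTE (quadratic_gen_disc_neq0 fd)) /=; apply/negP=> d0.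
by have [s _] := exists_embedding gK; have := embedding_not_real gK s d0; rewrite H.
Qed.

Lemma imaginary_quadraticE (K : fieldExtType rat) t n (w : K) : quadratic_gen t n w ->
  fundamental (t ^+ 2 - 4 * n) -> imaginary_quadratic K <-> t ^+ 2 - 4 * n < 0.
Proof.
move=> gK fd; split=> [[_ H]|d0]; last first.
  split; first exact: quadratic_gen_quadratic gK.
  by move=> s; exists w; exact: embedding_not_real gK s d0.
rewrite ltNge; apply/negP=> d0; have [s _] := exists_embedding gK.
by have [x] := H s; rewrite (embedding_real gK s x d0).
Qed.

Local Open Scope classical_set_scope.

(** * S-units *)

Section LocalPrimes.
Variable K : fieldExtType rat.
Local Notation O := (@ring_of_integers K).

Lemma ring_of_integersD x y : O x -> O y -> O (x + y).
Proof. exact: integral_add. Qed.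

Lemma ring_of_integersM x y : O x -> O y -> O (x * y).
Proof. exact: integral_mul. Qed.

Lemma ring_of_integers_int (m : int) : O m%:~R.
Proof. exact: integral_id. Qed.

Lemma ring_of_integers1 : O 1.
Proof. exact: (ring_of_integers_int 1). Qed.

Lemma ring_of_integers_nat (m : nat) : O m%:R.
Proof. exact: (ring_of_integers_int m%:Z). Qed.

Definition maximal_at (P : set K) : Prop :=
  forall a, O a -> ~ P a -> exists2 a', O a' & P (1 - a * a').

(** Maximal ideals are prime: if x has inverse x' modulo P, then y = x' (x y) + y (1 - x x'). An
    integer in P prime to q would put 1 into P by the Bezout identity. *)
Lemma prime_ideal_above (P : set K) (q : nat) : prime q -> P `<=` O -> P 0 ->
  (forall x y, P x -> P y -> P (x + y)) -> (forall a x, O a -> P x -> P (a * x)) ->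
  ~ P 1 -> P q%:R -> maximal_at P -> nonzero_prime_ideal P /\ lies_above P q.
Proof.
move=> pq PO P0 PD PM P1 Pq Pmax; split.
  split=> // [x y Ox Oy Pxy|]; last first.
    by exists q%:R => //; rewrite natrK_eq0 -lt0n prime_gt0.
  have [Px|nPx] := pselect (P x); [by left | right].
  have [x' Ox' Px'] := Pmax _ Ox nPx.
  have -> : y = x' * (x * y) + y * (1 - x * x') by ring.
  by apply: PD; apply: PM.
move=> m; split=> [Pm|/dvdzP[k ->]]; last first.
  by rewrite intrM; apply: PM => //; exact: ring_of_integers_int.
apply: contrapT => /negP qm; apply: P1; have [u /dvdzP[v uv]] := prime_inv_mod pq qm.
have -> : 1 = u%:~R * m%:~R + (- v)%:~R * q%:R :> K.
  by rewrite -intrM -[u * m](subrK 1) uv; ring.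
by apply: PD; apply: PM => //; exact: ring_of_integers_int.
Qed.

Lemma ideal_exp_scale (P : set K) c m x : (forall y, P y -> O (c * y)) ->
  ideal_exp P m x -> O (c ^+ m * x).
Proof.
move=> cP; elim: m x => [|m IH] x; first by rewrite expr0 mul1r.
rewrite /ideal_exp iterS -/(ideal_exp P m) => -[k [a [b [ab ->]]]].
rewrite mulr_sumr; elim/big_ind: _ => //.
- exact: (ring_of_integers_int 0).
- exact: ring_of_integersD.
move=> i _; rewrite exprS mulrACA; apply: ring_of_integersM.
  by apply: cP; case: (ab i).
by apply: IH; case: (ab i).
Qed.

Lemma ideal_exp_pow (P : set K) v m : P v -> ideal_exp P m (v ^+ m).
Proof.
move=> Pv; elim: m => [|m IH]; first by rewrite expr0; exact: ring_of_integers1.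
rewrite /ideal_exp iterS -/(ideal_exp P m).
by exists 1%N, (fun _ => v), (fun _ => v ^+ m); rewrite big_ord1 exprS.
Qed.

(* c generates the inverse of P locally at P. *)
Lemma has_val0_local (P : set K) c v x : nonzero_prime_ideal P -> maximal_at P ->
  (forall y, P y -> O (c * y)) -> P v -> ~ P (c * v) -> has_val P x 0 ->
  exists s, [/\ O s, ~ P s & O (s * x)].
Proof.
move=> [PO [P0 PD PM] P1 Pprime _] Pmax cP Pv ncv.
case=> a [b [m [m' [[Oa a0] [Ob b0] -> [[am _] [bm nbm]] e]]]].
have {e} mm : m' = m by move: e; lia.
subst m'; exists (c ^+ m * b); split.
- exact: (ideal_exp_scale cP bm).
(* If c^m b were in P, then b = (c^m b j') v^m + (1 - j j') b, with j' inverse to j = (c v)^m modulo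
   P, would lie in P times P^m. *)
- move=> Pcb; apply: nbm.
  pose j := (c * v) ^+ m.
  have Oj : O (c * v) by exact: cP.
  have nPj k : ~ P ((c * v) ^+ k).
    elim: k => [|k IH]; first by rewrite expr0.
    rewrite exprS => /Pprime[] //.
    by elim: k {IH} => [|k IH]; [exact: ring_of_integers1 | rewrite exprS; exact: ring_of_integersM].
  have Ojm : O j.
    rewrite /j; elim: (m) => [|k IH]; first exact: ring_of_integers1.
    by rewrite exprS; exact: ring_of_integersM.
  have [j' Oj' Pj'] := Pmax _ Ojm (nPj m).
  rewrite /ideal_exp iterS -/(ideal_exp P m).
  exists 2%N, (fun i => if i == ord0 then (c ^+ m * b) * j' else 1 - j * j'),
    (fun i => if i == ord0 then v ^+ m else b); split.
    move=> i; case: ifP => _; split=> //; last exact: ideal_exp_pow.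
    by rewrite mulrC; apply: PM.
  rewrite !big_ord_recl big_ord0 /= addr0 /j exprMn; ring.
- have -> : c ^+ m * b * (a / b) = c ^+ m * a by field.
  exact: (ideal_exp_scale cP am).
Qed.

End LocalPrimes.

(** * Primes that contain the denominators of an element *)

Section PrimesAbove.
Variables (K : fieldExtType rat) (t n : int) (w : K).
Hypothesis gen : quadratic_gen t n w.
Local Notation d := (t ^+ 2 - 4 * n).
Hypothesis fd : fundamental d.
Local Notation N := (qnorm t n).
Local Notation mul := (qmul t n).
Local Notation conj := (qconj t).
Local Notation f := (charpoly_at t n).
Local Notation qelt := (qelt w).
Local Notation O := (@ring_of_integers K).

Lemma ring_of_integers_qelt z : O (qelt z).
Proof. by apply/(ring_of_integersE gen fd); exists z. Qed.

Lemma ring_of_integersP x : O x -> exists z, x = qelt z.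
Proof. by move/(ring_of_integersE gen fd). Qed.

Variable q : nat.
Hypothesis pq : prime q.

Lemma natK_neq0 : q%:R != 0 :> K.
Proof. by rewrite natrK_eq0 -lt0n prime_gt0. Qed.

(* P is a prime above q that contains the denominator ideal of y, together
   with what [has_val0_local] needs. *)
Definition separating (P : set K) (y : K) : Prop :=
  [/\ nonzero_prime_ideal P, lies_above P q, maximal_at P,
    forall s, O s -> O (s * y) -> P s
  & exists c v, [/\ forall x, P x -> O (c * x), P v & ~ P (c * v)]].

Lemma qelt_div (z : int * int) (y : K) : q%:R * y = qelt z ->
  (q%:Z %| z.1)%Z -> (q%:Z %| z.2)%Z -> O y.
Proof.
move=> e /dvdzP[a ha] /dvdzP[b hb].
have -> : y = qelt (a, b).
  apply: (mulfI natK_neq0); rewrite e /qelt ha hb /=; ring.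
exact: ring_of_integers_qelt.
Qed.

(** Here q is inert and P = (q), with c = 1 / q. Elements outside P have norm prime to q, so their
    conjugates provide inverses. If s y is integral, then q divides N s or N z, hence s or z itself,
    and the latter would make y integral. *)
Lemma separating_inert (y : K) (z : int * int) : q%:R * y = qelt z -> ~ O y ->
  (forall r, ~~ (q%:Z %| f r)%Z) -> exists P, separating P y.
Proof.
move=> yz nOy nr; pose P : set K := [set x | exists z, [/\ x = qelt z, (q%:Z %| z.1)%Z & (q%:Z %| z.2)%Z]].
have inert x := qnorm_dvd_inert (x := x) pq nr.
have PO : P `<=` O by move=> x [u [-> _ _]]; exact: ring_of_integers_qelt.
have P1 : ~ P 1.
  case=> u [e h1 _]; have /negP[] := prime_not_dvd_one pq.
  by move: h1; rewrite -(qelt_inj gen (etrans (qelt_int w 1) e)).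
have Pq : P q%:R.
  by exists (q%:Z, 0); rewrite qelt_int /= dvdzz dvdz0.
have Pmax : maximal_at P.
  move=> a /ring_of_integersP[x ->] nPx.
  have qN : ~~ (q%:Z %| N x)%Z.
    by apply/negP=> /inert[h1 h2]; apply: nPx; exists x.
  have [u hu] := prime_inv_mod pq qN; exists (u%:~R * qelt (conj x)).
    by apply: ring_of_integersM; [exact: ring_of_integers_int | exact: ring_of_integers_qelt].
  exists (1 - u * N x, 0); rewrite dvdz0; split=> //.
    by rewrite qelt_int mulrCA (qelt_norm gen); ring.
  by rewrite -opprB rpredN.
have [] := prime_ideal_above pq PO _ _ _ P1 Pq Pmax.
- by exists (0, 0); rewrite qelt_int /= dvdz0.
- move=> _ _ [u [-> h1 h2]] [v [-> h3 h4]]; exists (u.1 + v.1, u.2 + v.2).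
  by rewrite qeltD /= !rpredD.
- move=> a _ /ring_of_integersP[x ->] [u [-> h1 h2]]; exists (mul x u).
  rewrite (qeltM gen) /=; split=> //.
    by apply: rpredB; exact: dvdz_mull.
  by apply: rpredD; [apply: rpredD; exact: dvdz_mull | exact: dvdz_mull].
move=> Pprime Pq'; exists P; split=> //.
  move=> _ /ring_of_integersP[x ->] /ring_of_integersP[u hu].
  have e : mul x z = mul (q%:Z, 0) u.
    apply: (qelt_inj gen); rewrite !(qeltM gen) -yz -hu qelt_int.
    by rewrite mulrCA.
  have : (q%:Z %| N x * N z)%Z.
    by rewrite -qnormM e qnormM /qnorm /=; apply: dvdz_mulr; apply/dvdzP; exists q%:Z; ring.
  rewrite prime_dvdzM // => /orP[] /inert[h1 h2]; first by exists x.
  by case: nOy; exact: qelt_div yz _ _.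
exists q%:R^-1, q%:R; split=> //.
  move=> x [u [-> h1 h2]]; apply: (qelt_div (z := u)) => //.
  by rewrite mulVKf // natK_neq0.
by rewrite mulVf // natK_neq0.
Qed.

(** P = (q, w - r) is the kernel of w |-> r modulo q, and c = (t - w - r) / q maps it into O because
    (w - r)(t - w - r) = f(r). *)
Lemma separating_root (y : K) (z : int * int) (r : int) : q%:R * y = qelt z -> ~ O y ->
  (q%:Z %| f r)%Z ->
  (forall x, (exists u, mul x z = (q%:Z * u.1, q%:Z * u.2)) -> (q%:Z %| x.1 + x.2 * r)%Z) ->
  exists P, separating P y.
Proof.
move=> yz nOy /dvdzP[g fr] hz.
pose P : set K := [set x | exists2 z, x = qelt z & (q%:Z %| z.1 + z.2 * r)%Z].
have PE u : P (qelt u) <-> (q%:Z %| u.1 + u.2 * r)%Z.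
  by split=> [[v /(qelt_inj gen) ->]|h] //; exists u.
have PO : P `<=` O by move=> x [u -> _]; exact: ring_of_integers_qelt.
have P1 : ~ P 1.
  rewrite -[1](qelt_int w 1) PE /= mul0r addr0; apply/negP; exact: prime_not_dvd_one.
have Pq : P q%:R.
  by rewrite -[q%:R](qelt_int w q) PE /= mul0r addr0 dvdzz.
have Pmax : maximal_at P.
  move=> a /ring_of_integersP[x ->]; rewrite PE => /negP nPx.
  have [u hu] := prime_inv_mod pq nPx; exists u%:~R.
    exact: ring_of_integers_int.
  exists (1 - u * x.1, - u * x.2); first by rewrite /qelt /=; ring.
  rewrite /= (_ : _ + _ = - (u * (x.1 + x.2 * r) - 1)); last by ring.
  by rewrite rpredN.
have [] := prime_ideal_above pq PO _ _ _ P1 Pq Pmax.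
- by rewrite -[0](qelt_int w 0) PE /= mul0r addr0 dvdz0.
- move=> _ _ [u -> h1] [v -> h2]; exists (u.1 + v.1, u.2 + v.2).
    by rewrite qeltD.
  by rewrite /= mulrDl addrACA rpredD.
- move=> a _ /ring_of_integersP[x ->] [u -> h1]; exists (mul x u).
    by rewrite (qeltM gen).
  have -> : (mul x u).1 + (mul x u).2 * r =
    (x.1 + x.2 * r) * (u.1 + u.2 * r) - (x.2 * u.2 * g) * q%:Z.
    by rewrite -mulrA -fr /qmul /charpoly_at /=; ring.
  by apply: rpredB; exact: dvdz_mull.
move=> Pprime Pq'; exists P; split=> //.
  move=> _ /ring_of_integersP[x ->] /ring_of_integersP[u hu].
  apply/PE/hz; exists u; apply: (qelt_inj gen); rewrite (qeltM gen) -yz mulrCA hu.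
  by rewrite /qelt /=; ring.
pose c := q%:R^-1 * qelt (t - r, -1).
have cP x : P x -> O (c * x).
  case=> u -> /dvdzP[k hk]; apply: (qelt_div (z := (q%:Z * (k * (t - r) + u.2 * g), q%:Z * - k))).
  - rewrite /c mulrA mulVKf ?natK_neq0 // -(qeltM gen); congr (qelt _).
    have u1 : u.1 = k * q%:Z - u.2 * r by rewrite -hk; ring.
    rewrite /qmul /= u1; congr pair; last by ring.
    transitivity (q%:Z * (k * (t - r)) + u.2 * f r); first by rewrite /charpoly_at; ring.
    by rewrite fr; ring.
  - exact: dvdz_mulr.
  - exact: dvdz_mulr.
(* At a simple root take v = q: c v = t - w - r has the value t - 2 r. At a double root take v = w -
   r: c v = f(r) / q, and q^2 does not divide f(r). *)
have [h|h] := boolP (q%:Z %| 2 * r - t)%Z; last first.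
  exists c, q%:R; split=> //; rewrite /c mulrAC mulVf ?natK_neq0 // mul1r PE /=.
  move=> h'; case/negP: h; move: h'; rewrite (_ : _ + _ = - (2 * r - t)); last by ring.
  by rewrite rpredN.
exists c, (qelt (- r, 1)); split=> //.
  by rewrite PE /= mul1r addNr dvdz0.
have -> : c * qelt (- r, 1) = qelt (g, 0).
  rewrite /c -mulrA -(qeltM gen).
  have -> : mul (t - r, -1) (- r, 1) = (f r, 0).
    by rewrite /qmul /charpoly_at /=; congr pair; ring.
  by rewrite fr !qelt_int intrM mulrC mulfK //; exact: natK_neq0.
rewrite PE /= mul0r addr0 => /dvdzP[k gk].
have /negP[] := fundamental_root fd pq h.
by rewrite fr gk; apply/dvdzP; exists k; rewrite PoszM; ring.
Qed.

(** Put z = q y. If q does not divide N z, then z is invertible modulo q and any root serves.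
    Otherwise w |-> s kills z for some root s, and the denominators of y lie in the conjugate prime,
    that of the root t - s. *)
Lemma exists_separating (y : K) : ~ O y -> O (q%:R * y) -> exists P, separating P y.
Proof.
move=> nOy /ring_of_integersP[z yz].
have [[r0 hr0]|nr] := pselect (exists r, (q%:Z %| f r)%Z); last first.
  by apply: (separating_inert yz nOy) => r; apply/negP=> h; apply: nr; exists r.
have [h|h] := boolP (q%:Z %| N z)%Z; last first.
  apply: (separating_root yz nOy hr0) => x [u e].
  have e2 : mul (mul x z) (conj z) = (N z * x.1, N z * x.2).
    by rewrite /qmul /qnorm /qconj /=; congr pair; ring.
  have := e2; rewrite e => -[e3 e4].
  have d1 : (q%:Z %| N z * x.1)%Z.
    rewrite -e3; apply/dvdzP; exists (u.1 * (z.1 + t * z.2) + n * u.2 * z.2).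
    by rewrite /=; ring.
  have d2 : (q%:Z %| N z * x.2)%Z.
    rewrite -e4; apply/dvdzP.
    by exists (- u.1 * z.2 + u.2 * (z.1 + t * z.2) - t * u.2 * z.2); rewrite /=; ring.
  move: d1 d2; rewrite !prime_dvdzM // (negbTE h) /= => d1 d2.
  by apply: rpredD => //; exact: dvdz_mulr.
have h2 : ~~ (q%:Z %| z.2)%Z.
  apply/negP=> h2; apply: nOy; apply: qelt_div yz _ _ => //.
  exact: qnorm_dvd_fst h h2.
have h1 : ((q ^ 1)%N%:Z %| N z)%Z by rewrite expn1.
have [s] := qnorm_root pq h2 h1; rewrite expn1 => -[hs1 hs2]; apply: (separating_root (r := t - s) yz nOy).
  by rewrite charpoly_sum.
move=> x [u [_ e2]]; have : (q%:Z %| z.2 * (x.1 + x.2 * (t - s)))%Z.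
  have -> : z.2 * (x.1 + x.2 * (t - s)) = q%:Z * u.2 - x.2 * (z.1 + s * z.2).
    by rewrite -e2; ring.
  by apply: rpredB; [exact: dvdz_mulr | exact: dvdz_mull].
by rewrite prime_dvdzM // (negbTE h2).
Qed.

End PrimesAbove.

(** * S-units described by denominators *)

Definition supported_in (S : {fset nat}) : nat_pred := [pred p | p \in S].

Definition S_integral (S : {fset nat}) (K : fieldExtType rat) (x : K) : Prop :=
  exists2 m, (supported_in S).-nat m & ring_of_integers (m%:R * x).

Lemma S_integralM S (K : fieldExtType rat) (x y : K) :
  S_integral S x -> S_integral S y -> S_integral S (x * y).
Proof.
move=> [m Sm Om] [k Sk Ok]; exists (m * k)%N; first by rewrite pnatM Sm.
by rewrite natrM mulrACA; exact: ring_of_integersM.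
Qed.

Lemma S_integral_int S (K : fieldExtType rat) (m : int) : S_integral S (m%:~R : K).
Proof. by exists 1%N => //; rewrite mul1r; exact: ring_of_integers_int. Qed.

Section SUnits.
Variables (K : fieldExtType rat) (t n : int) (w : K).
Hypothesis gen : quadratic_gen t n w.
Local Notation d := (t ^+ 2 - 4 * n).
Hypothesis fd : fundamental d.
Local Notation N := (qnorm t n).
Local Notation O := (@ring_of_integers K).
Variable S : {fset nat}.
Hypothesis S_prime : forall p, p \in S -> prime p.
Local Notation U := (@S_units K S).

Lemma denominator (x : K) : exists m : nat, (0 < m)%N /\ O (m%:R * x).
Proof.
have [_ span _] := gen; have [a [b ->]] := span x.
exists (`|denq a| * `|denq b|)%N; split; first by rewrite muln_gt0 !absz_gt0 !denq_neq0.
have E c : (`|denq c|%N)%:R * ratK K c = (numq c)%:~R.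
  rewrite -(rmorph_nat (ratK K)) -rmorphM natr_absz gtr0_norm ?denq_gt0 //.
  by rewrite mulrC -numqE rmorph_int.
have -> : (`|denq a| * `|denq b|)%:R * (ratK K a + ratK K b * w) =
  (`|denq b|%N)%:R * ((`|denq a|%N)%:R * ratK K a) +
  (`|denq a|%N)%:R * ((`|denq b|%N)%:R * ratK K b) * w by ring.
rewrite !E; apply: ring_of_integersD; apply: ring_of_integersM.
- exact: ring_of_integers_nat.
- exact: ring_of_integers_int.
- by apply: ring_of_integersM; [exact: ring_of_integers_nat | exact: ring_of_integers_int].
have -> : w = qelt w (0, 1) by rewrite /qelt /=; ring.
exact: (ring_of_integers_qelt gen fd).
Qed.

Lemma has_val0_inv (P : set K) x : has_val P x 0 -> has_val P x^-1 0.
Proof.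
case=> a [b [m [k [Oa Ob -> [va vb] e]]]]; exists b, a, k, m; split=> //.
- by rewrite invf_div.
- by move: e; lia.
Qed.

(** Let m be the least denominator of x and q a prime factor of m outside S. Then y = (m / q) x is
    not integral but q y is, so some P above q contains all denominators of y; yet valuation 0 at P
    yields a denominator outside P. *)
Lemma S_units_integral (x : K) : (forall P, nonzero_prime_ideal P -> ~ primes_above S P ->
  has_val P x 0) -> S_integral S x.
Proof.
move=> hx; have exm : exists m, (0 < m)%N && `[< O (m%:R * x) >].
  by have [m [m0 hm]] := denominator x; exists m; rewrite m0; apply/asboolP.
case: (ex_minnP exm) => m /andP[m0 /asboolP Om] mmin; exists m => //.
apply/(pnatP _ m0) => q pq /dvdnP[m' mm']; rewrite inE /=; apply: contraT => nqS.
pose y := m'%:R * x.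
have Oqy : O (q%:R * y) by rewrite /y mulrA -natrM mulnC -mm'.
have nOy : ~ O y.
  move=> Oy; have := mmin m'; have m'0 : (0 < m')%N.
    by move: m0; rewrite mm' muln_gt0 => /andP[].
  move=> /(_ ltac:(rewrite m'0; exact/asboolP)).
  by rewrite mm' leqNgt -[X in (X < _)%N]muln1 ltn_pmul2l // prime_gt1.
have [P [Pprime Pq Pmax PJ [c [v [cP Pv ncv]]]]] := exists_separating gen fd pq nOy Oqy.
have nabove : ~ primes_above S P.
  case=> _ [p pS Pp]; have : P p%:Z%:~R by apply/Pp; rewrite dvdzz.
  move/Pq; have pp := S_prime pS; rewrite dvdzE /= dvdn_prime2 // => /eqP qp.
  by move: nqS; rewrite qp pS.
have [s [Os nPs Osx]] := has_val0_local Pprime Pmax cP Pv ncv (hx P Pprime nabove).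
case: nPs; apply: PJ => //; rewrite /y mulrCA.
by apply: ring_of_integersM => //; exact: ring_of_integers_nat.
Qed.

Lemma ideal_val0 (P : set K) a : nonzero_prime_ideal P -> O a -> ~ P a -> ideal_val P a 0.
Proof.
move=> [PO [P0 PD PM] _ _ _] Oa nPa; split=> // -[m [a' [b [ab e]]]].
apply: nPa; rewrite e; elim/big_ind: _ => // i _; rewrite mulrC.
by have [Pa Ob] := ab i; exact: PM.
Qed.

Lemma S_unitsE (x : K) : U x <-> [/\ x != 0, S_integral S x & S_integral S x^-1].
Proof.
split=> [[x0 hx]|[x0 [m Sm Om] [k Sk Ok]]].
  split=> //; first exact: S_units_integral.
  by apply: S_units_integral => P h1 h2; apply: has_val0_inv; exact: hx.
split=> // P Pprime nabove; have [PO [P0 PD PM] P1 PP _] := Pprime.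
(* By primality, P would contain a prime factor of j, which is in S, and so lie above it. Hence m
   and m x are both outside P and have valuation 0. *)
have nP j : (supported_in S).-nat j -> ~ P j%:R.
  move=> Sj Pj; have [q [qj pq Pq]] : exists q, [/\ (q %| j)%N, prime q & P q%:R].
    have {Sj} j0 : (0 < j)%N by case/andP: Sj.
    elim/ltn_ind: j j0 Pj => j IH j0 Pj.
    have [j1|j1] := eqVneq j 1%N; first by move: Pj; rewrite j1.
    have pj : prime (pdiv j) by rewrite pdiv_prime // ltn_neqAle eq_sym j1.
    have /dvdnP[l jl] := pdiv_dvd j.
    move: Pj; rewrite {1}jl natrM => /PP[]; try exact: ring_of_integers_nat.
      have l0 : (0 < l)%N by move: j0; rewrite jl muln_gt0 => /andP[].
      move/IH => /(_ ltac:(by rewrite [X in (_ < X)%N]jl -[X in (X < _)%N]muln1 ltn_pmul2l // prime_gt1) l0).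
      by case=> q [ql pq Pq]; exists q; split=> //; rewrite jl dvdn_mulr.
    by exists (pdiv j); rewrite pdiv_dvd.
  apply: nabove; split=> //; exists q.
    by have := pnat_dvd qj Sj; rewrite pnatE.
  move=> i; split=> [Pi|/dvdzP[i' ->]]; last first.
    by rewrite intrM; apply: PM => //; exact: ring_of_integers_int.
  apply: contrapT => /negP qi; apply: P1; have [u /dvdzP[v uv]] := prime_inv_mod pq qi.
  have -> : 1 = u%:~R * i%:~R + (- v)%:~R * q%:R :> K.
    by rewrite -intrM -[u * i](subrK 1) uv; ring.
  by apply: PD; apply: PM => //; exact: ring_of_integers_int.
have m0 : m%:R != 0 :> K by rewrite natrK_eq0 -lt0n; case/andP: Sm.
exists (m%:R * x), m%:R, 0%N, 0%N; split=> //.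
- by split=> //; rewrite mulf_neq0.
- by split=> //; exact: ring_of_integers_nat.
- by field.
split; apply: ideal_val0 => //; [| exact: ring_of_integers_nat | exact: nP].
move=> Pmx; apply: (nP (m * k)%N); first by rewrite pnatM Sm.
have -> : (m * k)%:R = (k%:R * x^-1) * (m%:R * x) by rewrite natrM; field.
exact: PM.
Qed.

End SUnits.

(** * Groups modulo cubes *)

Section CubeRepresentatives.
Variable K : fieldExtType rat.
Implicit Types (A B : set K) (s : seq K).

Definition mul_subgroup A : Prop :=
  [/\ A 1, forall x y, A x -> A y -> A (x * y), forall x, A x -> A x^-1
    & forall x, A x -> x != 0].

(** A list of representatives of A / A^3, each class occurring once. *)
Definition cube_reps A s : Prop :=
  [/\ uniq s, forall x, x \in s -> A x,
    forall x, A x -> exists y z, [/\ y \in s, A z & x = y * z ^+ 3]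
  & forall x y z, x \in s -> y \in s -> A z -> x = y * z ^+ 3 -> x = y].

Lemma mul_subgroup_exp A x (m : nat) : mul_subgroup A -> A x -> A (x ^+ m).
Proof.
move=> [A1 AM _ _] Ax; elim: m => [|m IH]; first by rewrite expr0.
by rewrite exprS; exact: AM.
Qed.

Lemma mul_subgroup_expz A x (m : int) : mul_subgroup A -> A x -> A (x ^ m).
Proof.
move=> gA Ax; case: m => m; first exact: mul_subgroup_exp.
by rewrite NegzE -exprz_inv; apply: mul_subgroup_exp => //; case: gA => _ _ AV _; exact: AV.
Qed.

Lemma card_quotient_cube_reps A s : mul_subgroup A -> cube_reps A s ->
  card_quotient_by_cubes A = size s.
Proof.
move=> gA [us sA cov inj]; have [A1 AM AV A0] := gA.
pose f (x : K) : set K := [set x * y ^+ 3 | y in A].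
have -> : size s = #|` [fset x in s]%fset|%fset.
  by rewrite card_fseq undup_id.
rewrite /card_quotient_by_cubes.
have -> : quotient_by_cubes A = [set` [fset f x | x in [fset x in s]]%fset].
  apply/seteqP; split=> [_ [x Ax <-]|y] /=.
    have [y [z [ys Az ->]]] := cov x Ax.
    apply/imfsetP; exists y; first by rewrite inE.
    apply/seteqP; split=> _ [u Au <-].
      by exists (z * u); [exact: AM | ring].
    exists (u / z); first by apply: (AM) => //; exact: AV.
    by rewrite -mulrA -exprMn [z * _]mulrC divfK // A0.
  case/imfsetP => x; rewrite inE /= => xs ->.
  by exists x => //; exact: sA.
rewrite set_fsetK card_in_imfset // => x y; rewrite !inE /= => xs ys fxy.
have : f x x by exists 1 => //; rewrite expr1n mulr1.
by rewrite fxy => -[z Az /esym]; exact: inj.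
Qed.

(** A is the direct product of B and the infinite cyclic group generated by a, so A / A^3 is B / B^3
    times Z / 3. *)
Lemma cube_reps_step A B a s : mul_subgroup A -> mul_subgroup B ->
  B `<=` A -> A a -> (forall x, A x -> exists k : int, B (x * a ^ (- k))) ->
  (forall k : int, B (a ^ k) -> k = 0) -> cube_reps B s ->
  cube_reps A [seq a ^+ i * y | i <- iota 0 3, y <- s].
Proof.
move=> gA gB BA Aa Adec Aind [us sB cov inj].
have [A1 AM AV A0] := gA; have [B1 BM BV B0] := gB; have a0 := A0 _ Aa.
have sA x : x \in s -> A x by move=> xs; apply: (BA); exact: sB.
(* With z = z' a^k, the power a^(i - j - 3 k) lies in B, so its exponent is 0; as i, j < 3, this
   gives i = j and k = 0. *)
have dec (i j : nat) y y' z : (i < 3)%N -> (j < 3)%N -> y \in s -> y' \in s -> A z ->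
    a ^+ i * y = a ^+ j * y' * z ^+ 3 -> i = j /\ y = y'.
  move=> i3 j3 ys ys' Az e; have [k Bk] := Adec z Az; set z' := z * _ in Bk.
  have zE : z = z' * a ^ k by rewrite /z' -mulrA -expfzDr // addNr expr0z mulr1.
  have y0 := B0 _ (sB _ ys).
  have h : a ^ (i%:Z - (j%:Z + 3 * k)) = y' * z' ^+ 3 / y.
    rewrite expfzDr // -invr_expz; apply: (canLR (mulfK (expfz_neq0 _ a0))).
    rewrite expfzDr // [3 * k]mulrC -exprz_exp -!exprnP; apply: (mulIf y0).
    by rewrite e zE exprMn; field.
  have {h} : i%:Z - (j%:Z + 3 * k) = 0.
    apply: Aind; rewrite h; apply: (BM); last by apply: (BV); exact: sB.
    by apply: (BM); [exact: sB | exact: mul_subgroup_exp].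
  move=> ijk; have {ijk} [ij k0] : i = j /\ k = 0 by lia.
  split=> //; apply: (inj y y' z') => //.
  apply: (mulfI (expf_neq0 i a0)); rewrite e ij zE k0 expr0z mulr1; ring.
split.
- apply: allpairs_uniq; rewrite ?iota_uniq //.
  move=> [i y] [j y'] h h'.
  have /allpairsP[[i1 y1] /= [i1i y1s [-> ->]]] := h.
  have /allpairsP[[j1 y2] /= [j1i y2s [-> ->]]] := h'.
  rewrite /= => e.
  have i3 : (i1 < 3)%N by move: i1i; rewrite !inE; lia.
  have j3 : (j1 < 3)%N by move: j1i; rewrite !inE; lia.
  by have [|-> ->] := @dec i1 j1 y1 y2 1 i3 j3 y1s y2s A1; rewrite ?expr1n ?mulr1.
- move=> _ /allpairsP[[i y] /= [_ ys ->]]; apply: (AM); last exact: sA.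
  exact: mul_subgroup_exp.
- move=> x Ax; have [k Bk] := Adec x Ax.
  have [y [z [ys Bz e]]] := cov _ Bk.
  exists (a ^+ `|(k %% 3)%Z| * y), (z * a ^ (k %/ 3)%Z); split.
  + apply/allpairsP; exists (`|(k %% 3)%Z|%N, y); split=> //=.
    by rewrite !inE; lia.
  + by apply: (AM); [exact: BA | exact: mul_subgroup_expz].
  have -> : x = (x * a ^ (- k)) * a ^ k by rewrite -mulrA -expfzDr // addNr expr0z mulr1.
  rewrite e; have -> : a ^ k = a ^ ((k %/ 3)%Z * 3) * a ^ (k %% 3)%Z.
    by rewrite -expfzDr // -divz_eq.
  have -> : (k %% 3)%Z = `|(k %% 3)%Z|%N%:Z by lia.
  by rewrite -exprz_exp -!exprnP exprMn absz_nat; ring.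
- move=> x x' z h h' Az.
  have /allpairsP[[i y] /= [ii ys ->]] := h.
  have /allpairsP[[j y'] /= [jj ys' ->]] := h'.
  move=> e.
  have i3 : (i < 3)%N by move: ii; rewrite !inE; lia.
  have j3 : (j < 3)%N by move: jj; rewrite !inE; lia.
  by have [-> ->] := @dec i j y y' z i3 j3 ys ys' Az e.
Qed.

(* A = ker H x a^Z, where H a generates the image of H. *)
Lemma cube_reps_hom A (H : K -> int) g s : mul_subgroup A ->
  (forall x y, x != 0 -> y != 0 -> H (x * y) = H x + H y) -> A g -> H g != 0 ->
  cube_reps [set x | A x /\ H x = 0] s ->
  exists2 s', cube_reps A s' & size s' = (3 * size s)%N.
Proof.
move=> gA HM Ag Hg reps; have [A1 AM AV A0] := gA.
pose P (k : nat) := (0 < k)%N && `[< exists2 a, A a & `|H a|%N = k >].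
have exP : exists k, P k.
  by exists `|H g|%N; rewrite /P absz_gt0 Hg; apply/asboolP; exists g.
case: (ex_minnP exP) => k /andP[k0 /asboolP[a Aa Hak]] kmin.
have a0 := A0 _ Aa.
have H1 : H 1 = 0 by apply: (addrI (H 1)); rewrite -HM ?oner_neq0 // mulr1 addr0.
have HV x : x != 0 -> H x^-1 = - H x.
  by move=> x0; apply/eqP; rewrite -addr_eq0 -HM ?invr_eq0 // mulVf // H1.
have HX x (m : nat) : x != 0 -> H (x ^+ m) = m%:Z * H x.
  move=> x0; elim: m => [|m IH]; first by rewrite expr0 H1 mul0r.
  by rewrite exprS HM ?expf_neq0 // IH; lia.
have HZ x (m : int) : x != 0 -> H (x ^ m) = m * H x.
  move=> x0; case: m => m; first exact: HX.
  by rewrite NegzE -exprz_inv HX ?invr_eq0 // HV //; lia.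
exists [seq a ^+ i * y | i <- iota 0 3, y <- s]; last first.
  by rewrite size_allpairs size_iota.
apply: cube_reps_step reps => //.
- split=> //=.
  + move=> x y [Ax Hx] [Ay Hy]; split; first exact: AM.
    by rewrite HM ?A0 // Hx Hy.
  + by move=> x [Ax Hx]; split; [exact: AV | rewrite HV ?A0 // Hx oppr0].
  + by move=> x [Ax _]; exact: A0.
- by move=> x [].
- move=> x Ax; exists (H x %/ H a)%Z.
  have Axa : A (x * a ^ (- (H x %/ H a)%Z)) by apply: (AM) => //; exact: mul_subgroup_expz.
  split=> //.
  have Ha0 : H a != 0 by rewrite -absz_gt0 Hak.
  have e : H (x * a ^ (- (H x %/ H a)%Z)) = (H x %% H a)%Z.
    rewrite HM; [|exact: A0|exact: expfz_neq0].
    by rewrite HZ // /modz mulNr.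
  have := modz_ge0 (H x) Ha0; have := ltz_mod (H x) Ha0; rewrite -e => h1 h2.
  move: Axa h1 h2 {e}; set y := x * _ => Ay h1 h2; apply/eqP/negPn/negP => h3.
  have : P `|H y|%N by rewrite /P absz_gt0 h3; apply/asboolP; exists y.
  by move/kmin; rewrite -Hak; lia.
- move=> m [_]; rewrite HZ // => /eqP; rewrite mulf_eq0 -absz_eq0 => /orP[/eqP|]; first by lia.
  by rewrite -absz_eq0 Hak; move: k0; case: (k).
Qed.

(* A / B is killed by m, hence invisible modulo cubes. *)
Lemma cube_reps_pow A B (m : nat) s : mul_subgroup A -> mul_subgroup B -> B `<=` A ->
  coprime m 3 -> (forall x, A x -> B (x ^+ m)) -> cube_reps B s -> cube_reps A s.
Proof.
move=> gA gB BA cm AB [us sB cov inj].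
have [A1 AM AV A0] := gA; have [B1 BM BV B0] := gB.
have /coprimezP[[u v] /= uv] : coprimez m%:Z 3 by rewrite coprimezE.
have dec x : A x -> x = (x ^+ m) ^ u * (x ^+ 3) ^ v.
  move=> Ax; have x0 := A0 _ Ax; rewrite !exprnP !exprz_exp -expfzDr //.
  have -> : m%:Z * u + 3%:Z * v = 1 by apply: etrans uv; ring.
  by rewrite expr1z.
split=> //.
- by move=> x /sB; exact: BA.
- move=> x Ax; have Bx := mul_subgroup_expz u gB (AB _ Ax).
  have [y [z [ys Bz e]]] := cov _ Bx; exists y, (z * x ^ v); split=> //.
    by apply: (AM); [exact: BA | exact: mul_subgroup_expz].
  have h : x ^+ 3 ^ v = (x ^ v) ^+ 3 := exprzAC x 3%N%:Z v.
  by rewrite [LHS]dec // e exprMn h; ring.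
- move=> x y z xs ys Az e; apply: (inj x y z) => //.
  rewrite [z]dec //; apply: (BM); apply: mul_subgroup_expz => //; first exact: AB.
  have y0 := B0 _ (sB _ ys).
  have -> : z ^+ 3 = x / y by rewrite e mulrC mulKf.
  by apply: (BM); [exact: sB | apply: (BV); exact: sB].
Qed.

(** The representative r x is chosen in the class of x as a set, so it depends on the class alone.
    The bound serves the units for d = -3. *)
Lemma cube_reps_finite A s : mul_subgroup A -> (forall x, A x -> x \in s) ->
  exists2 s', cube_reps A s' & (size s' <= size s)%N.
Proof.
move=> gA sA; have [A1 AM AV A0] := gA.
pose E (x : K) : set K := [set y | exists2 z, A z & y = x * z ^+ 3].
have EE x z : A z -> E (x * z ^+ 3) = E x.
  move=> Az; apply/seteqP; split=> _ [u Au ->].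
    by exists (z * u); [exact: AM | ring].
  exists (u / z); first by apply: (AM) => //; exact: AV.
  by rewrite -mulrA -exprMn [z * _]mulrC divfK // A0.
pose r x := xget 0 (E x).
have rE x : exists2 z, A z & r x = x * z ^+ 3.
  have : E x (r x) by apply: (xgetPex 0); exists x; exists 1 => //; rewrite expr1n mulr1.
  by [].
have rr x z : A z -> r (x * z ^+ 3) = r x by move=> Az; rewrite /r EE.
exists (undup [seq r x | x <- s & `[< A x >]]); last first.
  by rewrite (leq_trans (size_undup _)) // size_map size_filter count_size.
split.
- exact: undup_uniq.
- move=> y; rewrite mem_undup => /mapP[x]; rewrite mem_filter => /andP[/asboolP Ax _] ->.
  by have [z Az ->] := rE x; apply: (AM) => //; exact: mul_subgroup_exp.
- move=> x Ax; have [z Az e] := rE x; exists (r x), z^-1; split; last 2 first.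
  + exact: AV.
  + by rewrite e -mulrA -exprMn mulfV ?expr1n ?mulr1 // A0.
  by rewrite mem_undup; apply: map_f; rewrite mem_filter sA // andbT; apply/asboolP.
- move=> x y z; rewrite !mem_undup => /mapP[x' _ ->] /mapP[y' _ ->] Az e.
  have idem v : r (r v) = r v by have [u Au e'] := rE v; rewrite {1}e' rr.
  by rewrite -(idem x') e rr // idem.
Qed.

(** Each index splits off a factor Z by [cube_reps_hom] and passes to the kernel. The triangular
    condition keeps the later test elements g j in the kernels of the earlier H i. *)
Lemma cube_reps_chain (I : eqType) (idx : seq I) (H : I -> K -> int) (g : I -> K) A s :
  mul_subgroup A ->
  (forall i x y, i \in idx -> x != 0 -> y != 0 -> H i (x * y) = H i x + H i y) ->
  (forall i, i \in idx -> A (g i) /\ H i (g i) != 0) ->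
  pairwise (fun i j => H i (g j) == 0) idx ->
  cube_reps [set x | A x /\ forall i, i \in idx -> H i x = 0] s ->
  exists2 s', cube_reps A s' & size s' = (3 ^ size idx * size s)%N.
Proof.
elim: idx A s => [|i idx IH] A s gA HM Hg pw reps.
  exists s; last by rewrite expn0 mul1n.
  suff -> : A = [set x | A x /\ forall i, i \in [::] -> H i x = 0] by [].
  by apply/seteqP; split=> [x Ax|x []].
move: pw => /= /andP[/allP pw1 pw2]; have [A1 AM AV A0] := gA.
have HMi x y : x != 0 -> y != 0 -> H i (x * y) = H i x + H i y.
  by apply: HM; rewrite mem_head.
have [Agi Hgi] := Hg i (mem_head _ _).
have H1 : H i 1 = 0 by apply: (addrI (H i 1)); rewrite -HMi ?oner_neq0 // mulr1 addr0.
have HV x : x != 0 -> H i x^-1 = - H i x.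
  by move=> x0; apply/eqP; rewrite -addr_eq0 -HMi ?invr_eq0 // mulVf // H1.
have [|||||s' reps' ss'] := IH [set x | A x /\ H i x = 0] s.
- split=> //=.
  + move=> x y [Ax Hx] [Ay Hy]; split; first exact: AM.
    by rewrite HMi ?A0 // Hx Hy.
  + by move=> x [Ax Hx]; split; [exact: AV | rewrite HV ?A0 // Hx oppr0].
  + by move=> x [Ax _]; exact: A0.
- by move=> j x y jI; apply: HM; rewrite inE jI orbT.
- move=> j jI; have [Agj Hgj] := Hg j ltac:(by rewrite inE jI orbT).
  by split=> //; split=> //; apply/eqP/pw1.
- exact: pw2.
- move: reps; congr (cube_reps _ _); apply/seteqP; split=> x /=.
    move=> [Ax hx]; split; first by split=> //; apply: hx; rewrite mem_head.
    by move=> j jI; apply: hx; rewrite inE jI orbT.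
  move=> [[Ax hx] hx']; split=> // j; rewrite inE => /orP[/eqP->//|]; exact: hx'.
have [s'' reps'' ss''] := cube_reps_hom gA HMi Agi Hgi reps'.
by exists s'' => //; rewrite ss'' ss' expnS mulnA.
Qed.

End CubeRepresentatives.

(** * Characters on S-units *)

Section UnitRank.
Variables (K : fieldExtType rat) (t n : int) (w : K).
Hypothesis gen : quadratic_gen t n w.
Local Notation d := (t ^+ 2 - 4 * n).
Hypothesis fd : fundamental d.
Hypothesis d1 : d != 1.
Local Notation N := (qnorm t n).
Local Notation mul := (qmul t n).
Local Notation conj := (qconj t).
Local Notation O := (@ring_of_integers K).
Local Notation qelt := (qelt w).

Definition is_hom (H : K -> int) : Prop :=
  forall x y, x != 0 -> y != 0 -> H (x * y) = H x + H y.

(** Every x is z / m with z integral and m a positive integer, and H x = h z - h m. Cross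
    multiplication shows independence of the denominator. *)
Lemma hom_extension (h : int * int -> int) :
  (forall x y, x != (0, 0) -> y != (0, 0) -> h (mul x y) = h x + h y) ->
  exists H, is_hom H /\ forall z, z != (0, 0) -> H (qelt z) = h z.
Proof.
move=> hM.
have /choice[m hm] x : exists m : nat, (0 < m)%N /\ O (m%:R * x) := denominator gen fd x.
have /choice[z hz] x : exists z, (m x)%:R * x = qelt z.
  exact: (ring_of_integersP gen fd (hm x).2).
have mne k : (0 < k)%N -> (k%:Z, 0) != (0, 0) :> (int * int)%type.
  by rewrite xpair_eqE eqxx andbT; lia.
have mK k : (0 < k)%N -> k%:R != 0 :> K by rewrite natrK_eq0 -lt0n.
have qne (k : nat) u x : (0 < k)%N -> x != 0 -> k%:R * x = qelt u -> u != (0, 0).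
  by move=> k0 x0 e; rewrite -(qelt_eq0 gen) -e mulf_neq0 // mK.
pose H x := h (z x) - h ((m x)%:Z, 0).
have wd x (k : nat) u : x != 0 -> (0 < k)%N -> k%:R * x = qelt u -> H x = h u - h (k%:Z, 0).
  move=> x0 k0 e; have u0 := qne _ _ _ k0 x0 e.
  have mx0 := (hm x).1; have z0 := qne _ _ _ mx0 x0 (hz x).
  have : mul ((m x)%:Z, 0) u = mul (k%:Z, 0) (z x).
    by apply: (qelt_inj gen); rewrite !(qeltM gen) !qelt_int -e -hz mulrCA.
  move/(congr1 h); rewrite !hM ?mne // /H; lia.
exists H; split=> [x y x0 y0|u u0].
  have k0 : (0 < m x * m y)%N by rewrite muln_gt0 !(hm _).1.
  rewrite (wd (x * y) (m x * m y)%N (mul (z x) (z y))) ?mulf_neq0 //; last first.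
    by rewrite natrM mulrACA !hz -(qeltM gen).
  have -> : ((m x * m y)%N%:Z, 0) = mul ((m x)%:Z, 0) ((m y)%:Z, 0).
    by rewrite /qmul /=; congr pair; rewrite ?PoszM; ring.
  rewrite !hM ?mne ?(hm _).1 //; first by rewrite /H; ring.
    exact: qne (hm x).1 x0 (hz x).
  exact: qne (hm y).1 y0 (hz y).
rewrite (wd (qelt u) 1%N u) ?mul1r // ?(qelt_eq0 gen) //.
have := hM (1%N%:Z, 0) (1%N%:Z, 0) isT isT.
have -> : mul (1%N%:Z, 0) (1%N%:Z, 0) = (1%N%:Z, 0) by rewrite /qmul /=; congr pair; ring.
by move: (h _) (h _); lia.
Qed.

Lemma psi_exists (p : nat) : prime p -> exists H, is_hom H /\
  forall z, z != (0, 0) -> H (qelt z) = (logn p `|N z|)%:Z.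
Proof.
move=> pp; apply: hom_extension => x y x0 y0.
by rewrite qnormM abszM lognM ?absz_gt0 ?(qnorm_eq0 fd d1) // PoszD.
Qed.

(* The character v_P - v_P', through the properties that are used, and an
   element g on which it does not vanish. *)
Definition chi_spec (p : nat) (Hg : (K -> int) * K) : Prop :=
  [/\ is_hom Hg.1, forall m : int, m != 0 -> Hg.1 m%:~R = 0,
    forall z, z != (0, 0) -> logn p `|N z| = 0%N -> Hg.1 (qelt z) = 0,
    forall z, z != (0, 0) -> (1 < logn p `|N z|)%N -> Hg.1 (qelt z) = 0 ->
      (p%:Z %| z.1)%Z /\ (p%:Z %| z.2)%Z
  & Hg.1 Hg.2 != 0 /\ exists z j, Hg.2 = qelt z /\ N z = (p ^ j)%N%:Z].

(** v_P is [qval] at a Hensel root and v_P' is its composition with the conjugation. If the two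
    agree and their sum is at least 2, both are positive and [qval_dvd] applies; [split_unit]
    supplies g. *)
Lemma chi_exists (p : nat) : prime p -> splits_at p d -> exists Hg, chi_spec p Hg.
Proof.
move=> pp /(splits_root _ _ pp)[r0 [h1 h2]].
have [r [r_root r_simple r_coh]] := hensel pp h1 h2.
pose V := qval t n p r.
have N0 z : z != (0, 0) -> N z != 0 by rewrite (qnorm_eq0 fd d1).
have C0 z : z != (0, 0) -> conj z != (0, 0).
  by move=> /N0 h; rewrite -(qnorm_eq0 fd d1) qnorm_conj.
have VM x y : x != (0, 0) -> y != (0, 0) -> V (mul x y) = (V x + V y)%N.
  by move=> x0 y0; apply: qvalM => //; exact: N0.
have VN z : z != (0, 0) -> (V z + V (conj z) = logn p `|N z|)%N.
  by move=> z0; apply: qval_conj => //; exact: N0.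
have [|H [HM HE]] := @hom_extension (fun z => (V z)%:Z - (V (conj z))%:Z).
  by move=> x y x0 y0; rewrite qconjM !VM ?C0 // !PoszD; ring.
have [u [j [Nu Vu]]] := split_unit fd d1 pp r_root r_coh.
exists (H, qelt u); split=> //=.
- move=> m m0; rewrite -(qelt_int w) HE ?xpair_eqE ?negb_and ?m0 //.
  have -> : conj (m, 0) = (m, 0) by rewrite /qconj /=; congr pair; ring.
  by rewrite subrr.
- move=> z z0; rewrite HE // -VN // => /eqP; rewrite addn_eq0 => /andP[/eqP-> /eqP->].
  by rewrite subrr.
- move=> z z0; rewrite -VN // HE // => h /eqP; rewrite subr_eq0 => /eqP[e].
  apply: (qval_dvd pp r_root r_coh r_simple (N0 _ z0)); rewrite -/(V _).
    by move: h; rewrite -e; case: (V z).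
  by move: h; rewrite e; case: (V (conj z)).
split; last by exists u, j.
have u0 : u != (0, 0).
  by rewrite -(qnorm_eq0 fd d1) Nu eqz_nat -lt0n expn_gt0 prime_gt0.
by rewrite HE // subr_eq0 eqz_nat.
Qed.

(** The unit group of the ring of integers. *)
Definition norm_one_units : set K := [set x | exists2 z, x = qelt z & `|N z|%N = 1%N].

Lemma unit_inverse z : N z != 0 -> (qelt z)^-1 = (N z)%:~R^-1 * qelt (conj z).
Proof.
move=> Nz; have z0 : qelt z != 0 by rewrite (qelt_eq0 gen) -(qnorm_eq0 fd d1).
have Nz' : (N z)%:~R != 0 :> K by rewrite -(rmorph_int (ratK K)) fmorph_eq0 intr_eq0.
by apply: (mulfI z0); rewrite mulfV // mulrCA (qelt_norm gen) mulVf.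
Qed.

Variable S : {fset nat}.
Hypothesis S_prime : forall p, p \in S -> prime p.
Local Notation U := (@S_units K S).

Lemma S_units_subgroup : mul_subgroup U.
Proof.
have UE := S_unitsE gen fd S_prime; split.
- by apply/UE; rewrite invr1 oner_neq0; split=> //; exact: (S_integral_int S K 1).
- move=> x y /UE[x0 ix ix'] /UE[y0 iy iy']; apply/UE; split; first by rewrite mulf_neq0.
    exact: S_integralM.
  by rewrite invfM; exact: S_integralM.
- by move=> x /UE[x0 ix ix']; apply/UE; rewrite invr_eq0 invrK.
- by move=> x /UE[].
Qed.

Lemma S_unit_of_norm (z : int * int) : (supported_in S).-nat `|N z|%N -> U (qelt z).
Proof.
move=> SN; have N0 : N z != 0 by rewrite -absz_gt0; case/andP: SN.
apply/(S_unitsE gen fd S_prime); split.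
- by rewrite (qelt_eq0 gen) -(qnorm_eq0 fd d1).
- by exists 1%N => //; rewrite mul1r; exact: ring_of_integers_qelt gen fd _.
exists `|N z|%N => //; rewrite unit_inverse //.
have Nz' : (N z)%:~R != 0 :> K by rewrite -(rmorph_int (ratK K)) fmorph_eq0 intr_eq0.
have : (`|N z|%N)%:R = (N z)%:~R :> K \/ (`|N z|%N)%:R = - (N z)%:~R :> K.
  have : (`|N z|%N)%:Z = N z \/ (`|N z|%N)%:Z = - N z by lia.
  by case=> e; [left | right]; rewrite -[_%:R]/((`|N z|%N)%:Z%:~R) e ?mulrNz.
case=> ->; first by rewrite mulVKf //; exact: ring_of_integers_qelt gen fd _.
rewrite mulNr mulVKf // -mulN1r; apply: ring_of_integersM.
  exact: (ring_of_integers_int K (-1)).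
exact: ring_of_integers_qelt gen fd _.
Qed.


Lemma nat_S_unit (p : nat) : p \in S -> U p%:R.
Proof.
move=> pS; have -> : p%:R = qelt (p%:Z, 0) by rewrite qelt_int.
apply: S_unit_of_norm; have -> : N (p%:Z, 0) = (p * p)%N%:Z.
  by rewrite /qnorm /= PoszM; ring.
by rewrite absz_nat pnatM pnatE ?S_prime // inE /= pS.
Qed.

(* If m is the least denominator of x and p divides m, then the vanishing of
   the characters makes m x divisible by p, contradicting minimality. *)
Lemma S_unit_kernel (x : K) (psi : nat -> K -> int) (chi : nat -> (K -> int) * K) :
  (forall p, prime p -> is_hom (psi p) /\
     forall z, z != (0, 0) -> psi p (qelt z) = (logn p `|N z|)%:Z) ->
  (forall p, prime p -> splits_at p d -> chi_spec p (chi p)) ->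
  (U x /\ (forall p, p \in S -> psi p x = 0) /\
    (forall p, p \in S -> splits_at p d -> (chi p).1 x = 0)) <-> norm_one_units x.
Proof.
move=> hpsi hchi; split; last first.
  case=> z -> Nz; split; first by apply: S_unit_of_norm; rewrite Nz.
  have z0 : z != (0, 0) by rewrite -(qnorm_eq0 fd d1) -absz_eq0 Nz.
  split=> [p /S_prime pp|p /S_prime pp sp].
    by rewrite (hpsi p pp).2 // Nz logn1.
  by have [_ _ h _ _] := hchi p pp sp; apply: h => //; rewrite Nz logn1.
case=> Ux [psi0 chi0]; have [x0 [k Sk Ok] [l Sl Ol]] := (S_unitsE gen fd S_prime x).1 Ux.
have exm : exists m, (supported_in S).-nat m && `[< O (m%:R * x) >].
  by exists k; rewrite Sk; exact/asboolP.
case: (ex_minnP exm) => m /andP[Sm /asboolP Om] mmin.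
have [z hz] := ring_of_integersP gen fd Om.
have m0 : (0 < m)%N by case/andP: Sm.
have mK0 : m%:R != 0 :> K by rewrite natrK_eq0 -lt0n.
have z0 : z != (0, 0) by rewrite -(qelt_eq0 gen) -hz mulf_neq0.
have mz0 : (m%:Z, 0) != (0, 0) :> (int * int)%type by rewrite xpair_eqE eqxx andbT eqz_nat -lt0n.
have Nm : N (m%:Z, 0) = (m * m)%N%:Z by rewrite /qnorm /= PoszM; ring.
(* As psi p x = 0, N z and N m = m^2 have the same valuation at p. *)
have logz p : p \in S -> logn p `|N z| = (2 * logn p m)%N.
  move=> pS; have [hom val] := hpsi p (S_prime pS).
  have := hom m%:R x mK0 x0; rewrite psi0 // addr0 hz val //.
  have -> : m%:R = qelt (m%:Z, 0) by rewrite qelt_int.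
  by rewrite val // Nm absz_nat lognM // => -[->]; rewrite mul2n addnn.
have m1 : m = 1%N.
  apply/eqP; apply: contraT => m1.
  have pp : prime (pdiv m) by rewrite pdiv_prime // ltn_neqAle eq_sym m1.
  move: (pdiv m) pp (pdiv_dvd m) => p pp pm.
  have pS : p \in S by have := pnat_dvd pm Sm; rewrite pnatE.
  have l1 : (0 < logn p m)%N by rewrite logn_gt0 mem_primes pp m0.
  suff [h1 h2] : (p%:Z %| z.1)%Z /\ (p%:Z %| z.2)%Z.
    have /dvdnP[m' mm'] := pm.
    have Om' : O (m'%:R * x).
      apply: (qelt_div gen fd pp _ h1 h2).
      by rewrite mulrA -natrM mulnC -mm'.
    have Sm' : (supported_in S).-nat m'.
      by apply: pnat_dvd Sm; rewrite mm' dvdn_mulr.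
    have := mmin m'; rewrite Sm' => /(_ ltac:(exact/asboolP)).
    have m'0 : (0 < m')%N by move: m0; rewrite mm' muln_gt0 => /andP[].
    by rewrite mm' leqNgt -[X in (X < _)%N]muln1 ltn_pmul2l // prime_gt1.
  have [sp|nsp] := boolP (splits_at p d).
    have [hom rat0 _ dvd _] := hchi p pp sp; apply: dvd => //.
      by rewrite logz //; lia.
    by rewrite -hz hom // chi0 // addr0 -[m%:R]/(m%:Z%:~R) rat0 // eqz_nat -lt0n.
  apply: (qnorm_dvd_nonsplit fd pp nsp); rewrite dvdzE absz_nat pfactor_dvdn //.
    by rewrite logz //; lia.
  by rewrite absz_gt0 (qnorm_eq0 fd d1).
move: hz; rewrite m1 mul1r => hz; exists z => //.
have [z' hz'] := ring_of_integersP gen fd Ol.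
have e : mul z z' = (l%:Z, 0).
  by apply: (qelt_inj gen); rewrite (qeltM gen) -hz -hz' qelt_int mulrCA divff // mulr1.
(* A prime factor p of N z divides l^2, hence lies in S, where [logz] with m = 1 gives valuation
   0. *)
apply/eqP; apply: contraT => N1; have N0 : N z != 0 by rewrite (qnorm_eq0 fd d1).
have pp : prime (pdiv `|N z|) by rewrite pdiv_prime // ltn_neqAle eq_sym N1 absz_gt0.
move: (pdiv _) pp (pdiv_dvd `|N z|) => p pp pN.
have pS : p \in S.
  have : (p %| l * l)%N.
    have -> : (l * l)%N = `|N (mul z z')|%N by rewrite e /qnorm /=; rewrite -[(l * l)%N]absz_nat PoszM; congr absz; ring.
    by rewrite qnormM abszM dvdn_mulr.
  by rewrite Euclid_dvdM // orbb => pl; have := pnat_dvd pl Sl; rewrite pnatE.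
have := logz p pS; rewrite m1 logn1 muln0 => /eqP; rewrite -leqn0 leqNgt logn_gt0.
by rewrite mem_primes pp absz_gt0 N0 pN.
Qed.

Theorem S_units_cube_reps s : cube_reps norm_one_units s ->
  card_quotient_by_cubes U =
  (3 ^ (#|` S| + count (fun p => splits_at p d) S) * size s)%N.
Proof.
move=> reps.
have /choice[psi hpsi] p : exists H, prime p -> is_hom H /\
     forall z, z != (0, 0) -> H (qelt z) = (logn p `|N z|)%:Z.
  have [pp|np] := boolP (prime p); last by exists (fun _ => 0).
  by have [H hH] := psi_exists pp; exists H.
have /choice[chi hchi] p : exists Hg, prime p -> splits_at p d -> chi_spec p Hg.
  have [pp|np] := boolP (prime p); last by exists (fun _ => 0, 0).
  have [sp|nsp] := boolP (splits_at p d); last by exists (fun _ => 0, 0).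
  by have [Hg hHg] := chi_exists pp sp; exists Hg.
pose H (i : bool * nat) := if i.1 then (chi i.2).1 else psi i.2.
pose g (i : bool * nat) := if i.1 then (chi i.2).2 else i.2%:R.
pose Ssp := [seq p <- S | splits_at p d].
(* The order matters: the characters chi vanish on the rational test elements of psi, whereas psi p
   need not vanish on the test element of chi p, whose norm is a power of p. *)
pose idx := [seq (true, p) | p <- Ssp] ++ [seq (false, p) | p <- S].
have idxP b p : (b, p) \in idx -> [/\ p \in S, prime p & b -> splits_at p d].
  rewrite mem_cat => /orP[] /mapP[q]; last by move=> qS [-> ->]; split=> //; exact: S_prime.
  by rewrite mem_filter => /andP[sq qS] [-> ->]; split=> //; exact: S_prime.
have Nn (p : nat) : N (p%:Z, 0) = (p * p)%N%:Z by rewrite /qnorm /= PoszM; ring.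
have natne (p : nat) : prime p -> (p%:Z, 0) != (0, 0) :> (int * int)%type.
  by move=> pp; rewrite xpair_eqE eqxx andbT eqz_nat -lt0n prime_gt0.
have ntq (p : nat) : p%:R = qelt (p%:Z, 0) by rewrite qelt_int.
have [||||s' reps' ss'] := @cube_reps_chain K _ idx H g U s S_units_subgroup.
- move=> [b p] x y /idxP[pS pp sp] x0 y0; rewrite /H /=; case: b sp => [/(_ isT) sp|_].
    by have [hom _ _ _ _] := hchi p pp sp; exact: hom.
  by apply: (hpsi p pp).1.
- move=> [b p] /idxP[pS pp sp]; rewrite /H /g /=; case: b sp => [/(_ isT) sp|_].
    have [_ _ _ _ [h [z [j [e Nz]]]]] := hchi p pp sp; split=> //; rewrite e.
    by apply: S_unit_of_norm; rewrite Nz absz_nat pnatX pnatE // inE /= pS.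
  split; first exact: nat_S_unit.
  rewrite ntq (hpsi p pp).2 ?natne // Nn absz_nat lognM ?prime_gt0 //.
  by rewrite logn_prime // eqxx.
- rewrite pairwise_cat !pairwise_map; apply/and3P; split.
  + apply/allrelP => _ _ /mapP[p hp ->] /mapP[q qS ->].
    have /idxP[pS pp /(_ isT) sp] : (true, p) \in idx by rewrite mem_cat map_f.
    rewrite /H /g /=; have [_ h _ _ _] := hchi p pp sp.
    by rewrite -[q%:R]/(q%:Z%:~R) h // eqz_nat -lt0n prime_gt0 // S_prime.
  + have : uniq Ssp by rewrite filter_uniq // fset_uniq.
    rewrite uniq_pairwise; apply: (sub_in_pairwise (P := mem Ssp)); last by apply/allP.
    move=> p q hp hq /= pq; rewrite /H /g /=.
    have /idxP[pS pp /(_ isT) sp] : (true, p) \in idx by rewrite mem_cat map_f.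
    have /idxP[qS qq /(_ isT) sq] : (true, q) \in idx by rewrite mem_cat map_f.
    have [_ _ h _ _] := hchi p pp sp; have [_ _ _ _ [h2 [z [j [e Nz]]]]] := hchi q qq sq.
    rewrite e; apply/eqP/h.
      apply: contra h2 => /eqP z0; rewrite e z0; exfalso; move: Nz; rewrite z0.
      have -> : N (0, 0) = 0 by rewrite /qnorm /=; ring.
      by move/esym/eqP; rewrite eqz_nat expn_eq0 => /andP[/eqP q0]; move: qq; rewrite q0.
    by rewrite Nz absz_nat lognX logn_prime // (negbTE pq) muln0.
  + have : uniq S by rewrite fset_uniq.
    rewrite uniq_pairwise; apply: (sub_in_pairwise (P := mem S)); last by apply/allP.
    move=> p q pS qS /= pq; rewrite /H /g /=.
    have pp := S_prime pS; have qq := S_prime qS.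
    rewrite ntq (hpsi p pp).2 ?natne // Nn absz_nat lognM ?prime_gt0 //.
    by rewrite logn_prime // (negbTE pq).
- move: reps; congr (cube_reps _ _); apply/seteqP.
  have hk x := S_unit_kernel x hpsi hchi.
  split=> x /=.
    move/hk=> [Ux [h1 h2]]; split=> // -[b p] /idxP[pS pp sp]; rewrite /H /=.
    by case: b sp => [/(_ isT)|_]; [exact: h2 | exact: h1].
  move=> [Ux h]; apply/hk; split=> //; split=> p pS.
    by apply: (h (false, p)); rewrite mem_cat map_f ?orbT.
  by move=> sp; apply: (h (true, p)); rewrite mem_cat map_f // mem_filter sp.
rewrite (card_quotient_cube_reps S_units_subgroup reps') ss' size_cat !size_map size_filter.
by rewrite addnC.
Qed.

End UnitRank.

(** * Units of the ring of integers modulo cubes *)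

Section Units.
Variables (K : fieldExtType rat) (t n : int) (w : K).
Hypothesis gen : quadratic_gen t n w.
Local Notation d := (t ^+ 2 - 4 * n).
Hypothesis fd : fundamental d.
Hypothesis d1 : d != 1.
Local Notation N := (qnorm t n).
Local Notation mul := (qmul t n).
Local Notation conj := (qconj t).
Local Notation qelt := (qelt w).
Local Notation A0 := (norm_one_units t n w).

Lemma norm_one_units_subgroup : mul_subgroup A0.
Proof.
have N0 z : `|N z|%N = 1%N -> N z != 0 by rewrite -absz_eq0 => ->.
split.
- by exists (1, 0); [rewrite qelt_int | rewrite (_ : N (1, 0) = 1) // /qnorm /=; ring].
- move=> _ _ [u -> hu] [v -> hv]; exists (mul u v); first by rewrite (qeltM gen).
  by rewrite qnormM abszM hu hv.
- move=> _ [z -> hz]; rewrite (unit_inverse gen fd d1 (N0 _ hz)).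
  have [e|e] : N z = 1 \/ N z = -1 by lia.
    by exists (conj z); rewrite ?qnorm_conj // e invr1 mul1r.
  exists (- (conj z).1, - (conj z).2); first by rewrite e invrN1 /qelt /=; ring.
  by rewrite -hz; congr absz; rewrite /qnorm /qconj /=; ring.
- by move=> _ [z -> hz]; rewrite (qelt_eq0 gen) -(qnorm_eq0 fd d1) N0.
Qed.

Lemma trivial_subgroup : mul_subgroup [set 1 : K].
Proof.
split=> [//|x y -> ->|x ->|x ->] /=; by rewrite ?mulr1 ?invr1 ?oner_eq0.
Qed.

Lemma trivial_cube_reps : cube_reps [set 1 : K] [:: 1].
Proof.
split=> //.
- by move=> x; rewrite inE => /eqP.
- by move=> x -> /=; exists 1, 1; rewrite mem_head expr1n mulr1.
- by move=> x y z; rewrite !inE => /eqP -> /eqP ->.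
Qed.

Lemma qnorm4 z : 4 * N z = (2 * z.1 + t * z.2) ^+ 2 - d * z.2 ^+ 2.
Proof. rewrite /qnorm; ring. Qed.

Lemma imaginary_unit z : d < 0 -> `|N z|%N = 1%N ->
  (2 * z.1 + t * z.2) ^+ 2 - d * z.2 ^+ 2 = 4.
Proof.
move=> d0 Nz; have := qnorm4 z; have := sqr_ge0 (2 * z.1 + t * z.2); have := sqr_ge0 z.2.
move: (_ ^+ 2) ((2 * _ + _) ^+ 2) => u v u0 v0 e.
have : 0 <= - d * u by rewrite mulr_ge0 // oppr_ge0 ltW.
move: e; rewrite mulNr; move: (d * u) => du; lia.
Qed.

(** T^2 - d b^2 = 4 leaves b = 0, where the unit is 1 or -1, or T = 0, where its square is -1. So
    fourth powers are trivial, and 4 is prime to 3. *)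
Lemma unit_cubes_imaginary : d < -3 -> exists2 s, cube_reps A0 s & size s = 1%N.
Proof.
move=> d3; exists [:: 1] => //.
apply: (@cube_reps_pow K A0 [set 1] 4) => //.
- exact: norm_one_units_subgroup.
- exact: trivial_subgroup.
- by move=> x ->; have [] := norm_one_units_subgroup.
- move=> _ [z -> Nz] /=; have := imaginary_unit (lt_trans d3 (isT : (-3 : int) < 0)) Nz.
  set T := 2 * z.1 + t * z.2 => e.
  have sq : qelt z ^+ 2 = T%:~R * qelt z - 1.
    have N1 : N z = 1 by have := qnorm4 z; rewrite e; lia.
    transitivity (qelt z * (qelt z + qelt (conj z)) - qelt z * qelt (conj z)); first by ring.
    by rewrite (qelt_norm gen) N1 /T /qelt /qconj /=; ring.
  have [z2|z2] := eqVneq z.2 0.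
    have : T = 2 \/ T = -2.
      have : (T - 2) * (T + 2) = 0.
        by transitivity (T ^+ 2 - d * z.2 ^+ 2 - 4); [rewrite z2; ring | rewrite e].
      by move/eqP; rewrite mulf_eq0 => /orP[] /eqP; lia.
    have ez : qelt z = z.1%:~R by rewrite /qelt z2 mul0r addr0.
    rewrite /T z2 mulr0 addr0 ez => hT.
    have : z.1 = 1 \/ z.1 = -1 by lia.
    by case=> ->; ring.
  have : T = 0.
    have : 1 <= z.2 ^+ 2 by rewrite -(expr1n _ 2%N); move: z2; nia.
    have := sqr_ge0 T; move: e; move: (z.2 ^+ 2) => u e T0 u1.
    have : T ^+ 2 = 0 by move: e T0 d3 u1; move: (T ^+ 2) d => v d'; nia.
    by move/eqP; rewrite expf_eq0 /= => /eqP.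
  move=> T0; rewrite (exprM _ 2 2) sq T0 mul0r add0r; ring.
- exact: trivial_cube_reps.
Qed.

(** T^2 + 3 b^2 = 4 forces |T| <= 2 and |b| <= 1, which leaves 5 times 3 candidates. *)
Lemma unit_cubes_eisenstein : d = -3 -> exists2 s, cube_reps A0 s & (size s <= 15)%N.
Proof.
move=> d3; pose r k : seq int := [seq i%:Z - k%:Z | i <- iota 0 (2 * k + 1)].
have rP k (x : int) : `|x| <= k%:Z -> x \in r k.
  move=> h; apply/mapP; exists `|(x + k%:Z)%R|%N; first by rewrite mem_iota; lia.
  by lia.
pose s := [seq (T%:~R + b%:~R * (2 * w - t%:~R)) / 2 | T <- r 2%N, b <- r 1%N].
have [|s' reps ss'] := @cube_reps_finite K A0 s norm_one_units_subgroup.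
  move=> _ [z -> Nz]; have := imaginary_unit _ Nz; rewrite d3 => /(_ isT) e.
  apply/allpairsP; exists (2 * z.1 + t * z.2, z.2); split=> /=.
  - by apply: rP; move: e; set T := 2 * z.1 + t * z.2; move: T z.2 => u v; nia.
  - by apply: rP; move: e; set T := 2 * z.1 + t * z.2; move: T z.2 => u v; nia.
  - have two0 : 2%:R != 0 :> K by rewrite natrK_eq0.
    by rewrite /qelt; field.
by exists s' => //; rewrite (leq_trans ss') // size_allpairs !size_map !size_iota.
Qed.


(* Passing to totally positive units of norm 1 changes the index by a power of
   2; on these x |-> x + x^-1 is the trace, so a least unit exceeding 1 exists
   and generates. *)
Lemma unit_cubes_real (R : realType) : 0 < d -> exists2 s, cube_reps A0 s & size s = 3%N.
Proof.
move=> d0; pose e : R := (t%:~R + Num.sqrt d%:~R) / 2.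
have he : e ^+ 2 = t%:~R * e - n%:~R.
  transitivity ((t%:~R ^+ 2 + 2 * t%:~R * Num.sqrt d%:~R + Num.sqrt d%:~R ^+ 2) / 4 : R).
    by rewrite /e; field.
  by rewrite sqr_sqrtr ?ler0z ?ltW // /e; field.
have [f _] := quadratic_gen_lift gen (@ratr R) he.
have gA := norm_one_units_subgroup; have [A01 AM AV A00] := gA.
have f0 x : x != 0 -> f x != 0 by rewrite fmorph_eq0.
pose A1 : set K := [set x | (exists2 z, x = qelt z & N z = 1) /\ 0 < f x].
have A1A x : A1 x -> A0 x by move=> [[z -> Nz] _]; exists z => //; rewrite Nz.
have tr z : N z = 1 -> f (qelt z) + (f (qelt z))^-1 = (2 * z.1 + t * z.2)%:~R.
  move=> Nz; rewrite -fmorphV (unit_inverse gen fd d1) ?Nz // invr1 mul1r -rmorphD.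
  have -> : qelt z + qelt (conj z) = (2 * z.1 + t * z.2)%:~R.
    by rewrite /qelt /qconj /=; ring.
  by rewrite rmorph_int.
have gA1 : mul_subgroup A1.
  split.
  - split; last by rewrite rmorph1.
    by exists (1, 0); [rewrite qelt_int | rewrite /qnorm /=; ring].
  - move=> _ _ [[u -> hu] fu] [[v -> hv] fv]; split; last by rewrite rmorphM mulr_gt0.
    by exists (mul u v); rewrite ?(qeltM gen) // qnormM hu hv.
  - move=> _ [[z -> hz] fz]; split; last by rewrite fmorphV invr_gt0.
    exists (conj z); rewrite ?qnorm_conj //.
    by rewrite (unit_inverse gen fd d1) hz // invr1 mul1r.
  - by move=> x /A1A; exact: A00.
have [A11 A1M A1V A10] := gA1.
pose P (k : nat) := `[< exists z, [/\ N z = 1, 1 < f (qelt z) & `|2 * z.1 + t * z.2|%R = k%:Z] >].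
have exP : exists k, P k.
  (* Up to sign and conjugation, a Pell solution becomes a unit greater than 1. *)
  have [z [Nz z2]] := pell R fd d1 d0.
  have PI u : N u = 1 -> 1 < f (qelt u) -> exists k, P k.
    move=> Nu fu; exists `|(2 * u.1 + t * u.2)%R|%N; apply/asboolP; exists u; split=> //.
  have N0 u : N u = 1 -> f (qelt u) != 0.
    by move=> Nu; apply: f0; rewrite (qelt_eq0 gen) -(qnorm_eq0 fd d1) Nu.
  have pos u : N u = 1 -> u.2 != 0 -> 0 < f (qelt u) -> exists k, P k.
    move=> Nu u2 fu; have [|lt1|f1] := ltgtP 1 (f (qelt u)); first exact: PI.
      apply: (PI (conj u)); first by rewrite qnorm_conj.
      have -> : qelt (conj u) = (qelt u)^-1.
        by rewrite (unit_inverse gen fd d1) Nu // invr1 mul1r.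
      by rewrite fmorphV invf_gt1.
    move/eqP: u2; case; have /(fmorph_inj f) : f (qelt (1, 0)) = f (qelt u).
      by rewrite -f1 qelt_int rmorph1.
    by move/(qelt_inj gen) => <-.
  have [fz|fz] := ltP 0 (f (qelt z)); first exact: (pos z).
  apply: (pos (- z.1, - z.2)) => /=.
  - by rewrite -Nz /qnorm /=; ring.
  - by rewrite oppr_eq0.
  - have -> : qelt (- z.1, - z.2) = - qelt z by rewrite /qelt /=; ring.
    by rewrite rmorphN oppr_gt0 lt_neqAle fz andbT N0.
case: (ex_minnP exP) => k /asboolP[z [Nz fz Tz]] kmin.
set eps := qelt z in fz.
have A1eps : A1 eps by split; [exists z | exact: lt_trans fz].
have least x : A1 x -> 1 < f x -> f eps <= f x.
  move=> [[u -> Nu] _] fu; rewrite leNgt; apply/negP=> lt.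
  have : (k <= `|(2 * u.1 + t * u.2)%R|%N)%N.
    by apply: kmin; apply/asboolP; exists u; split.
  rewrite -lez_nat -Tz abszE -(ler_int R) !intr_norm -!tr //.
  have fx0 : 0 < f (qelt u) by exact: lt_trans fu.
  have fe0 : 0 < f eps by exact: lt_trans fz.
  have nn v : 0 < f v -> 0 <= f v + (f v)^-1 by move=> h; rewrite addr_ge0 ?invr_ge0 ?ltW.
  rewrite (ger0_norm (nn _ fx0)) (ger0_norm (nn _ fe0)) -/eps leNgt => /negP; apply.
  rewrite -subr_gt0.
  have -> : f eps + (f eps)^-1 - (f (qelt u) + (f (qelt u))^-1) =
     (f eps - f (qelt u)) * (1 - (f (qelt u) * f eps)^-1).
    by field; rewrite !gt_eqF.
  rewrite mulr_gt0 // ?subr_gt0 // invf_lt1 ?mulr_gt0 //.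
  by rewrite -[ltLHS]mulr1 ltr_pM.
have le0 : 0 < ln (f eps) by exact: ln_gt0.
have reps1 : cube_reps A1 [seq eps ^+ i * y | i <- iota 0 3, y <- [:: 1]].
  apply: (@cube_reps_step K A1 [set 1] eps) => //.
  - exact: trivial_subgroup.
  - by move=> x ->.
  (* This exponent m gives 1 <= f (x eps^(- m)) < f eps, so the quotient is 1 by the minimality of
     eps. *)
  - move=> x A1x; exists (Num.floor (ln (f x) / ln (f eps))).
    set m := Num.floor _; set y := x * _.
    have A1y : A1 y by apply: (A1M) => //; exact: mul_subgroup_expz.
    have lnZ (j : int) : ln (f (eps ^ j)) = j%:~R * ln (f eps).
      have fe0 : 0 < f eps by exact: lt_trans fz.
      case: j => j; first by rewrite -exprnP rmorphXn lnXn //= -mulr_natl.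
      rewrite NegzE -exprz_inv -exprnP rmorphXn fmorphV lnXn ?invr_gt0 //.
      by rewrite lnV //= -mulr_natl mulrN -mulNr intrN.
    have lny : ln (f y) = ln (f x) - m%:~R * ln (f eps).
      rewrite rmorphM lnM ?posrE; first by rewrite lnZ intrN mulNr.
        by case: A1x.
      by case: (mul_subgroup_expz (- m) gA1 A1eps).
    have /andP[h1 h2] := floor_itv (ln (f x) / ln (f eps)).
    rewrite -/m ler_pdivlMr // in h1; rewrite -/m ltr_pdivrMr // intrD mulrDl mul1r in h2.
    have fy0 : 0 < f y by case: A1y.
    have y1 : ~~ (1 < f y).
      apply/negP => /(least y A1y) h3.
      have : ln (f eps) <= ln (f y) by rewrite ler_ln ?posrE // (lt_trans ltr01 fz).
      by rewrite lny lerBrDl leNgt h2.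
    have y2 : ~~ (f y < 1).
      apply/negP=> h3; have : ln (f y) < 0 by apply: ln_lt0; rewrite fy0.
      by rewrite lny subr_lt0 ltNge h1.
    rewrite -leNgt in y1; rewrite -leNgt in y2.
    have fy1 : f y = f 1 by rewrite rmorph1; apply/eqP; rewrite eq_le y1 y2.
    exact: (fmorph_inj f fy1).
  - move=> j /= ej; have lnj : (f eps) ^ j == 1 by rewrite -fmorphXz ej rmorph1.
    move: lnj; rewrite pexprz_eq1 ?(ltW (lt_trans ltr01 fz)) // => /orP[/eqP//|].
    by rewrite gt_eqF.
  - exact: trivial_cube_reps.
exists [seq eps ^+ i * y | i <- iota 0 3, y <- [:: 1]] => //.
apply: (@cube_reps_pow K A0 A1 2) => //.
move=> x A0x; have x0 := A00 _ A0x; split; last first.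
  by rewrite rmorphXn exprn_even_gt0 // f0.
case: A0x => u -> Nu; exists (mul u u); first by rewrite (qeltM gen) expr2.
by rewrite qnormM; have [->|->] : N u = 1 \/ N u = -1 by lia.
Qed.

End Units.

(** * Isomorphism classes and discriminants *)

Lemma quadratic_disc (K : fieldExtType rat) : quadratic K ->
  fundamental (discriminant K) /\ discriminant K != 1.
Proof.
by move=> /quadratic_genP[t [n [w [gK fd d1]]]]; rewrite (discriminantE gK fd).
Qed.

Lemma isomorphic_same_disc (K L : fieldExtType rat) : quadratic K -> quadratic L ->
  discriminant K = discriminant L -> field_isomorphic K L.
Proof.
move=> /quadratic_genP[t [n [w [gK fd _]]]] /quadratic_genP[t' [n' [w' [gL fd' _]]]].
by rewrite (discriminantE gK fd) (discriminantE gL fd'); exact: isomorphic_of_disc gK gL.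
Qed.

Lemma exists_disc (d : int) : fundamental d -> d != 1 ->
  exists2 K : fieldExtType rat, quadratic K & discriminant K = d.
Proof.
move=> fd d1; have [t [n dE]] := fundamental_form fd; subst d.
have [K [w gK]] := quadratic_gen_exists fd d1.
by exists K; [exact: quadratic_gen_quadratic gK | exact: discriminantE gK fd].
Qed.

(** * Averages *)

Section Average.
Variables (R : realType) (sg : int).
Hypothesis sg2 : sg ^+ 2 = 1.
Variable S : {fset nat}.
Hypothesis S_prime : forall p, p \in S -> prime p.
Variables (F : fieldExtType rat -> Prop) (f : fieldExtType rat -> nat) (c C : nat).
Hypothesis c0 : (0 < c)%N.
Hypothesis F_disc : forall K, F K <-> quadratic K /\ 0 < sg * discriminant K.
Hypothesis f_generic : forall K, F K -> discriminant K != -3 ->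
  f K = (c * 3 ^ count (fun p => splits_at p (discriminant K)) S)%N.
Hypothesis f_bound : forall K, F K -> (f K <= C)%N.

(* 1 satisfies [fundamental] but is not the discriminant of a quadratic field. *)
Definition is_disc (e : nat) : bool := `[< fundamental (sg * e%:Z) >] && (sg * e%:Z != 1).

Definition absdisc (K : fieldExtType rat) : nat := `|discriminant K|%N.

Lemma discE K : F K -> discriminant K = sg * (absdisc K)%:Z.
Proof.
by move=> /F_disc[_]; rewrite /absdisc; have [->|->] := sgP sg2; lia.
Qed.

Lemma absdiscP K : F K -> is_disc (absdisc K).
Proof.
move=> FK; rewrite /is_disc -discE //; have [qK _] := (F_disc K).1 FK.
by have [fd ->] := quadratic_disc qK; rewrite andbT; apply/asboolP.
Qed.

Lemma is_disc_gt0 e : is_disc e -> (0 < e)%N.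
Proof.
case: e => // /andP[/asboolP/fundamental2]; by rewrite mulr0 mod0z.
Qed.

Lemma field_of_absdisc e : is_disc e -> exists2 K, F K & absdisc K = e.
Proof.
move=> de; have e0 := is_disc_gt0 de; case/andP: de => /asboolP fe e1.
have [K qK dK] := exists_disc fe e1; exists K.
  apply/F_disc; split=> //; rewrite dK mulrA -expr2 sg2 mul1r; lia.
by rewrite /absdisc dK abszM; have [->|->] := sgP sg2; rewrite mul1n.
Qed.

Lemma absdisc_isomorphic K L : F K -> F L -> field_isomorphic K L <-> absdisc K = absdisc L.
Proof.
move=> FK FL; have [qK _] := (F_disc K).1 FK; have [qL _] := (F_disc L).1 FL.
split=> [/(isomorphic_disc qK qL) e|e]; first by rewrite /absdisc e.
by apply: isomorphic_same_disc => //; rewrite !discE // e.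
Qed.

Lemma nat_cutoff (X : R) : exists n, forall e : nat, (e%:R < X) = (e < n)%N.
Proof.
have exn : exists n : nat, X <= n%:R.
  exists (Num.trunc `|X|).+1; apply: le_trans (ler_norm X) _.
  by have /andP[_ /ltW] := trunc_itv (normr_ge0 X).
case: (ex_minnP exn) => n Xn nmin; exists n => e; apply/idP/idP.
  by move=> eX; rewrite -(ltr_nat R); exact: lt_le_trans Xn.
by move=> en; rewrite ltNge; apply/negP => /nmin; rewrite leqNgt en.
Qed.

Lemma lt_absdisc K (X : R) n : (forall e : nat, (e%:R < X) = (e < n)%N) ->
  (`|discriminant K|%:~R < X) = (absdisc K < n)%N.
Proof. by move=> <-; rewrite /absdisc natr_absz. Qed.

Lemma exists_enumeration (X : R) : exists (N : nat) (k : 'I_N -> fieldExtType rat),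
  enumerates_below F X k.
Proof.
have [n hn] := nat_cutoff X; pose E := [seq e <- iota 0 n | is_disc e].
have uE : uniq E by rewrite filter_uniq // iota_uniq.
have memE e : (e \in E) = is_disc e && (e < n)%N by rewrite mem_filter mem_iota.
have /choice[k hk] (i : 'I_(size E)) : exists K, F K /\ absdisc K = nth 0%N E i.
  have : nth 0%N E i \in E by rewrite mem_nth.
  by rewrite memE => /andP[/field_of_absdisc[K FK dK] _]; exists K.
exists (size E), k; split.
- move=> i; have [Fk dk] := hk i; split=> //; rewrite (lt_absdisc _ hn) dk.
  have : nth 0%N E i \in E by rewrite mem_nth.
  by rewrite memE => /andP[].
- move=> i j; have [Fi di] := hk i; have [Fj dj] := hk j.
  move=> /(absdisc_isomorphic Fi Fj); rewrite di dj => /eqP.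
  by rewrite nth_uniq // => /eqP /val_inj.
move=> K FK; rewrite (lt_absdisc _ hn) => Kn.
have KE : absdisc K \in E by rewrite memE absdiscP.
have lt : (index (absdisc K) E < size E)%N by rewrite index_mem.
exists (Ordinal lt); have [Fi di] := hk (Ordinal lt).
by apply/(absdisc_isomorphic FK Fi); rewrite di /= nth_index.
Qed.

(** Within F the absolute discriminant determines the field up to isomorphism, and every e with
    [is_disc] e occurs; hence all choices of representatives lead to the same sums over integers. *)
Lemma enumeration_perm (X : R) n N (k : 'I_N -> fieldExtType rat) :
  (forall e : nat, (e%:R < X) = (e < n)%N) -> enumerates_below F X k ->
  perm_eq [seq absdisc (k i) | i <- enum 'I_N] [seq e <- iota 0 n | is_disc e].
Proof.
move=> hn [h1 h2 h3]; apply: uniq_perm.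
- rewrite map_inj_uniq ?enum_uniq // => i j e; apply: h2.
  by apply/(absdisc_isomorphic (h1 i).1 (h1 j).1).
- by rewrite filter_uniq // iota_uniq.
move=> e; rewrite mem_filter mem_iota add0n /=; apply/mapP/andP.
  case=> i _ ->; have [Fi] := h1 i; rewrite (lt_absdisc _ hn) => lt.
  by rewrite absdiscP.
case=> /field_of_absdisc[K FK dK] en.
have [i iso] := h3 K FK ltac:(by rewrite (lt_absdisc _ hn) dK).
by exists i; rewrite ?mem_enum // -dK; apply/(absdisc_isomorphic FK (h1 i).1).
Qed.

Lemma sum_is_disc (n : nat) (u : nat -> nat) :
  (\sum_(e <- iota 0 n | is_disc e) u e <=
     \sum_(0 <= e < n) `[< fundamental (sg * e%:Z) >] * u e)%N /\
  (\sum_(0 <= e < n) `[< fundamental (sg * e%:Z) >] * u e <=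
     \sum_(e <- iota 0 n | is_disc e) u e + u 1)%N.
Proof.
have E : (\sum_(e <- iota 0 n | is_disc e) u e = \sum_(0 <= e < n) is_disc e * u e)%N.
  rewrite /index_iota subn0 big_mkcond; apply: eq_bigr => e _.
  by case: is_disc; rewrite ?mul1n ?mul0n.
rewrite E /is_disc; split.
  apply: leq_sum => e _; rewrite leq_mul2r; apply/orP; right.
  by case: `[< _ >]; case: (_ != _).
apply: (@leq_trans (\sum_(0 <= e < n) is_disc e * u e + \sum_(0 <= e < n) (e == 1) * u e)%N).
  rewrite -big_split /=; apply: leq_sum => e _; rewrite /is_disc.
  case: asboolP => //= _; have [e1|] := eqVneq (sg * e%:Z) 1; last by rewrite mul1n leq_addr.
  have -> : e = 1%N by move: e1; have [->|->] := sgP sg2; lia.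
  by rewrite eqxx.
rewrite leq_add2l; have [n1|n1] := leqP n 1.
  case: n n1 {E} => [|[|]] // _; first by rewrite big_geq.
  by rewrite big_nat1.
rewrite (bigD1_seq 1%N) ?mem_index_iota ?iota_uniq //= mul1n big1 ?addn0 // => e /negbTE ->.
by rewrite mul0n.
Qed.

Lemma sum_indicator_le (r : seq nat) : uniq r -> (\sum_(e <- r) (e == 3) <= 1)%N.
Proof.
move=> ur; rewrite -big_mkcond /= sum1_count.
by rewrite (eq_count (a2 := pred1 3%N)) // count_uniq_mem //; case: (_ \in _).
Qed.

(** With n the integer cutoff for X, the sum of f is c A(n) up to D, the number of fields is B(n) up
    to 1, and [weight_density] compares A with rho B. The bounded errors disappear because B(n) >= n
    / 8. *)
Lemma average_of_density :
  average_is F f (c%:R * \prod_(p <- S) (1 + p%:R / (p%:R + 1)) : R).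
Proof.
split; first exact: exists_enumeration.
move=> N k hk; rewrite -/(split_density R S); set rho := split_density R S.
have rho0 : 0 <= rho := split_density_ge0 R S.
pose g e := (3 ^ count (fun p => splits_at p (sg * e%:Z)) S)%N.
(* C + c g(3) pays for a field with |d| = 3, and c g(1) for the term e = 1, which [weight] may
   count. *)
pose D : R := (C + c * g 3 + c * g 1)%N%:R.
have /choice[nX hnX] X := nat_cutoff X.
pose A n : R := (\sum_(0 <= e < n) weight sg S e)%N%:R.
pose B n : R := (\sum_(0 <= e < n) weight sg fset0 e)%N%:R.
pose s X : R := \sum_(i < N X) (f (k X i))%:R.
have NB X : `|(N X)%:R - B (nX X)| <= 1.
  have p := enumeration_perm (hnX X) (hk X).
  have -> : N X = (\sum_(e <- iota 0 (nX X) | is_disc e) 1)%N.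
    rewrite sum1_count -size_filter -(perm_size p) size_map.
    by rewrite size_enum_ord.
  have [] := sum_is_disc (nX X) (fun _ => 1%N).
  rewrite -!(ler_nat R) natrD.
  have -> : (\sum_(0 <= e < nX X) `[< fundamental (sg * e%:Z) >] * 1)%N%:R = B (nX X).
    by congr (_%:R); apply: eq_bigr => e _; rewrite /weight.
  by rewrite ler_norml; lra.
have sA X : `|s X - c%:R * A (nX X)| <= D.
  have p := enumeration_perm (hnX X) (hk X).
  pose e i := absdisc (k X i).
  have Fk i : F (k X i) by have [h _ _] := hk X; exact: (h i).1.
  have sE : (\sum_(i < N X) g (e i) = \sum_(e <- iota 0 (nX X) | is_disc e) g e)%N.
    rewrite -big_filter -(perm_big _ p) big_map /=.
    by rewrite big_enum.
  have [] := sum_is_disc (nX X) g; rewrite -sE.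
  have -> : (\sum_(0 <= e < nX X) `[< fundamental (sg * e%:Z) >] * g e =
    \sum_(0 <= e < nX X) weight sg S e)%N by [].
  rewrite -!(ler_nat R) natrD -/(A _) => h1 h2.
  have h3 : `|s X - c%:R * (\sum_(i < N X) g (e i))%N%:R| <= (C + c * g 3)%N%:R.
    rewrite /s natr_sum mulr_sumr -sumrB.
    apply: le_trans (ler_norm_sum _ _ _) _.
    apply: (@le_trans _ _ (\sum_(i < N X) (C + c * g 3)%N%:R * (e i == 3%N)%:R)).
      apply: ler_sum => i _; have [e3|e3] := eqVneq (e i) 3%N.
        rewrite mulr1 e3 natrD natrM; apply: le_trans (ler_normB _ _) _.
        by rewrite normrM !normr_nat lerD2r ler_nat f_bound.
      rewrite mulr0 f_generic //; last first.
        by apply: contra e3 => /eqP h; rewrite /e /absdisc h.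
      by rewrite (discE (Fk i)) -/(e i) natrM subrr normr0.
    rewrite -mulr_sumr -natr_sum ler_piMr // lern1.
    have := sum_indicator_le (r := [seq absdisc (k X i) | i <- enum 'I_(N X)]).
    rewrite (perm_uniq p) filter_uniq ?iota_uniq // => /(_ isT).
    by rewrite big_map big_enum.
  have c0' : 0 <= c%:R :> R by [].
  rewrite /D natrD (natrM _ c (g 1)).
  move: h3; rewrite !ler_norml; move: (_%:R) h1 h2 => x h1 h2.
  have h4 : c%:R * x <= c%:R * A (nX X) by rewrite ler_wpM2l.
  have h5 : c%:R * A (nX X) <= c%:R * (x + (g 1)%:R) by rewrite ler_wpM2l.
  by move: h4 h5; rewrite mulrDr; lra.
apply/cvgrPdist_le => eps eps0.
have cR : 0 < c%:R :> R by rewrite ltr0n.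
have d0 : 0 < eps / (4 * c%:R) by rewrite divr_gt0 // mulr_gt0.
have [n0 hn0] := weight_density sg2 S_prime d0.
pose E : R := D + c%:R * rho + eps.
have D0 : 0 <= D by [].
have E0 : 0 <= E by rewrite /E !addr_ge0 ?mulr_ge0 // ltW.
(* Beyond this bound B is at least 2 + 4 E / eps, so there are at least 1 + 4 E / eps fields, and E,
   which collects the bounded errors, is at most eps / 4 times their number. *)
exists (n0%:R + 8 * (2 + 4 * E / eps)); split; first exact: num_real.
move=> X hX /=.
have nXge : X <= (nX X)%:R by rewrite leNgt hnX ltnn.
have q0 : 0 <= 4 * E / eps by rewrite divr_ge0 ?mulr_ge0 // ltW.
have n0X : (n0 <= nX X)%N by rewrite -(ler_nat R); lra.
have [h1 h2] := hn0 _ n0X.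
rewrite -/(A _) -/(B _) -/rho in h1 h2.
have hN := NB X; have hs := sA X.
have n00 : 0 <= n0%:R :> R by [].
have N1 : 1 + 4 * E / eps <= (N X)%:R.
  move: hN; rewrite ler_norml => /andP[hN _].
  by move: hX nXge q0 h2 hN n00; move: (4 * E / eps) (B _) => q b; lra.
have Npos : 0 < (N X)%:R :> R by lra.
rewrite -/(s X); have -> : c%:R * rho - s X / (N X)%:R =
    - ((s X - c%:R * rho * (N X)%:R) / (N X)%:R) by field; rewrite gt_eqF.
rewrite normrN normrM normfV (ger0_norm (ltW Npos)) ler_pdivrMr //.
have -> : s X - c%:R * rho * (N X)%:R = (s X - c%:R * A (nX X)) +
  c%:R * (A (nX X) - rho * B (nX X)) - (c%:R * rho) * ((N X)%:R - B (nX X)) by ring.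
have h3 : c%:R * `|A (nX X) - rho * B (nX X)| <= eps / 4 * B (nX X).
  have -> : eps / 4 * B (nX X) = c%:R * (eps / (4 * c%:R) * B (nX X)) by field; rewrite gt_eqF.
  by rewrite ler_pM2l.
have h4 : c%:R * rho * `|(N X)%:R - B (nX X)| <= c%:R * rho.
  by rewrite ler_piMr // mulr_ge0.
have h5 : eps + 4 * E <= eps * (N X)%:R.
  have := ler_wpM2l (ltW eps0) N1; rewrite mulrDr mulr1.
  by have -> : eps * (4 * E / eps) = 4 * E by field; rewrite gt_eqF.
have h6 : eps / 4 * B (nX X) <= eps / 4 * ((N X)%:R + 1).
  by rewrite ler_wpM2l ?divr_ge0 ?(ltW eps0) //; move: hN; rewrite ler_norml; lra.
apply: le_trans (ler_normB _ _) _; apply: le_trans (lerD (ler_normD _ _) (lexx _)) _.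
rewrite !normrM (ger0_norm (ltW cR)) (ger0_norm rho0).
by rewrite /E in h5 E0; lra.
Qed.

End Average.

Theorem theorem5 (R : realType) (S : {fset nat})
    (S_prime : forall p, p \in S -> prime p) :
  average_is real_quadratic
    (fun K => card_quotient_by_cubes (@S_units K S))
    (3 ^+ (#|` S|%fset).+1 * \prod_(p <- S) (1 + p%:R / (p%:R + 1)) : R) /\
  average_is imaginary_quadratic
    (fun K => card_quotient_by_cubes (@S_units K S))
    (3 ^+ #|` S|%fset * \prod_(p <- S) (1 + p%:R / (p%:R + 1)) : R).
Proof.
have count_bound d : (3 ^ (#|` S| + count (fun p => splits_at p d) S) <= 3 ^ (#|` S| + #|` S|))%N.
  by rewrite leq_exp2l // leq_add2l count_size.
split.
  (* The constant c contains the factor 3 of the fundamental unit. In C, the number of split primes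
     is bounded by |S|, and 15 exceeds the factor 3. *)
  rewrite -natrX; apply: (@average_of_density R 1 _ S S_prime _ _ _ (3 ^ (#|` S| + #|` S|) * 15)).
  - by rewrite expr1n.
  - by rewrite expn_gt0.
  - move=> K; rewrite mul1r; split=> [rK|[qK d0]].
      have qK := rK.1; split=> //; have [t [n [w [gK fd d1]]]] := quadratic_genP qK.
      by rewrite (discriminantE gK fd); apply/(real_quadraticE gK fd).
    have [t [n [w [gK fd d1]]]] := quadratic_genP qK; apply/(real_quadraticE gK fd).
    by rewrite -(discriminantE gK fd).
  - move=> K rK _; have [t [n [w [gK fd d1]]]] := quadratic_genP rK.1.
    have [s reps s3] := unit_cubes_real gK fd d1 R ((real_quadraticE gK fd).1 rK).
    by rewrite (S_units_cube_reps gK fd d1 S_prime reps) s3 (discriminantE gK fd) expnD expnS; ring.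
  - move=> K rK; have [t [n [w [gK fd d1]]]] := quadratic_genP rK.1.
    have [s reps s3] := unit_cubes_real gK fd d1 R ((real_quadraticE gK fd).1 rK).
    by rewrite (S_units_cube_reps gK fd d1 S_prime reps) s3 leq_mul.
rewrite -natrX; apply: (@average_of_density R (-1) _ S S_prime _ _ _ (3 ^ (#|` S| + #|` S|) * 15)).
- by rewrite sqrrN expr1n.
- by rewrite expn_gt0.
- move=> K; rewrite mulN1r oppr_gt0; split=> [iK|[qK d0]].
    have qK := iK.1; split=> //; have [t [n [w [gK fd d1]]]] := quadratic_genP qK.
    by rewrite (discriminantE gK fd); apply/(imaginary_quadraticE gK fd).
  have [t [n [w [gK fd d1]]]] := quadratic_genP qK; apply/(imaginary_quadraticE gK fd).
  by rewrite -(discriminantE gK fd).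
- move=> K iK; have [t [n [w [gK fd d1]]]] := quadratic_genP iK.1.
  rewrite (discriminantE gK fd) => d3; have d0 := (imaginary_quadraticE gK fd).1 iK.
  (* The values -1 and -2 have forbidden residues modulo 16. *)
  have lt3 : t ^+ 2 - 4 * n < -3.
    by move: d0 d3; have := fundamental2 fd; rewrite !inE; move: (_ - _) => d; lia.
  have [s reps s1] := unit_cubes_imaginary gK fd d1 lt3.
  by rewrite (S_units_cube_reps gK fd d1 S_prime reps) s1 muln1 expnD.
- move=> K iK; have [t [n [w [gK fd d1]]]] := quadratic_genP iK.1.
  have d0 := (imaginary_quadraticE gK fd).1 iK.
  have [d3|d3] := eqVneq (t ^+ 2 - 4 * n) (-3).
    have [s reps s15] := unit_cubes_eisenstein gK fd d1 d3.
    by rewrite (S_units_cube_reps gK fd d1 S_prime reps) leq_mul.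
  have lt3 : t ^+ 2 - 4 * n < -3.
    by move: d0 d3; have := fundamental2 fd; rewrite !inE; move: (_ - _) => d; lia.
  have [s reps s1] := unit_cubes_imaginary gK fd d1 lt3.
  by rewrite (S_units_cube_reps gK fd d1 S_prime reps) s1 leq_mul.
Qed.
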